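(* Let $n\ge 1$ be an integer, $1<p<\infty$ and let $w$ be a parabolic $A_p$ weight on $\mathbb{R}^{n+1}$. Then there exist constants $\delta>0$ and $c>0$, depending only on $n$, $p$ and $[w]_p$, such that with $$k=\frac{n+2}{n+1}+\delta>1$$ the following holds for every $r>0$. If $u\in W^{2,1}_1(Q_r)$ and $u_t,|D^2u|\in L^p_w(Q_r)$, then $Du\in L^{pk}_w(Q_r,\mathbb{R}^n)$ and $$\left(\frac{1}{w(Q_r)}\int_{Q_r} |Du-(Du)_{Q_r}|^{pk}\,w\,dz \right)^{\frac{1}{pk}} \le c\,r \left(\frac{1}{w(Q_r)}\int_{Q_r}\left[|D^2u|^p+|u_t|^p\right]w\,dz\right)^{\frac{1}{p}}.$$
   Context: Points of $\mathbb{R}^{n+1}=\mathbb{R}^n\times\mathbb{R}$ are written $z=(x,t)$, $dz=dx\,dt$. For $r>0$ and $z=(x,t)$: $K_r(x)=\{y\in\mathbb{R}^n:|x_i-y_i|<r,\ i=1,\dots,n\}$, and the parabolic cube is $Q_r(z)=K_r(x)\times(t-r^2,t+r^2)$. When the center is the origin it is omitted: $Q_r=Q_r(0)$. $Du=D_xu$ and $D^2u=D_x^2u$ are the spatial gradient and spatial Hessian, $u_t$ the time derivative (all weak). $(g)_U=\frac1{|U|}\int_U g\,dz$ (componentwise for vector-valued $g$). $W^{2,1}_1(U)$ is the space of functions $u$ on $U$ such that $u,u_t,Du,D^2u$ exist in $L^1(U)$. A weight $w$ is a nonnegative locally integrable function on $\mathbb{R}^{n+1}$. For $1<p<\infty$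 it is a parabolic $A_p$ weight if $$[w]_p:=\sup_Q\Big(\frac1{|Q|}\int_Q w\,dz\Big)\Big(\frac1{|Q|}\int_Q w^{-\frac1{p-1}}\,dz\Big)^{p-1}<\infty,$$ the supremum over all parabolic cubes $Q=Q_s(z)\subset\mathbb{R}^{n+1}$; both averages are finite, so $w>0$ a.e. Write $w(E)=\int_E w\,dz$. $L^p_w(U)$ is the space of measurable functions $f$ on $U$ with $\int_U|f|^pw\,dz<\infty$; $L^p_w(U,\mathbb{R}^n)$ is the $\mathbb{R}^n$-valued version. *)

(* Defs.v *)
From HB Require Import structures.
From mathcomp Require Import all_boot all_order all_algebra.
From mathcomp Require Import all_classical all_reals all_analysis.

Set Implicit Arguments.
Unset Strict Implicit.
Unset Printing Implicit Defensive.

Import Order.TTheory GRing.Theory Num.Theory.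
Import numFieldNormedType.Exports.

Local Open Scope classical_set_scope.
Local Open Scope ring_scope.

Definition measure_rV_display : measure_display -> measure_display.
Proof. exact. Qed.

Section measurable_rV.
Context {d} {T : measurableType d}.
Variable n : nat.

(* The product sigma-algebra; for T a realType it is the Borel one. *)
Let coors : 'I_n -> 'rV[T]_n -> T := fun i x => x ord0 i.

Let rV_set0 : g_sigma_preimage coors set0.
Proof. exact: sigma_algebra0. Qed.

Let rV_setC A : g_sigma_preimage coors A -> g_sigma_preimage coors (~` A).
Proof. exact: sigma_algebraC. Qed.

Let rV_bigcup (F : _^nat) : (forall i, g_sigma_preimage coors (F i)) ->
  g_sigma_preimage coors (\bigcup_i (F i)).
Proof. exact: sigma_algebra_bigcup. Qed.

HB.instance Definition _ := @isMeasurable.Build (measure_rV_display d)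
  'rV[T]_n (g_sigma_preimage coors) rV_set0 rV_setC rV_bigcup.

End measurable_rV.

Lemma measurable_rV_coord d (T : measurableType d) n (i : 'I_n) :
  measurable_fun [set: 'rV[T]_n] (fun x : 'rV[T]_n => x ord0 i).
Proof.
move=> _ Y mY; rewrite setTI; apply: sub_sigma_algebra => /=.
rewrite -bigcup_seq/=; exists i => /=; first by rewrite mem_index_enum.
by exists Y => //; rewrite setTI.
Qed.

Lemma measurable_fun_rVP d1 d2 (T1 : measurableType d1) (T2 : measurableType d2)
    n (f : T1 -> 'rV[T2]_n) :
  measurable_fun [set: T1] f <->
  forall i, measurable_fun [set: T1] (fun x => f x ord0 i).
Proof.
split=> [mf i|mf].
  exact: (measurableT_comp (measurable_rV_coord i) mf).
have : (g_sigma_preimage (fun i => (fun x : 'rV[T2]_n => x ord0 i) \o f))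
    `<=` measurable.
  apply: smallest_sub; first exact: sigma_algebra_measurable.
  case: n => [|n] in f mf *; first by rewrite big_ord0.
  rewrite -bigcup_mkord_ord; apply: bigcup_sub => i Ii.
  by move=> A [B mB <-]; exact: mf.
rewrite g_sigma_preimage_comp => prefS.
by move=> _ A mA; apply: prefS; exists A.
Qed.

(* In the library the SigmaFiniteMeasure instance of \x is masked by the one for
   pairs of subprobabilities. *)
Lemma product_sigma_finite d1 d2 (T1 : measurableType d1)
    (T2 : measurableType d2) (R : realType)
    (m1 : {sigma_finite_measure set T1 -> \bar R})
    (m2 : {sigma_finite_measure set T2 -> \bar R}) :
  sigma_finite setT (m1 \x m2)%E.
Proof.
have /sigma_finiteP[F [TF ndF Foo]] := sigma_finiteT m1.
have /sigma_finiteP[G [TG ndG Goo]] := sigma_finiteT m2.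
exists (fun n => F n `*` G n).
  rewrite -setXTT TF TG predeqE => -[x y]; split.
    move=> [/= [n _ Fnx] [k _ Gky]]; exists (maxn n k) => //; split.
    - by move: x Fnx; exact/subsetPset/ndF/leq_maxl.
    - by move: y Gky; exact/subsetPset/ndG/leq_maxr.
  by move=> [n _ []/= ? ?]; split; exists n.
move=> k; have [? ?] := Foo k; have [? ?] := Goo k.
split; first exact: measurableX.
by rewrite product_measure1E// lte_mul_pinfty// ge0_fin_numE.
Qed.

Section lebesgue_rV.
Context {R : realType}.
Local Notation mR := (measurableTypeR R).

Definition rV_cons n (x : mR * 'rV[R]_n) : 'rV[R]_n.+1 :=
  \row_i oapp (x.2 ord0) x.1 (unlift ord0 i).

Definition rV_uncons n (x : 'rV[R]_n.+1) : mR * 'rV[R]_n :=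
  (x ord0 ord0, \row_i x ord0 (lift ord0 i)).

Lemma rV_consK n : cancel (@rV_cons n) (@rV_uncons n).
Proof.
move=> [a x]; rewrite /rV_uncons /rV_cons mxE unlift_none /=; congr (_, _).
by apply/rowP => i; rewrite !mxE liftK.
Qed.

Lemma measurable_rV_cons n : measurable_fun setT (@rV_cons n).
Proof.
apply/measurable_fun_rVP => i.
case: (unliftP ord0 i) => [j ->|->].
  rewrite (_ : (fun _ => _) = (fun x : 'rV[R]_n => x ord0 j) \o snd);
    last first.
    by apply/funext => x; rewrite mxE liftK.
  exact: (measurableT_comp (measurable_rV_coord j) measurable_snd).
rewrite (_ : (fun _ => _) = fst); last first.
  by apply/funext => x; rewrite mxE unlift_none.
exact: measurable_fst.
Qed.

HB.instance Definition _ n :=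
  @isMeasurableFun.Build _ _ _ _ (@rV_cons n) (@measurable_rV_cons n).

Lemma measurable_rV_uncons n : measurable_fun setT (@rV_uncons n).
Proof.
apply/measurable_fun_pairP; split.
  exact: (measurable_rV_coord ord0).
apply/measurable_fun_rVP => i.
rewrite (_ : (fun _ => _) = (fun x : 'rV[R]_n.+1 => x ord0 (lift ord0 i))).
  exact: measurable_rV_coord.
by apply/funext => x; rewrite mxE.
Qed.

Section step.
Variables (n : nat) (m : {sigma_finite_measure set 'rV[R]_n -> \bar R}).

Definition lebesgue_rV_step : set 'rV[R]_n.+1 -> \bar R :=
  pushforward (lebesgue_measure \x m)%E (@rV_cons n).

Let step0 : lebesgue_rV_step set0 = 0%E.
Proof. exact: measure0. Qed.

Let step_ge0 A : (0 <= lebesgue_rV_step A)%E.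
Proof. exact: measure_ge0. Qed.

Let step_sigma_additive : semi_sigma_additive lebesgue_rV_step.
Proof. exact: measure_semi_sigma_additive. Qed.

HB.instance Definition _ := isMeasure.Build _ _ _ lebesgue_rV_step
  step0 step_ge0 step_sigma_additive.

Let step_sigma_finite : sigma_finite setT lebesgue_rV_step.
Proof.
have [F FT Foo] := product_sigma_finite lebesgue_measure m.
exists (fun i => @rV_uncons n @^-1` F i).
  by rewrite -preimage_bigcup -FT preimage_setT.
move=> i; have [mF mFoo] := Foo i; split.
  by rewrite -[X in measurable X]setTI; exact: measurable_rV_uncons.
rewrite /lebesgue_rV_step /pushforward -comp_preimage.
rewrite (_ : _ \o _ = id) ?preimage_id//.
by apply/funext => x /=; rewrite rV_consK.
Qed.

HB.instance Definition _ := Measure_isSigmaFinite.Build _ _ _ lebesgue_rV_step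
  step_sigma_finite.

End step.

(* Lebesgue measure on R^n, i.e. the n-fold product of lebesgue_measure. *)
Fixpoint lebesgue_rV n : {sigma_finite_measure set 'rV[R]_n -> \bar R} :=
  match n with
  | 0 => \d_(0 : 'rV[R]_0)
  | m.+1 => lebesgue_rV_step (lebesgue_rV m)
  end.

Lemma measurable_rV_box n (A : 'I_n -> set mR) :
  (forall i, measurable (A i)) ->
  measurable [set x : 'rV[R]_n | forall i, A i (x ord0 i)].
Proof.
move=> mA.
rewrite (_ : mkset _ =
    \bigcap_(i in [set: 'I_n]) ((fun x : 'rV[R]_n => x ord0 i) @^-1` A i)).
  apply: fin_bigcap_measurable => [|i _]; first exact: finite_finset.
  by rewrite -[X in measurable X]setTI; apply: (measurable_rV_coord i _ (mA i)).
by apply/seteqP; split => x /= H i; [move=> _; exact: H|exact: H].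
Qed.

Lemma lebesgue_rV_box n (A : 'I_n -> set mR) :
  (forall i, measurable (A i)) ->
  lebesgue_rV n [set x : 'rV[R]_n | forall i, A i (x ord0 i)] =
  (\prod_(i < n) lebesgue_measure (A i))%E.
Proof.
elim: n A => [|n IH] A mA.
  by rewrite big_ord0 /= diracE mem_set//= => -[].
have mB := measurable_rV_box (fun i => mA (lift ord0 i)).
rewrite big_ord_recl -IH//= -product_measure1E//.
rewrite /lebesgue_rV_step /pushforward; congr (_ _).
apply/seteqP; split => [[a x] /= H|[a x] /= [Ha H] i].
  split; first by have := H ord0; rewrite mxE unlift_none.
  by move=> i; have := H (lift ord0 i); rewrite mxE liftK.
by rewrite mxE; case: (unliftP ord0 i) => [j ->|->].
Qed.

(* dz = dx dt *)
Definition lebesgue_xt n : set ('rV[R]_n * mR) -> \bar R :=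
  (lebesgue_rV n \x lebesgue_measure)%E.

HB.instance Definition _ n := Measure.on (@lebesgue_xt n).
HB.instance Definition _ n := Measure_isSigmaFinite.Build _ _ _ (@lebesgue_xt n)
  (product_sigma_finite (lebesgue_rV n) lebesgue_measure).

End lebesgue_rV.

Section cubes.
Context {R : realType} {n : nat}.

Definition cube (r : R) (x : 'rV[R]_n) : set 'rV[R]_n :=
  [set y | forall i, `|x ord0 i - y ord0 i| < r].

Definition pcube (r : R) (z : 'rV[R]_n * R) : set ('rV[R]_n * R) :=
  cube r z.1 `*` `]z.2 - r ^+ 2, z.2 + r ^+ 2[.

Lemma cubeE r x : cube r x =
  [set y | forall i, `]x ord0 i - r, x ord0 i + r[%classic (y ord0 i)].
Proof.
by apply/seteqP; split=> y /= H i; have := H i; rewrite in_itv/= ltr_distlC.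
Qed.

Lemma measurable_cube r x : measurable (cube r x).
Proof.
rewrite cubeE.
apply: (@measurable_rV_box _ _
  (fun i => `]x ord0 i - r, x ord0 i + r[%classic)).
by move=> i; exact: measurable_itv.
Qed.

Lemma measurable_pcube r z : measurable (pcube r z).
Proof.
by apply: measurableX; [exact: measurable_cube|exact: measurable_itv].
Qed.

Lemma lebesgue_cube r x : 0 < r ->
  lebesgue_rV n (cube r x) = ((2 * r) ^+ n)%:E.
Proof.
move=> r0; rewrite cubeE.
rewrite (@lebesgue_rV_box _ _ (fun i => `]x ord0 i - r, x ord0 i + r[%classic));
  last by move=> i; exact: measurable_itv.
under eq_bigr => i _.
  rewrite lebesgue_measure_itv/= lte_fin ltrD2l gtrN// -EFinD.
  rewrite opprD opprK addrACA subrr add0r -mulr2n -mulr_natl.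
  over.
by rewrite prodEFin prodr_const card_ord.
Qed.

Lemma lebesgue_pcube r z : 0 < r ->
  lebesgue_xt (pcube r z) = ((2 * r) ^+ n * (2 * r ^+ 2))%:E.
Proof.
move=> r0; rewrite /lebesgue_xt /pcube product_measure1E//; last first.
  exact: measurable_cube.
rewrite [X in (X * _)%E](_ : _ = ((2 * r) ^+ n)%:E); last exact: lebesgue_cube.
rewrite /= lebesgue_measure_itv/= lte_fin ltrD2l gtrN ?exprn_gt0//.
by rewrite -EFinD opprD opprK addrACA subrr add0r -mulr2n -(mulr_natl (r ^+ 2)).
Qed.

End cubes.

(* The Euclidean norm, on row vectors as well as on matrices; the library norm
   on matrices is the max norm. *)
Definition euclid {R : realType} m n (A : 'M[R]_(m, n)) : R :=
  Num.sqrt (\sum_i \sum_j A i j ^+ 2).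

Section weak_derivatives.
Context {R : realType} {n : nat}.
Local Notation mu := (@lebesgue_xt R n).
Implicit Types (U : set ('rV[R]_n * R)) (f g phi : 'rV[R]_n * R -> R).

Definition iter_derive (vs : seq ('rV[R]_n * R)) phi :=
  foldr (fun v g => 'D_v g) phi vs.

Definition smooth phi := forall vs,
  continuous (iter_derive vs phi) /\
  forall z v, derivable (iter_derive vs phi) z v.

Definition test_function U phi :=
  let supp := closure [set z | phi z != 0] in
  [/\ smooth phi, compact supp & supp `<=` U].

Definition weak_derive U (v : 'rV[R]_n * R) f g :=
  forall phi, test_function U phi ->
    \int[mu]_(z in U) (f z * 'D_v phi z) = - \int[mu]_(z in U) (g z * phi z).

Definition dir_x (i : 'I_n) : 'rV[R]_n * R := (delta_mx ord0 i, 0).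
Definition dir_t : 'rV[R]_n * R := (0, 1).

Definition L1 U f := mu.-integrable U (EFin \o f).

(* u belongs to W^{2,1}_1(U), with weak derivatives u_t = ut, D u = Du and
   D^2 u = D2u; these are determined almost everywhere by u. *)
Definition W21_1 U (u ut : 'rV[R]_n * R -> R) (Du : 'rV[R]_n * R -> 'rV[R]_n)
    (D2u : 'rV[R]_n * R -> 'M[R]_n) :=
  [/\ L1 U u,
      L1 U ut /\ weak_derive U dir_t u ut,
      forall i, L1 U (fun z => Du z ord0 i) /\
        weak_derive U (dir_x i) u (fun z => Du z ord0 i) &
      forall i j, L1 U (fun z => D2u z i j) /\
        weak_derive U (dir_x j) (fun z => Du z ord0 i) (fun z => D2u z i j)].

End weak_derivatives.

Section weights.
Context {R : realType} {n : nat}.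
Local Notation mu := (@lebesgue_xt R n).
Implicit Types (U : set ('rV[R]_n * R)) (w : 'rV[R]_n * R -> R).

Definition mean U (f : 'rV[R]_n * R -> R) : R :=
  (fine (mu U))^-1 * \int[mu]_(z in U) f z.

Definition mean_rV m U (F : 'rV[R]_n * R -> 'rV[R]_m) : 'rV[R]_m :=
  \row_i mean U (fun z => F z ord0 i).

Local Open Scope ereal_scope.

Definition emean U (f : 'rV[R]_n * R -> \bar R) : \bar R :=
  (mu U)^-1 * \int[mu]_(z in U) f z.

Definition weight w :=
  [/\ forall z, (0 <= w z)%R, measurable_fun setT w &
      forall K, compact K -> \int[mu]_(z in K) (w z)%:E < +oo].

(* w^{-1/(p-1)}, equal to +oo (and not to 0, as with powR) where w = 0 *)
Definition dual_weight (p : R) w z : \bar R :=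
  ((w z `^ (p - 1)^-1)%R%:E)^-1.

Definition Ap_const (p : R) w : \bar R :=
  ereal_sup [set x | exists z s, (0 < s)%R /\
    x = emean (pcube s z) (fun y => (w y)%:E) *
        emean (pcube s z) (dual_weight p w) `^ (p - 1)].

(* Finiteness of the dual averages is not implied by that of [w]_p, because
   0 * +oo = 0 in \bar R; those of w are finite by local integrability. *)
Definition Ap_weight (p : R) w :=
  [/\ weight w,
      forall z s, (0 < s)%R -> emean (pcube s z) (dual_weight p w) < +oo &
      Ap_const p w < +oo].

Definition wmeasure w U : \bar R := \int[mu]_(z in U) (w z)%:E.

Definition wmean w U (f : 'rV[R]_n * R -> R) : \bar R :=
  (wmeasure w U)^-1 * \int[mu]_(z in U) (f z * w z)%:E.

Definition Lpw (p : R) w U (f : 'rV[R]_n * R -> R) :=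
  measurable_fun U f /\ \int[mu]_(z in U) (`|f z| `^ p * w z)%:E < +oo.

Definition Lpw_rV (p : R) w U m (F : 'rV[R]_n * R -> 'rV[R]_m) :=
  measurable_fun U F /\ \int[mu]_(z in U) (euclid (F z) `^ p * w z)%:E < +oo.

End weights.

(* Main.v *)
Require Import Defs.
From mathcomp Require Import all_boot all_order all_algebra.
From mathcomp Require Import ring lra zify.
From mathcomp Require Import all_classical all_reals all_analysis.
From mathcomp Require Import measurable_realfun.

Set Implicit Arguments.
Unset Strict Implicit.
Unset Printing Implicit Defensive.

Import Order.TTheory GRing.Theory Num.Theory.
Import numFieldNormedType.Exports.

Local Open Scope classical_set_scope.
Local Open Scope ring_scope.

(** Let N = n + 2, the homogeneous dimension of parabolic scaling, and let
    g = |D^2u| + |u_t|. The cube Q is halved repeatedly: generation j consists of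
    2^(jN) disjoint parabolic cubes (cells) of radius r / 2^j that fill Q up to a
    null set.

    Unweighted part. For f = D_i u, the mean of f over a cell differs from the mean
    over its parent P by at most K rad(P) (g)_P ([mean_child]). Indeed a mean is a
    limit of integrals of f against tensor products of one-dimensional densities,
    and these are exchanged one coordinate at a time. Two densities of equal mass
    differ by the derivative of a compactly supported function. For a spatial
    coordinate, integration by parts yields D^2u. In time f has no derivative, but
    f is itself D_i u: the derivative D_i moves onto a fixed smooth density in x_i
    and the derivative in time moves onto u, which yields u_t. Adding the
    differences along the cells that contain z gives, for almost every z,
    |Du(z) - (Du)_Q| <= K' sum_j y_j(z), where y_j(z) is the radius times the mean
    of g over the cell of generation j that contains z ([chain_bound],
    [oscillation_bound]).

    Weighted part. Let s be the dual weight and X the integral of g^p w over Q.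
    Hoelder's inequality on a cell P and the A_p condition give
    w(P) (g)_P^p <= A int_P g^p w. They also give
    (g)_P^p <= X s(P)^(p-1) / |P|^p, and the dual mass s(P) decays with the
    generation: each cell has a sibling in its parent, which by A_p carries at least
    a fixed fraction eta of the dual mass of the parent, so
    s(P) <= (1 - eta)^j s(Q) ([dR_half], [dR_cell]). Hence
    w(P) (g)_P^(pk) is at most the local integral of g^p w times the power k - 1 of
    a bound that grows like (2^(Np) (1 - eta)^(p-1))^j, and summation over the cells
    shows that the integral of y_j^(pk) w is at most a constant times rho^j with
    rho = 2^(-pk) (2^(Np) (1 - eta)^(p-1))^(k-1) ([integral_step_powR]).

    For k = N / (N - 1) the powers of 2 cancel and rho is a power of 1 - eta, hence
    less than 1; this is still so for k slightly larger ([exponent_choice]), which is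
    where delta comes from. Geometric decay in j allows the series to be summed
    ([powR_series_le], [main_integral]). *)

(** * Smooth functions through iterated differentiability *)

Section smooth_functions.
Context {R : realType}.

(** Differentiability at each stage, rather than mere existence of directional
    derivatives, makes the class stable under products and composition. *)
Fixpoint Ck (V : normedModType R) k (f : V -> R) : Prop :=
  (forall z, differentiable f z) /\
  match k with 0 => True | k'.+1 => forall v, Ck k' ('D_v f) end.

Definition Cinf (V : normedModType R) (f : V -> R) := forall k, Ck k f.

Section algebra.
Variable V : normedModType R.
Implicit Types f g : V -> R.

Lemma Ck_differentiable k f z : Ck k f -> differentiable f z.
Proof. by case: k => [|k] [H _]. Qed.

Lemma CkW k f : Ck k.+1 f -> Ck k f.
Proof.
elim: k f => [|k IH] f [H1 H2]; split=> // v.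
by apply: IH; exact: H2.
Qed.

Lemma CkD k f g : Ck k f -> Ck k g -> Ck k (f \+ g).
Proof.
elim: k f g => [|k IH] f g [f1 f2] [g1 g2]; split=> //.
- by move=> z; exact: differentiableD.
- by move=> z; exact: differentiableD.
move=> v; rewrite (_ : 'D_v (f \+ g) = 'D_v f \+ 'D_v g); first exact: (IH _ _ (f2 v) (g2 v)).
by apply/funext => z; rewrite deriveD//; exact: diff_derivable.
Qed.

Lemma CkM k f g : Ck k f -> Ck k g -> Ck k (f \* g).
Proof.
elim: k f g => [|k IH] f g Hf Hg.
  by split=> // z; apply: differentiableM; [exact: (Ck_differentiable _ Hf)|exact: (Ck_differentiable _ Hg)].
have Df z : differentiable f z by exact: (Ck_differentiable _ Hf).
have Dg z : differentiable g z by exact: (Ck_differentiable _ Hg).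
split; first by move=> z; exact: differentiableM.
move=> v; rewrite (_ : 'D_v (f \* g) = (f \* 'D_v g) \+ (g \* 'D_v f)).
  by apply: CkD; apply: IH; [exact: CkW|exact: Hg.2|exact: CkW|exact: Hf.2].
by apply/funext => z; rewrite deriveM//; exact: diff_derivable.
Qed.

Lemma Ck_cst k (c : R) : Ck k (cst c : V -> R).
Proof.
elim: k c => [|k IH] c; split => // v.
rewrite (_ : 'D_v _ = cst 0); first exact: IH.
by apply/funext => z; rewrite derive_cst.
Qed.

Lemma Ck_linear k (f : {linear V -> R^o}) : continuous f -> Ck k (f : V -> R).
Proof.
move=> cf; case: k => [|k]; split=> //; try by move=> z; exact: linear_differentiable.
move=> v; rewrite (_ : 'D_v _ = cst (f v)); first exact: Ck_cst.
apply/funext => z; rewrite deriveE; last exact: linear_differentiable.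
by rewrite diff_lin.
Qed.

End algebra.

Section composition.
Variable V : normedModType R.
Implicit Types f g : V -> R.

Lemma Ck_comp k (h : R -> R) f : Ck k h -> Ck k f -> Ck k (h \o f).
Proof.
elim: k h f => [|k IH] h f Hh Hf.
  by split=> // z; apply: differentiable_comp; [exact: (Ck_differentiable _ Hf)|exact: (Ck_differentiable _ Hh)].
have Df z : differentiable f z by exact: (Ck_differentiable _ Hf).
have Dh z : differentiable h z by exact: (Ck_differentiable _ Hh).
split; first by move=> z; exact: differentiable_comp.
move=> v; rewrite (_ : 'D_v _ = ('D_1 h \o f) \* 'D_v f).
  by apply: CkM; [apply: IH; [exact: Hh.2|exact: CkW]|exact: Hf.2].
apply/funext => z; rewrite deriveE; last exact: differentiable_comp.
rewrite diff_comp//= deriveE//= deriveE//.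
by rewrite -[in LHS](mulr1 ('d f z v)) -[_ * 1]/(_ *: 1) linearZ /= mulrC.
Qed.

Lemma Cinf_prod (I : Type) (s : seq I) (F : I -> V -> R) :
  (forall i, Cinf (F i)) -> Cinf (fun z => \prod_(i <- s) F i z).
Proof.
move=> HF k; elim: s => [|i s IH].
  by rewrite (_ : (fun _ => _) = cst 1); [exact: Ck_cst|apply/funext => z; rewrite big_nil].
rewrite (_ : (fun _ => _) = F i \* (fun z => \prod_(i <- s) F i z)).
  by apply: CkM => //; exact: HF.
by apply/funext => z; rewrite big_cons.
Qed.

Lemma Cinf_derive f v : Cinf f -> Cinf ('D_v f).
Proof. by move=> Hf k; exact: (Hf k.+1).2. Qed.

Lemma Cinf_differentiable f z : Cinf f -> differentiable f z.
Proof. by move=> Hf; exact: (Ck_differentiable z (Hf 0%N)). Qed.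

Lemma Cinf_continuous f : Cinf f -> continuous f.
Proof.
by move=> Hf z; apply: differentiable_continuous; exact: Cinf_differentiable.
Qed.

End composition.

Lemma deriveR (h : R -> R) v x : differentiable h x -> 'D_v h x = v * 'D_1 h x.
Proof.
move=> dh; rewrite !deriveE//.
by rewrite -[in LHS](mulr1 v) -[_ * 1]/(_ *: 1) linearZ.
Qed.

Lemma Cinf_smooth n (f : 'rV[R]_n * R -> R) : Cinf f -> smooth f.
Proof.
move=> Hf vs; have {}Hf : Cinf (iter_derive vs f).
  by elim: vs => //= v vs IH; exact: Cinf_derive.
split; first exact: Cinf_continuous.
by move=> z v; apply: diff_derivable; exact: Cinf_differentiable.
Qed.

End smooth_functions.

(** * A smooth profile on the line and its primitive *)

Section bump.
Context {R : realType}.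
Implicit Types x y : R.

(** The powers of 1/x make the family of flat functions x^-k exp(-1/x) stable
    under differentiation, whence smoothness by induction. *)
Definition psi (k : nat) x : R := if 0 < x then x ^- k * expR (- x^-1) else 0.

Lemma psi_ge0 k x : 0 <= psi k x.
Proof.
by rewrite /psi; case: ifPn => // x0; rewrite mulr_ge0 ?expR_ge0// invr_ge0 exprn_ge0// ltW.
Qed.

Lemma psi_le0 k x : x <= 0 -> psi k x = 0.
Proof. by rewrite /psi; case: ltP. Qed.

(** Flatness at 0, from y^(k+1) <= (k+1)! exp y at y = 1/x. *)
Lemma psi_bound k x : psi k x <= k.+1`!%:R * `|x|.
Proof.
have [x0|x0] := leP x 0; first by rewrite psi_le0// mulr_ge0.
rewrite /psi x0 gtr0_norm//.
have Hy : x ^- k.+1 <= k.+1`!%:R * expR x^-1.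
  rewrite mulrC -ler_pdivrMr ?ltr0n ?fact_gt0// -exprVn.
  by apply: le_trans (@expR_ge1Dxn _ _ k _); rewrite ?lerDr ?invr_ge0 ?ltW.
rewrite expRN ler_pdivrMr ?expR_gt0// mulrAC.
rewrite -ler_pdivrMr//; apply: le_trans Hy.
by rewrite exprSr invfM mulrC.
Qed.

Lemma psi_le1 x : psi 0 x <= 1.
Proof.
rewrite /psi; case: ifPn => // x0; rewrite expr0 invr1 mul1r.
by rewrite -expR0 ler_expR oppr_le0 invr_ge0 ltW.
Qed.

Lemma is_derive_psi k x :
  is_derive x 1 (psi k) (psi k.+2 x - k%:R * psi k.+1 x).
Proof.
have [x0|x0|->] := ltgtP x 0.
- rewrite !psi_le0 ?ltW// mulr0 subrr.
  apply: (@near_eq_is_derive _ _ _ (cst 0)).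
  by near=> y; rewrite psi_le0// ltW//; near: y; exact: lt_nbhsl.
- have xn0 : x != 0 by rewrite gt_eqF.
  rewrite /psi x0.
  pose i := fun y : R => y^-1.
  have Hi : is_derive x 1 i (- x ^- 2).
    apply: DeriveDef; first exact: derivableV.
    by rewrite deriveV// derive_id -[_ *: 1]/(_ * 1) mulr1.
  apply: (@near_eq_is_derive _ _ _ ((i ^+ k) * (expR \o (- i)))).
    near=> y; rewrite ifT; first by rewrite !fctE /= exprVn.
    by near: y; exact: lt_nbhsr.
  have H1 : is_derive x 1 (- i) (- (- x ^- 2)) by exact: is_deriveN.
  have H2 : is_derive x 1 (expR \o - i) (expR (- x^-1) * x ^- 2).
    by have := is_derive1_comp (is_derive_expR ((- i) x)) H1; rewrite opprK.
  apply: is_derive_eq.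
  rewrite -![_ *: _]/(_ * _) /=.
  have -> : (i ^+ k) x = x ^- k by rewrite fctE exprVn.
  rewrite !exprS !invfM expr0 /i.
  have -> : (- [eta GRing.inv]) x = - x^-1 :> R by [].
  rewrite -!exprVn invr1.
  case: (k) => [|k']; first by rewrite expr0 /=; ring.
  by rewrite /= exprS; ring.
- rewrite !psi_le0// mulr0 subrr.
  suff H : h^-1 *: (psi k (h *: 1 + 0) - psi k 0) @[h --> 0^'] --> (0 : R).
    by apply: DeriveDef; [apply/cvg_ex; exists 0|apply: cvg_lim].
  apply/cvgrPdist_le => /= e e0.
  near=> h; rewrite sub0r normrN addr0 (psi_le0 _ (lexx 0)) subr0.
  rewrite -[h *: 1]/(h * 1) mulr1.
  have h0 : h != 0 by near: h; exact: nbhs_dnbhs_neq.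
  have -> : h^-1 *: psi k h = psi k.+1 h.
    rewrite -[_ *: _]/(_ * _) /psi; case: ifP => _; last by rewrite mulr0.
    by rewrite mulrA exprS invfM.
  rewrite ger0_norm ?psi_ge0// (le_trans (psi_bound _ _))//.
  rewrite mulrC -ler_pdivlMr ?ltr0n ?fact_gt0//.
  near: h; apply: cvg_within; near=> h.
  rewrite -[h in `|h|]subr0 distrC ltW//; near: h.
  by apply: nbhsx_ballx; rewrite divr_gt0// ltr0n fact_gt0.
Unshelve. all: by end_near. Qed.

Lemma Cinf_psi k : Cinf (psi k).
Proof.
have dpsi j x : differentiable (psi j) x.
  by apply/derivable1_diffP; exact: (@ex_derive _ _ _ _ _ _ _ (is_derive_psi j x)).
move=> d; elim: d k => [|d IH] k; split=> // v.
rewrite (_ : 'D_v (psi k) =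
    cst v \* (psi k.+2 \+ cst (- k%:R) \* psi k.+1)).
  by apply: CkM; [exact: Ck_cst|apply: CkD => //; apply: CkM => //; exact: Ck_cst].
apply/funext => x; rewrite deriveR//= (@derive_val _ _ _ _ _ _ _ (is_derive_psi k x)).
by rewrite mulNr.
Qed.

(** As m grows, [bump m] increases to the indicator of (-1, 1); integrals against
    it become integrals over a cube. *)
Definition bump (m : nat) x := psi 0 (m.+2%:R * (1 - x ^+ 2) - 1).

Lemma Cinf_id : Cinf (id : R -> R).
Proof. by move=> k; apply: (@Ck_linear _ R k idfun) => x; exact: cvg_id. Qed.

Lemma Cinf_affine (a b : R) : Cinf (fun x => a * x + b).
Proof.
move=> k; apply: (@CkD _ R k (cst a \* id) (cst b)); last exact: Ck_cst.
by apply: CkM; [exact: Ck_cst|exact: Cinf_id].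
Qed.

Lemma Cinf_comp1 (V : normedModType R) (h : R -> R) (f : V -> R) :
  Cinf h -> Cinf f -> Cinf (h \o f).
Proof. by move=> Hh Hf k; exact: Ck_comp. Qed.

Lemma Cinf_bump m : Cinf (bump m).
Proof.
apply: (@Cinf_comp1 _ (psi 0) (fun x : R => m.+2%:R * (1 - x ^+ 2) - 1)).
  exact: Cinf_psi.
apply: (@Cinf_comp1 _ (fun y => m.+2%:R * y + (-1)) (fun x : R => 1 - x ^+ 2)).
  exact: Cinf_affine.
move=> k; apply: (@CkD _ R k (cst 1) (fun x : R => - x ^+ 2)).
  exact: Ck_cst.
rewrite (_ : (fun x : R => _) = cst (-1) \* (id \* id)).
  by apply: CkM; [exact: Ck_cst|apply: CkM; exact: Cinf_id].
by apply/funext => x /=; rewrite mulN1r expr2.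
Qed.

Lemma bump_ge0 m x : 0 <= bump m x. Proof. exact: psi_ge0. Qed.

Lemma bump_le1 m x : bump m x <= 1. Proof. exact: psi_le1. Qed.

(** The margin below 1 keeps the supports of the test functions compact in the open
    cube; the value comes from m.+2 (1 - x^2) <= 1. *)
Definition bump_radius (m : nat) : R := 1 - m.+2%:R^-1 / 2.

Lemma bump_radius_bound m : 0 < bump_radius m < 1.
Proof.
rewrite /bump_radius; apply/andP; split; last first.
  by rewrite gtrBl divr_gt0// invr_gt0.
have : (m.+2%:R : R)^-1 < 1 by rewrite invf_lt1// ltr1n.
by move: (_^-1) => i i1; lra.
Qed.

Lemma bump_arg_le0 m x : bump_radius m <= `|x| ->
  m.+2%:R * (1 - x ^+ 2) - 1 <= 0.
Proof.
move=> H; rewrite subr_le0 -ler_pdivlMl// mulr1.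
rewrite -(real_normK (num_real x)).
have /andP[r0 r1] := bump_radius_bound m.
have : bump_radius m ^+ 2 <= `|x| ^+ 2 by rewrite lerXn2r// nnegrE ltW// (lt_le_trans r0).
move=> /(lerB (lexx 1)) /le_trans; apply.
rewrite /bump_radius; set i := _^-1.
have i0 : 0 < i by rewrite invr_gt0.
nra.
Qed.

Lemma bump_eq0 m x : bump_radius m <= `|x| -> bump m x = 0.
Proof. by move=> H; apply: psi_le0; exact: bump_arg_le0. Qed.

Lemma bump_cvg x : `|x| < 1 -> bump m x @[m --> \oo] --> (1 : R).
Proof.
move=> x1.
have d0 : 0 < 1 - x ^+ 2.
  by rewrite subr_gt0 -(real_normK (num_real x)) expr_lt1.
apply/cvgrPdist_le => /= e e0.
have [e1|e1] := leP 1 e.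
  near=> m; rewrite ger0_norm ?subr_ge0 ?bump_le1//.
  by rewrite (le_trans _ e1)// gerBl bump_ge0.
near=> m; rewrite ger0_norm ?subr_ge0 ?bump_le1// lerBlDl -lerBlDr.
have Hm : 1 + e^-1 <= m.+2%:R * (1 - x ^+ 2).
  rewrite -ler_pdivrMr// (@le_trans _ _ m%:R)//; last by rewrite ler_nat -addn2 leq_addr.
  by near: m; exact: nbhs_infty_ger.
rewrite /bump /psi ifT; last first.
  rewrite subr_gt0 (lt_le_trans _ Hm)// ltrDl invr_gt0//.
rewrite expr0 invr1 mul1r.
apply: le_trans (expR_ge1Dx _); rewrite lerD2l lerN2 -[leRHS]invrK.
have e0' : 0 < e^-1 by rewrite invr_gt0.
by rewrite lef_pV2 ?posrE; lra.
Unshelve. all: by end_near. Qed.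

Lemma continuous_bump m : continuous (bump m).
Proof. exact/Cinf_continuous/Cinf_bump. Qed.

Lemma integrable_bump m u :
  lebesgue_measure.-integrable `]-oo, u] (EFin \o bump m).
Proof.
have -> : bump m = bump m \_ `[-1, 1].
  apply/funext => x; rewrite patchE; case: ifPn => // /negP; rewrite inE/= in_itv/=.
  move=> H; rewrite bump_eq0//; have /andP[_ r1] := bump_radius_bound m.
  rewrite (le_trans (ltW r1))// leNgt; apply/negP => /ltW.
  by rewrite ler_norml => /H.
rewrite -restrict_EFin; apply/integrable_restrict => //=.
apply: (@integrableS _ (measurableTypeR R) R lebesgue_measure `[-1, 1]%classic) => //=.
  exact: measurableI.
apply: continuous_compact_integrable; first exact: segment_compact.
by apply: continuous_subspaceT; exact: continuous_bump.
Qed.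

(** The primitive is what integration by parts needs: two profiles of the same
    mass differ by the derivative of a compactly supported function. *)
Definition Bump (m : nat) x : R := \int[lebesgue_measure]_(t in `]-oo, x]) bump m t.

Lemma is_derive_Bump m x : is_derive x 1 (Bump m) (bump m x).
Proof.
have xx : x < x + 1 by rewrite ltrDl.
have [] := continuous_FTC1 xx (integrable_bump m (x + 1)) _ (@continuous_bump m x).
  by rewrite ltNyr.
by rewrite derive1E => H1 H2; apply: DeriveDef.
Qed.

Lemma Cinf_Bump m : Cinf (Bump m).
Proof.
have dB z : differentiable (Bump m) z.
  by apply/derivable1_diffP; exact: (@ex_derive _ _ _ _ _ _ _ (is_derive_Bump m z)).
case=> [|k]; split => // v.
rewrite (_ : 'D_v _ = cst v \* bump m).
  by apply: CkM; [exact: Ck_cst|exact: Cinf_bump].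
by apply/funext => x; rewrite deriveR// (@derive_val _ _ _ _ _ _ _ (is_derive_Bump m x)).
Qed.

Lemma Bump_left m x : x <= - bump_radius m -> Bump m x = 0.
Proof.
move=> H; have /andP[r0 r1] := bump_radius_bound m.
rewrite /Bump (@eq_Rintegral _ _ _ _ _ (cst 0)) ?Rintegral_cst ?mul0r//.
move=> t; rewrite inE/= in_itv/= => tx; apply: bump_eq0.
move: (bump_radius m) H r0 r1 => d H r0 r1.
have t0 : t <= 0 by lra.
by rewrite ler0_norm; lra.
Qed.

Lemma Bump_MVT m x y : x <= y ->
  exists2 z, z \in `[x, y] & Bump m y - Bump m x = bump m z * (y - x).
Proof.
move=> xy; apply: MVT_segment => //.
  by move=> z _; exact: is_derive_Bump.
by apply: continuous_subspaceT; apply: Cinf_continuous; exact: Cinf_Bump.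
Qed.

Lemma Bump_homo m : {homo Bump m : x y / x <= y}.
Proof.
move=> x y xy; have [z _ H] := Bump_MVT m xy.
by rewrite -subr_ge0 H mulr_ge0 ?bump_ge0 ?subr_ge0.
Qed.

Lemma Bump_right m x : bump_radius m <= x -> Bump m x = Bump m 1.
Proof.
move=> H; have /andP[r0 r1] := bump_radius_bound m.
wlog suff W : x H / x <= 1 -> Bump m x = Bump m 1.
  have [x1|/ltW x1] := leP x 1; first exact: W.
  have [z] := Bump_MVT m x1; rewrite in_itv/= => /andP[z1 z2].
  rewrite bump_eq0 ?mul0r => [/eqP|]; first by rewrite subr_eq0 => /eqP.
  by rewrite ger0_norm; lra.
move=> x1; have [z] := Bump_MVT m x1; rewrite in_itv/= => /andP[z1 z2].
rewrite bump_eq0 ?mul0r => [/eqP|]; first by rewrite subr_eq0 => /eqP.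
by rewrite ger0_norm; lra.
Qed.

Lemma Bump_ge0 m x : 0 <= Bump m x.
Proof.
have [H|H] := leP x (- bump_radius m); first by rewrite Bump_left.
by rewrite -(Bump_left (lexx (- bump_radius m))) Bump_homo// ltW.
Qed.

Lemma Bump_le m x : Bump m x <= Bump m 1.
Proof.
have [H|/ltW H] := leP x 1; first exact: Bump_homo.
have /andP[r0 r1] := bump_radius_bound m.
by rewrite (@Bump_right _ x)//; lra.
Qed.

Lemma Bump1_le2 m : Bump m 1 <= 2.
Proof.
have /andP[r0 r1] := bump_radius_bound m.
have H : -1 <= 1 :> R by lra.
have [z _ ] := Bump_MVT m H.
rewrite (_ : Bump m (-1) = 0); last by apply: Bump_left; lra.
by have := bump_le1 m z; lra.
Qed.

Lemma bump0_gt0 m : 0 < bump m 0.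
Proof.
rewrite /bump expr0n/= subr0 mulr1 /psi.
have : (1 : R) < m.+2%:R by rewrite ltr1n.
rewrite -subr_gt0 => H; rewrite H expr0 invr1 mul1r; exact: expR_gt0.
Qed.

Lemma Bump1_gt0 m : 0 < Bump m 1.
Proof.
rewrite lt_neqAle Bump_ge0 andbT; apply/eqP => H.
have B0 : Bump m = cst 0.
  by apply/funext => x; apply/eqP; rewrite eq_le Bump_ge0 andbT H Bump_le.
have := @derive_val _ _ _ _ _ _ _ (is_derive_Bump m 0).
rewrite B0 derive_cst => /esym/eqP; apply/negP.
by rewrite gt_eqF// bump0_gt0.
Qed.

End bump.

(** * Tensor products as test functions *)

Section tensors.
Context {R : realType} {n : nat}.
Local Notation V := ('rV[R]_n * R)%type.
Implicit Types (h : 'I_n -> R -> R) (k : R -> R) (z : V).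

Definition tens h k z : R := (\prod_l h l (z.1 ord0 l)) * k z.2.

Lemma Cinf_coord (l : 'I_n) : Cinf (fun z : V => z.1 ord0 l).
Proof.
have @f : {linear V -> R}.
  by exists (fun z : V => z.1 ord0 l); do 2![eexists]; do ?[constructor];
     rewrite ?mxE// => ? *; rewrite ?mxE//; move=> ?; rewrite !mxE.
have cf : continuous f.
  move=> z; apply: (@continuous_comp _ _ _ fst (fun x : 'rV[R]_n => x ord0 l)).
    exact: cvg_fst.
  exact: coord_continuous.
by move=> j; exact: (@Ck_linear _ _ j f).
Qed.

Lemma Cinf_time : Cinf (fun z : V => z.2).
Proof.
have @f : {linear V -> R}.
  by exists (fun z : V => z.2); do 2![eexists]; do ?[constructor]. 
have cf : continuous f by move=> z; exact: cvg_snd.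
by move=> j; exact: (@Ck_linear _ _ j f).
Qed.

Lemma Cinf_tens h k : (forall l, Cinf (h l)) -> Cinf k -> Cinf (tens h k).
Proof.
move=> Hh Hk j; apply: (@CkM _ _ _ (fun z : V => \prod_l h l (z.1 ord0 l))
  (fun z => k z.2)).
  apply: (@Cinf_prod _ _ _ _ (fun l (z : V) => h l (z.1 ord0 l))) => l.
  exact: (Cinf_comp1 (Hh l) (Cinf_coord l)).
exact: (Cinf_comp1 Hk Cinf_time).
Qed.

Definition upd h (l : 'I_n) (f : R -> R) : 'I_n -> R -> R :=
  fun j => if j == l then f else h j.

Lemma tens_upd h l f k z :
  tens (upd h l f) k z =
  f (z.1 ord0 l) * (\prod_(j | j != l) h j (z.1 ord0 j)) * k z.2.
Proof.
rewrite /tens (bigD1 l)//= /upd eqxx; congr (_ * _ * _).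
by apply: eq_bigr => j /negbTE ->.
Qed.

Lemma derive_tens_x h l f k z : Cinf f ->
  'D_(dir_x l) (tens (upd h l f) k) z = tens (upd h l ('D_1 f)) k z.
Proof.
move=> Cf; set C := (\prod_(j | j != l) h j (z.1 ord0 j)) * k z.2.
have E s : tens (upd h l f) k (s *: dir_x l + z) = f (s + z.1 ord0 l) * C.
  rewrite tens_upd -mulrA; congr (f _ * (_ * _)).
  - by rewrite /= !mxE !eqxx mulr1.
  - apply: eq_bigr => j jl; congr h; rewrite /= !mxE eqxx/= (negbTE jl).
    by rewrite mulr0 add0r.
  - by rewrite /= scaler0 add0r.
transitivity ('D_1 (fun x => f x * C) (z.1 ord0 l)).
  rewrite /derive; set F := (X in lim (X @ _)); set G := (X in _ = lim (X @ _)).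
  suff -> : F = G by [].
  apply/funext => s; rewrite /F /G /= E.
  have := E 0; rewrite scale0r !add0r => ->.
  by rewrite -[s *: 1]/(s * 1) mulr1.
rewrite deriveMr; last exact/diff_derivable/Cinf_differentiable.
by rewrite tens_upd mulrC mulrA.
Qed.

Lemma derive_tens_t h k z : Cinf k ->
  'D_dir_t (tens h k) z = tens h ('D_1 k) z.
Proof.
move=> Ck; set C := \prod_l h l (z.1 ord0 l).
have E s : tens h k (s *: dir_t + z) = C * k (s + z.2).
  rewrite /tens /=; congr (_ * k _).
  - by apply: eq_bigr => j _; rewrite scaler0 add0r.
  - by rewrite -[s *: 1]/(s * 1) mulr1.
transitivity ('D_1 (fun x => C * k x) z.2).
  rewrite /derive; set F := (X in lim (X @ _)); set G := (X in _ = lim (X @ _)).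
  suff -> : F = G by [].
  apply/funext => s; rewrite /F /G /= E.
  have := E 0; rewrite scale0r !add0r => ->.
  by rewrite -[s *: 1]/(s * 1) mulr1.
by rewrite deriveMl//; exact/diff_derivable/Cinf_differentiable.
Qed.

Lemma measurable_tens (D : set V) h k :
  (forall l, continuous (h l)) -> continuous k -> measurable_fun D (tens h k).
Proof.
move=> ch ck; apply: measurable_funTS; apply: measurable_funM.
  apply: measurable_prod => l _.
  apply: (@measurableT_comp _ _ _ _ _ _ (h l) _ (fun z : V => z.1 ord0 l)).
    exact: continuous_measurable_fun.
  exact: (measurableT_comp (measurable_rV_coord l) measurable_fst).
apply: (@measurableT_comp _ _ _ _ _ _ k _ snd).
  exact: continuous_measurable_fun.
exact: measurable_snd.
Qed.

Lemma tens_bound h k (A B : R) :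
  (forall l x, `|h l x| <= A) -> (forall t, `|k t| <= B) ->
  forall z, `|tens h k z| <= A ^+ n * B.
Proof.
move=> hA kB z; rewrite /tens normrM normr_prod ler_pM//.
  exact: prodr_ge0.
rewrite -[X in A ^+ X](card_ord n) -prodr_const.
by apply: ler_prod => l _; rewrite normr_ge0 hA.
Qed.

(** The factors vanish outside intervals strictly shorter than those of the cube,
    so the support stays in a closed box inside the open cube. *)
Lemma test_tens (c : V) (rho a b : R) h k :
  (forall l, Cinf (h l)) -> Cinf k -> a < rho -> b < rho ^+ 2 ->
  (forall l x, a <= `|c.1 ord0 l - x| -> h l x = 0) ->
  (forall t, b <= `|c.2 - t| -> k t = 0) ->
  (forall U, pcube rho c `<=` U -> test_function U (tens h k)) /\
  (forall z, tens h k z != 0 -> pcube rho c z).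
Proof.
move=> Ch Ck a1 b1 h0 k0.
pose K : set V := [set x : 'rV[R]_n | forall l, `[c.1 ord0 l - a, c.1 ord0 l + a]%classic (x ord0 l)]
   `*` `[c.2 - b, c.2 + b]%classic.
have KP : K `<=` pcube rho c.
  move=> z [/= z1 z2]; split => /=.
    move=> l; have := z1 l; rewrite in_itv/= => H.
    by rewrite distrC (le_lt_trans _ a1)// ler_distl.
  by move: z2; rewrite !in_itv/= => /andP[? ?]; apply/andP; split; lra.
have cK : compact K.
  apply: compact_setX; last exact: segment_compact.
  apply: (@rV_compact _ _ (fun l => `[c.1 ord0 l - a, c.1 ord0 l + a]%classic)).
  by move=> l; exact: segment_compact.
have supp : [set z | tens h k z != 0] `<=` K.
  move=> z /= zn0; split => /=.
    move=> l; rewrite in_itv/= -ler_distl distrC ltW// ltNge; apply/negP => H.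
    by move: zn0; rewrite /tens (bigD1 l)//= h0// !mul0r eqxx.
  rewrite in_itv/= -ler_distl distrC ltW// ltNge; apply/negP => H.
  by move: zn0; rewrite /tens k0// mulr0 eqxx.
have clK : closed K by apply: compact_closed => //; exact: norm_hausdorff.
have csupp : closure [set z | tens h k z != 0] `<=` K.
  by rewrite [X in _ `<=` X](closure_id K).1//; exact: closure_subset.
split; last by move=> z /supp; exact: KP.
move=> U PU; split.
- by apply: Cinf_smooth; exact: Cinf_tens.
- by apply: (subclosed_compact _ cK csupp); exact: closed_closure.
- exact: subset_trans csupp (subset_trans KP PU).
Qed.

End tensors.

(** * Densities on an interval and their distribution functions *)

Section densities.
Context {R : realType}.
Implicit Types (c h x : R) (m : nat).

Definition dens m c h x : R := bump m ((x - c) / h) / h.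
Definition cdf m c h x : R := Bump m ((x - c) / h).

Lemma Cinf_scaled (f : R -> R) c h : Cinf f -> Cinf (fun x => f ((x - c) / h)).
Proof.
move=> Cf; rewrite (_ : (fun x => _) = f \o (fun x => h^-1 * x + (- (c / h)))).
  by apply: Cinf_comp1 => //; exact: Cinf_affine.
by apply/funext => x /=; rewrite mulrBl [x / h]mulrC.
Qed.

Lemma Cinf_dens m c h : Cinf (dens m c h).
Proof.
move=> k; rewrite (_ : dens m c h = (fun x => bump m ((x - c) / h)) \* cst h^-1)//.
by apply: CkM; [exact: (Cinf_scaled _ _ (Cinf_bump m))|exact: Ck_cst].
Qed.

Lemma Cinf_cdf m c h : Cinf (cdf m c h).
Proof. exact: (Cinf_scaled _ _ (Cinf_Bump m)). Qed.

Lemma is_derive_affine c h x : is_derive x 1 (fun y : R => (y - c) / h) h^-1.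
Proof.
rewrite (_ : (fun y : R => _) = h^-1 \*: (id - cst c)); last first.
  by apply/funext => y /=; rewrite mulrC.
apply: is_derive_eq; rewrite subr0.
by rewrite -[_ *: _]/(_ * _) mulr1.
Qed.

Lemma derive_scaled (f f' : R -> R) c h :
  (forall x, is_derive x 1 f (f' x)) ->
  'D_1 (fun x => f ((x - c) / h)) = (fun x => f' ((x - c) / h) / h).
Proof.
move=> Hf; apply/funext => x.
have := @is_derive1_comp _ f (fun y => (y - c) / h) x _ _ (Hf _) (is_derive_affine c h x).
by move=> /@derive_val.
Qed.

Lemma derive_cdf m c h : 'D_1 (cdf m c h) = dens m c h.
Proof. exact: (derive_scaled c h (@is_derive_Bump _ m)). Qed.

Lemma dens_ge0 m c h x : 0 < h -> 0 <= dens m c h x.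
Proof. by move=> h0; rewrite divr_ge0 ?bump_ge0// ltW. Qed.

Lemma dens_le m c h x : 0 < h -> dens m c h x <= h^-1.
Proof. by move=> h0; rewrite ler_piMl ?bump_le1// invr_ge0 ltW. Qed.

Lemma cdf_ge0 m c h x : 0 <= cdf m c h x. Proof. exact: Bump_ge0. Qed.

Lemma cdf_le2 m c h x : cdf m c h x <= 2.
Proof. by rewrite (le_trans (Bump_le _ _))// Bump1_le2. Qed.

(** The interval of centre c' and half-length h' lies in that of centre c and
    half-length h, and is not much shorter: in a halved parabolic cube the sides
    shrink by 2 in space and by 4 in time. *)
Definition sub_itv c' h' c h := `|c' - c| + h' <= h /\ h / 4 <= h'.

(** One radius that serves both the density of an interval and those of its
    subintervals [sub_itv]; the factor 1/4 comes from h / 4 <= h'. *)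
Definition supp_radius m h : R := (1 - (1 - bump_radius m) / 4) * h.

Lemma supp_radius_lt m h : 0 < h -> supp_radius m h < h.
Proof.
move=> h0; have /andP[r0 r1] := @bump_radius_bound R m.
by rewrite /supp_radius; nra.
Qed.

Lemma sub_itv_refl c h : 0 < h -> sub_itv c h c h.
Proof. by move=> h0; split; rewrite ?subrr ?normr0; lra. Qed.

Lemma sub_itv_far m c' h' c h x : 0 < h -> sub_itv c' h' c h ->
  supp_radius m h <= `|c - x| -> bump_radius m <= `|(x - c') / h'|.
Proof.
move=> h0 [H1 H2] H3; have /andP[r0 r1] := @bump_radius_bound R m.
have h'0 : 0 < h' by lra.
rewrite normf_div (gtr0_norm h'0) ler_pdivlMr//.
have H4 : `|c - x| <= `|x - c'| + `|c' - c|.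
  rewrite -normrN opprB (le_trans _ (ler_normD _ _))//.
  by rewrite le_eqVlt addrA subrK eqxx.
by move: H3; rewrite /supp_radius; nra.
Qed.

Lemma dens_far m c' h' c h x : 0 < h -> sub_itv c' h' c h ->
  supp_radius m h <= `|c - x| -> dens m c' h' x = 0.
Proof. by move=> h0 s H; rewrite /dens bump_eq0 ?mul0r// (sub_itv_far h0 s). Qed.

(** Both distribution functions are 0 to the left and have reached the same full
    mass to the right; their difference is therefore compactly supported. *)
Lemma cdf_far m c' h' c h x : 0 < h -> sub_itv c' h' c h ->
  supp_radius m h <= `|c - x| -> cdf m c' h' x = cdf m c h x.
Proof.
move=> h0 s H; have [s1 s2] := s.
have F1 := sub_itv_far h0 s H; have F2 := sub_itv_far h0 (sub_itv_refl c h0) H.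
have h'0 : 0 < h' by lra.
have /andP[r0 r1] := @bump_radius_bound R m.
have s3 : c' - c <= `|c' - c| by exact: ler_norm.
have s4 : - (c' - c) <= `|c' - c| by rewrite -normrN ler_norm.
rewrite /cdf.
have [cx|cx] := leP c x.
  have Hc : 0 <= (x - c) / h by rewrite divr_ge0; lra.
  rewrite ger0_norm// in F2.
  rewrite (Bump_right F2) Bump_right//.
  have [x0|x0] := leP 0 (x - c'); first by rewrite ger0_norm ?divr_ge0 ?(ltW h'0) in F1.
  exfalso; move: F1; rewrite ltr0_norm ?pmulr_llt0 ?invr_gt0//.
  rewrite -mulNr ler_pdivlMr// => F1.
  move: H; rewrite ler0_norm /supp_radius; last by lra.
  nra.
have Hc : (x - c) / h <= 0 by rewrite mulr_le0_ge0 ?invr_ge0; lra.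
rewrite ler0_norm// lerNr in F2.
rewrite (Bump_left F2) Bump_left//.
have [x0|x0] := leP (x - c') 0; first by rewrite ler0_norm ?mulr_le0_ge0 ?invr_ge0 ?(ltW h'0)// lerNr in F1.
exfalso; move: F1; rewrite gtr0_norm ?divr_gt0//.
rewrite ler_pdivlMr// => F1.
move: H; rewrite ger0_norm /supp_radius; last by lra.
nra.
Qed.

Lemma CinfB (V : normedModType R) (a b : V -> R) : Cinf a -> Cinf b -> Cinf (a \- b).
Proof.
move=> Ca Cb k; rewrite (_ : a \- b = a \+ (cst (-1) \* b)).
  by apply: CkD => //; apply: CkM => //; exact: Ck_cst.
by apply/funext => x /=; rewrite mulN1r.
Qed.

Lemma derive_cdfB m m' c c' h h' (b : R) :
  'D_1 (cdf m c h \- (b \*: cdf m' c' h')) = dens m c h \- (b \*: dens m' c' h').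
Proof.
apply/funext => x.
have D m0 c0 h0 : is_derive x 1 (cdf m0 c0 h0) (dens m0 c0 h0 x).
  apply: DeriveDef; last exact: (congr1 (fun F => F x) (derive_cdf m0 c0 h0)).
  by apply: diff_derivable; apply: Cinf_differentiable; exact: Cinf_cdf.
exact: (@derive_val _ _ _ _ _ _ _ (is_deriveB (D m c h) (is_deriveZ b (D m' c' h')))).
Qed.

Lemma cdfB_le2 m m' c c' h h' x (b : R) : 0 <= b -> b * Bump m' 1 <= 2 ->
  `|(cdf m c h \- (b \*: cdf m' c' h')) x| <= 2.
Proof.
move=> b0 b2.
have H1 := cdf_ge0 m c h x; have H2 := cdf_le2 m c h x.
have H3 : 0 <= b * cdf m' c' h' x := mulr_ge0 b0 (cdf_ge0 _ _ _ _).
have H4 : b * cdf m' c' h' x <= 2 := le_trans (ler_wpM2l b0 (Bump_le _ _)) b2.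
rewrite [X in `|X|](_ : _ = cdf m c h x - b * cdf m' c' h' x)//.
move: (cdf m c h x) (b * _) H1 H2 H3 H4 => y y' *.
by rewrite ler_norml; apply/andP; split; lra.
Qed.

Lemma derive_cdf_diff m c c' h h' :
  'D_1 (cdf m c h \- cdf m c' h') = dens m c h \- dens m c' h'.
Proof.
have E (f : R -> R) : f = 1 \*: f by apply/funext => x /=; rewrite scale1r.
by rewrite (E (cdf m c' h')) (E (dens m c' h')) derive_cdfB.
Qed.

Lemma cdf_diff_le2 m c c' h h' x : `|(cdf m c h \- cdf m c' h') x| <= 2.
Proof.
have E (f : R -> R) : f = 1 \*: f by apply/funext => y /=; rewrite scale1r.
by rewrite (E (cdf m c' h')) cdfB_le2// mul1r Bump1_le2.
Qed.

End densities.

(** * Integration by parts against tensor test functions *)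

Section weak_bounds.
Context {R : realType} {n : nat}.
Local Notation V := ('rV[R]_n * measurableTypeR R)%type.
Local Notation mu := (@lebesgue_xt R n).
Implicit Types (f g phi : V -> R) (P Q : set V).

Lemma L1_bounded_mul Q f phi (M : R) : measurable Q -> L1 Q f ->
  measurable_fun Q phi -> (forall z, `|phi z| <= M) ->
  mu.-integrable Q (EFin \o (fun z => f z * phi z)).
Proof.
move=> mQ If mphi bphi.
apply: (@integrableMl _ _ _ mu Q mQ (EFin \o f) phi) => //.
exists M; split; first exact: num_real.
by move=> y My x Qx /=; rewrite (le_trans (bphi x))// ltW.
Qed.

Lemma weak_derive_le P Q (v : 'rV[R]_n * R) f g g0 phi (M : R) :
  measurable P -> measurable Q -> P `<=` Q -> weak_derive Q v f g ->
  L1 Q g -> L1 Q g0 -> (forall z, `|g z| <= g0 z) ->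
  test_function Q phi -> measurable_fun Q phi ->
  (forall z, `|phi z| <= M) -> (forall z, phi z != 0 -> P z) ->
  `|\int[mu]_(z in Q) (f z * 'D_v phi z)| <= M * \int[mu]_(z in P) g0 z.
Proof.
move=> mP mQ PQ wd Ig Ig0 gg0 tphi mphi bphi sphi.
have M0 : 0 <= M by apply: le_trans (bphi 0); exact: normr_ge0.
rewrite wd// normrN.
have I1 := L1_bounded_mul mQ Ig mphi bphi.
apply: (le_trans (le_normr_Rintegral mQ I1)).
have I0 : mu.-integrable P (EFin \o g0) by exact: integrableS mQ mP PQ Ig0.
rewrite -RintegralZl//.
have -> : P = Q `&` P by rewrite setIidr.
rewrite Rintegral_mkcondr; apply: le_Rintegral => //.
- exact: (integrable_norm I1).
- have H : mu.-integrable (Q `&` P) (EFin \o (fun z => M * g0 z)).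
    rewrite setIidr//.
    exact: (integrableZl mP M I0).
  by rewrite -restrict_EFin; apply/integrable_restrict.
move=> z Qz; rewrite patchE; case: ifPn => [|/negP zP].
  by move=> _; rewrite normrM mulrC ler_pM.
rewrite (_ : phi z = 0) ?mulr0 ?normr0//.
by apply/eqP; rewrite -[_ == 0]negbK; apply/negP => /sphi; rewrite -inE.
Qed.

Lemma tens_upd_bound (h : 'I_n -> R -> R) k l (f0 : R -> R) (A B C : R) :
  0 < A -> (forall j x, `|h j x| <= A) -> (forall x, `|f0 x| <= B * A) ->
  (forall t, `|k t| <= C) ->
  forall z : V, `|tens (upd h l f0) k z| <= B * A ^+ n * C.
Proof.
move=> A0 hA fB kC z.
rewrite tens_upd !normrM normr_prod ler_pM ?mulr_ge0 ?prodr_ge0//.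
have -> : B * A ^+ n = (B * A) * \prod_(j < n | j != l) A.
  have -> : A ^+ n = \prod_(j < n) A by rewrite prodr_const card_ord.
  by rewrite (bigD1 l)//= mulrA.
apply: ler_pM => //; first exact: prodr_ge0.
by apply: ler_prod => j _; rewrite normr_ge0 hA.
Qed.

Lemma tens_updB (h : 'I_n -> R -> R) k l (f1 f2 : R -> R) (z : V) :
  tens (upd h l (f1 \- f2)) k z = tens (upd h l f1) k z - tens (upd h l f2) k z.
Proof. by rewrite !tens_upd -!mulrBl. Qed.

Lemma tensBr (h : 'I_n -> R -> R) (k1 k2 : R -> R) (z : V) :
  tens h (k1 \- k2) z = tens h k1 z - tens h k2 z.
Proof. by rewrite /tens -mulrBr. Qed.

Section compare.
Variables (Q : set V) (c : 'rV[R]_n * R) (rho : R).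
Local Notation P := (pcube rho c).
Hypotheses (mQ : measurable Q) (rho0 : 0 < rho) (PQ : P `<=` Q).
Variables (m : nat).

Definition admissible_x (h : 'I_n -> R -> R) :=
  (forall l, Cinf (h l)) /\
  (forall l x, supp_radius m rho <= `|c.1 ord0 l - x| -> h l x = 0).

Definition admissible_t (k : R -> R) := Cinf k /\
  (forall t, supp_radius m (rho ^+ 2) <= `|c.2 - t| -> k t = 0).

Lemma admissible_upd h l (f0 : R -> R) : admissible_x h -> Cinf f0 ->
  (forall x, supp_radius m rho <= `|c.1 ord0 l - x| -> f0 x = 0) ->
  admissible_x (upd h l f0).
Proof.
move=> [H1 H2] Cf s; split=> j; rewrite /upd; first by case: ifP.
by case: eqP => [->//|_ x]; exact: H2.
Qed.

Lemma admissible_test h k : admissible_x h -> admissible_t k ->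
  test_function Q (tens h k) /\ (forall z, tens h k z != 0 -> P z).
Proof.
move=> [H1 H2] [K1 K2].
have [T1 T2] := @test_tens R n c rho _ _ h k H1 K1 (supp_radius_lt m rho0)
  (supp_radius_lt m (exprn_gt0 2 rho0)) H2 K2.
by split=> //; exact: T1.
Qed.

Lemma admissible_measurable h k : admissible_x h -> admissible_t k ->
  measurable_fun Q (tens h k).
Proof.
by move=> [H1 _] [K1 _]; apply: measurable_tens => [l|]; exact: Cinf_continuous.
Qed.

Let mP : measurable P. Proof. exact: measurable_pcube. Qed.

(** The step behind every comparison of averages: if two densities of the l-th
    coordinate have the same mass, their difference is lam' with lam compactly
    supported, and the derivative moves onto f. *)
Lemma space_step f g g0 (h : 'I_n -> R -> R) k l lam (A B C : R) :
  weak_derive Q (dir_x l) f g -> L1 Q g -> L1 Q g0 ->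
  (forall z, `|g z| <= g0 z) ->
  admissible_x h -> admissible_t k -> Cinf lam ->
  (forall x, supp_radius m rho <= `|c.1 ord0 l - x| -> lam x = 0) ->
  0 < A -> (forall j x, `|h j x| <= A) -> (forall x, `|lam x| <= B * A) ->
  (forall t, `|k t| <= C) ->
  `|\int[mu]_(z in Q) (f z * tens (upd h l ('D_1 lam)) k z)| <=
    B * A ^+ n * C * \int[mu]_(z in P) g0 z.
Proof.
move=> wd Ig Ig0 gg0 ah ak Clam slam A0 hA lB kC.
have au := admissible_upd ah Clam slam.
have [T1 T2] := admissible_test au ak.
under eq_Rintegral do rewrite -derive_tens_x//.
apply: weak_derive_le => //; [exact: wd|exact: Ig| | ] => //.
  exact: admissible_measurable.
exact: tens_upd_bound.
Qed.

End compare.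
End weak_bounds.

(** * Comparing smoothed averages over a cube and a smaller one *)

Section bump_slope.
Context {R : realType}.

Lemma derive_bump0 (x : R) :
  'D_1 (bump 0) x = psi 2 (2%:R * (1 - x ^+ 2) - 1) * (- (4 * x)).
Proof.
have H1 : is_derive x 1 (fun y : R => 2%:R * (1 - y ^+ 2) - 1) (- (4 * x)).
  rewrite (_ : (fun y : R => _) = (2%:R : R) \*: (cst 1 - id ^+ 2) - cst 1); last first.
    by apply/funext => y /=; rewrite !fctE.
  apply: is_derive_eq; rewrite -![_ *: _]/(_ * _) /=; ring.
have := @is_derive1_comp _ (psi 0) _ x _ _ (is_derive_psi 0 _) H1.
move=> /(@derive_val _ _ _ _ _ _ _) ->.
by rewrite mul0r subr0.
Qed.

Lemma bump_slope (x : R) : `|'D_1 (bump 0) x| <= 24.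
Proof.
rewrite derive_bump0 normrM.
have [y0|y0] := leP (2%:R * (1 - x ^+ 2) - 1) 0; first by rewrite psi_le0// normr0 mul0r.
have H2 := psi_bound 2 (2%:R * (1 - x ^+ 2) - 1).
rewrite (ger0_norm (psi_ge0 _ _)) normrN.
rewrite (gtr0_norm y0) in H2.
have x2 : `|x| ^+ 2 <= 1 by rewrite real_normK ?num_real//; nra.
have x1 : `|x| <= 1 by have := normr_ge0 x; nra.
rewrite normrM (ger0_norm (ler0n _ 4)).
apply: (@le_trans _ _ (6 * 4)); last by rewrite -natrM.
apply: ler_pM => //.
- exact: psi_ge0.
- rewrite (le_trans H2)// -[leRHS]mulr1 ler_pM2l//.
  by have := sqr_ge0 x; lra.
- by rewrite -[leRHS]mulr1 ler_pM2l.
Qed.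

Lemma bump_radius0_le m : bump_radius 0 <= bump_radius m :> R.
Proof.
rewrite /bump_radius lerB// ler_pM2r ?invr_gt0// lef_pV2 ?posrE//.
by rewrite ler_nat.
Qed.

(** The density of level 0, rescaled to the mass of level m, has the same
    distribution function as level m far from the centre. *)
Lemma cdf_fixed_far m (c h x : R) : 0 < h -> supp_radius m h <= `|c - x| ->
  (cdf m c h \- (Bump m 1 / Bump 0 1 \*: cdf 0 c h)) x = 0.
Proof.
move=> h0 H; have F := sub_itv_far h0 (sub_itv_refl c h0) H.
have F0 := le_trans (bump_radius0_le m) F.
have B0 : Bump 0 1 != 0 :> R by rewrite gt_eqF// Bump1_gt0.
rewrite [LHS](_ : _ = cdf m c h x - Bump m 1 / Bump 0 1 * cdf 0 c h x)//.
rewrite /cdf; have [y0|y0] := leP 0 ((x - c) / h).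
  rewrite ger0_norm// in F F0.
  by rewrite (Bump_right F) (Bump_right F0) divfK// subrr.
rewrite ltr0_norm// lerNr in F; rewrite ltr0_norm// lerNr in F0.
by rewrite (Bump_left F) (Bump_left F0) mulr0 subrr.
Qed.

End bump_slope.

Section smoothed_averages.
Context {R : realType} {n : nat}.
Local Notation V := ('rV[R]_n * measurableTypeR R)%type.
Local Notation mu := (@lebesgue_xt R n).
Variables (Q : set V) (c : 'rV[R]_n * R) (rho : R).
Local Notation P := (pcube rho c).
Hypotheses (mQ : measurable Q) (rho0 : 0 < rho) (PQ : P `<=` Q).
Variables (u ut f g0 : V -> R) (fd : 'I_n -> V -> R) (i : 'I_n).
Hypotheses (Iut : L1 Q ut) (If : L1 Q f)
  (Ifd : forall l, L1 Q (fd l)) (Ig0 : L1 Q g0).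
Hypotheses (wut : weak_derive Q dir_t u ut) (wf : weak_derive Q (dir_x i) u f)
  (wfd : forall l, weak_derive Q (dir_x l) f (fd l)).
Hypotheses (utg : forall z, `|ut z| <= g0 z)
  (fdg : forall l z, `|fd l z| <= g0 z).
Variables (c' h' : 'I_n -> R) (c0' h0' : R).
Hypotheses (sub_x : forall l, sub_itv (c' l) (h' l) (c.1 ord0 l) rho)
  (sub_t : sub_itv c0' h0' c.2 (rho ^+ 2)).
Variable m : nat.

Let A := 4 / rho.
Let I0 := \int[mu]_(z in P) g0 z.
Let rho2 : 0 < rho ^+ 2. Proof. exact: exprn_gt0. Qed.
Let mP : measurable P. Proof. exact: measurable_pcube. Qed.
Let A0 : 0 < A. Proof. by rewrite divr_gt0. Qed.
Let h'0 l : 0 < h' l. Proof. by have [_] := sub_x l; apply: lt_le_trans; rewrite divr_gt0. Qed.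
Let h0'0 : 0 < h0'. Proof. by have [_] := sub_t; apply: lt_le_trans; rewrite divr_gt0. Qed.
Let dx' l := dens m (c' l) (h' l).
Let dx l := dens m (c.1 ord0 l) rho.
Let dt' := dens m c0' h0'.
Let dt := dens m c.2 (rho ^+ 2).

Let dx'_bound l x : `|dx' l x| <= A.
Proof.
rewrite ger0_norm ?dens_ge0// (le_trans (dens_le _ _ _ (h'0 l)))//.
have [_ H] := sub_x l.
by rewrite /A -[4 / rho]invrK invf_div lef_pV2 ?posrE ?divr_gt0.
Qed.

Let dx_bound l x : `|dx l x| <= A.
Proof.
rewrite ger0_norm ?dens_ge0// (le_trans (dens_le _ _ _ rho0))//.
by rewrite /A ler_peMl ?invr_ge0 ?(ltW rho0)// ler1n.
Qed.

Let dt'_bound x : `|dt' x| <= 4 / rho ^+ 2.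
Proof.
rewrite ger0_norm ?dens_ge0// (le_trans (dens_le _ _ _ h0'0))//.
have [_ H] := sub_t.
by rewrite -[4 / _]invrK invf_div lef_pV2 ?posrE ?divr_gt0.
Qed.

Let dt_diff_bound x : `|(dt' \- dt) x| <= 4 / rho ^+ 2.
Proof.
have := dt'_bound x; rewrite ger0_norm ?dens_ge0// => H1.
have H2 := dens_le m c.2 x rho2.
have H3 := dens_ge0 m c0' x h0'0; have H4 := dens_ge0 m c.2 x rho2.
have H5 : (rho ^+ 2)^-1 <= 4 / rho ^+ 2 by rewrite ler_peMl ?invr_ge0 ?(ltW rho2)// ler1n.
rewrite /= ler_norml; apply/andP; split; rewrite /dt' /dt in H1 *; lra.
Qed.

Let adm_dx' l x : supp_radius m rho <= `|c.1 ord0 l - x| -> dx' l x = 0.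
Proof. exact: dens_far. Qed.

Let adm_dx l x : supp_radius m rho <= `|c.1 ord0 l - x| -> dx l x = 0.
Proof. by apply: dens_far => //; exact: sub_itv_refl. Qed.

Let adm_dt' : admissible_t c rho m dt'.
Proof. by split; [exact: Cinf_dens|move=> t; exact: dens_far]. Qed.

Let adm_dt : admissible_t c rho m dt.
Proof. by split; [exact: Cinf_dens|move=> t; apply: dens_far => //; exact: sub_itv_refl]. Qed.

(** Hybrids between the densities of the two boxes: consecutive ones differ in a
    single coordinate. *)
Let hyb (j : nat) : 'I_n -> R -> R := fun l => if (l < j)%N then dx l else dx' l.

Let adm_hyb j : admissible_x c rho m (hyb j).
Proof.
split=> l; rewrite /hyb; case: ifP => _; try exact: Cinf_dens.
  exact: adm_dx.
exact: adm_dx'.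
Qed.

Let hyb_bound j l x : `|hyb j l x| <= A.
Proof. by rewrite /hyb; case: ifP => _. Qed.

Let integ h k : admissible_x c rho m h -> admissible_t c rho m k ->
  (forall l x, `|h l x| <= A) -> (exists C, forall t, `|k t| <= C) ->
  mu.-integrable Q (EFin \o (fun z => f z * tens h k z)).
Proof.
move=> ah ak hA [C kC]; apply: L1_bounded_mul => //.
  exact: admissible_measurable ah ak.
exact: tens_bound.
Qed.

Let J h k := \int[mu]_(z in Q) (f z * tens h k z).

Let space_steps j : (j <= n)%N ->
  `|J (hyb 0) dt' - J (hyb j) dt'| <= j%:R * (rho / 2 * A ^+ n * (4 / rho ^+ 2) * I0).
Proof.
elim: j => [|j IH] jn; first by rewrite subrr normr0 mul0r.
have -> : J (hyb 0) dt' - J (hyb j.+1) dt' =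
  (J (hyb 0) dt' - J (hyb j) dt') + (J (hyb j) dt' - J (hyb j.+1) dt') by ring.
rewrite (le_trans (ler_normD _ _))// -natr1 mulrDl mul1r lerD ?IH// 1?ltnW//.
pose l := Ordinal jn.
pose lam := cdf m (c' l) (h' l) \- cdf m (c.1 ord0 l) rho.
have E1 : hyb j = upd (hyb j) l (dx' l).
  by apply/funext => l'; rewrite /upd; case: eqP => // ->; rewrite /hyb ltnn.
have E2 : hyb j.+1 = upd (hyb j) l (dx l).
  apply/funext => l'; rewrite /upd; case: eqP => [->|/eqP ll']; rewrite /hyb/= ?ltnS ?leqnn//.
  rewrite leq_eqVlt; case: eqP => //= e; exfalso; move/negP: ll'; apply.
  by apply/eqP/val_inj.
have dt'b : exists C, forall t, `|dt' t| <= C by exists (4 / rho ^+ 2).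
have IB : J (hyb j) dt' - J (hyb j.+1) dt' =
    \int[mu]_(z in Q) (f z * tens (upd (hyb j) l ('D_1 lam)) dt' z).
  rewrite /J -RintegralB//; [|exact: integ|exact: integ].
  apply: eq_Rintegral => z _; rewrite -mulrBr; congr (_ * _).
  by rewrite /lam derive_cdf_diff tens_updB {1}E1 E2.
rewrite IB; apply: (space_step mQ rho0 PQ (wfd l) (Ifd l) Ig0 (fdg l) (adm_hyb j) adm_dt') => //.
- by apply: CinfB; exact: Cinf_cdf.
- move=> x H; rewrite /lam /= (cdf_far rho0 (sub_x l) H) subrr//.
- move=> x; have -> : rho / 2 * A = 2 by rewrite /A; field; rewrite gt_eqF.
  exact: cdf_diff_le2.
Qed.

(** A density in the direction i with the mass of [dx i] but a slope bounded
    independently of m; the slope of [dx i] itself blows up as m grows. *)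
Let a x := Bump m 1 / Bump 0 1 * dens 0 (c.1 ord0 i) rho x.

Let kap_le : (0 <= Bump m 1 / Bump 0 1 :> R) && (Bump m 1 / Bump 0 1 <= 2 / Bump 0 1 :> R).
Proof.
by rewrite divr_ge0 ?Bump_ge0//= ler_pM2r ?invr_gt0 ?Bump1_gt0// Bump1_le2.
Qed.

Let Cinf_a : Cinf a.
Proof.
move=> k; apply: (@CkM _ _ _ (cst _) (dens 0 (c.1 ord0 i) rho)).
  exact: Ck_cst.
exact: Cinf_dens.
Qed.

Let hybn : hyb n = upd (hyb n) i (dx i).
Proof.
by apply/funext => l'; rewrite /upd; case: eqP => // ->; rewrite /hyb ltn_ord.
Qed.

Let a_far x : supp_radius m rho <= `|c.1 ord0 i - x| -> a x = 0.
Proof.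
move=> H; rewrite /a /dens bump_eq0 ?mul0r ?mulr0//.
exact: le_trans (bump_radius0_le m) (sub_itv_far rho0 (sub_itv_refl _ rho0) H).
Qed.

Let daE x :
  'D_1 a x = Bump m 1 / Bump 0 1 * ('D_1 (bump 0) ((x - c.1 ord0 i) / rho) / rho / rho).
Proof.
  rewrite [LHS](@deriveMl _ _ (dens 0 (c.1 ord0 i) rho) (Bump m 1 / Bump 0 1) x 1); last first.
    by apply/diff_derivable/Cinf_differentiable; exact: Cinf_dens.
  congr (_ * _); rewrite [LHS](@deriveMr _ _ (fun x => bump 0 ((x - c.1 ord0 i) / rho)) rho^-1 x 1); last first.
    apply/diff_derivable/Cinf_differentiable; exact: (Cinf_scaled _ _ (@Cinf_bump R 0)).
  have E : 'D_1 (fun x => bump 0 ((x - c.1 ord0 i) / rho)) =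
      (fun x => 'D_1 (bump 0) ((x - c.1 ord0 i) / rho) / rho).
    have Hb (y : R) : is_derive y 1 (bump 0) ('D_1 (@bump R 0) y).
      apply: derivableP; apply: diff_derivable.
      by apply: Cinf_differentiable; exact: Cinf_bump.
    exact: (derive_scaled (c.1 ord0 i) rho Hb).
  by rewrite [LHS]mulrC; congr (_ * _); exact: (congr1 (fun F => F x) E).
Qed.

Let da_bound x : `|'D_1 a x| <= 12 / Bump 0 1 / rho * A.
Proof.
rewrite daE.
have /andP[k1 k2] := kap_le.
have B0 := @Bump1_gt0 R 0.
rewrite normrM (ger0_norm k1) !normrM (@ger0_norm _ rho^-1) ?invr_ge0 ?(ltW rho0)//.
have -> : 12 / Bump 0 1 / rho * A = 2 / Bump 0 1 * (24 / rho / rho).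
  by rewrite /A; field; rewrite !gt_eqF.
have r0 : 0 <= rho^-1 by rewrite invr_ge0 ltW.
apply: ler_pM => //; first by rewrite !mulr_ge0.
by rewrite !ler_wpM2r// bump_slope.
Qed.

Let ca_bound x : `|a x| <= 2 / Bump 0 1 * A.
Proof.
have /andP[k1 k2] := kap_le.
rewrite /a normrM (ger0_norm k1); apply: ler_pM => //.
rewrite ger0_norm ?dens_ge0// (le_trans (dens_le _ _ _ rho0))//.
by rewrite /A ler_peMl ?invr_ge0 ?(ltW rho0)// ler1n.
Qed.

(** No time derivative of f is available, so the densities in time are changed
    through u: since f is the derivative of u in the direction i, the change of f
    is bounded by the slope of [a] and by u_t. The density in x_i is
    first replaced by [a], at the price of a spatial step. *)
Let time_step :
  `|J (hyb n) dt' - J (hyb n) dt| <=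
   rho / 2 * A ^+ n * (4 / rho ^+ 2) * I0 + 12 / Bump 0 1 / rho * A ^+ n * 2 * I0.
Proof.
have adB : admissible_t c rho m (dt' \- dt).
  split; first by apply: CinfB; exact: Cinf_dens.
  by move=> t H /=; rewrite adm_dt'.2// adm_dt.2// subrr.
have ada : admissible_x c rho m (upd (hyb n) i a) by exact: admissible_upd.
pose lam := cdf m (c.1 ord0 i) rho \- (Bump m 1 / Bump 0 1 \*: cdf 0 (c.1 ord0 i) rho).
have Ccdf0 : Cinf (Bump m 1 / Bump 0 1 \*: cdf 0 (c.1 ord0 i) rho).
  by move=> k; apply: (@CkM _ _ _ (cst _) (cdf 0 (c.1 ord0 i) rho));
    [exact: Ck_cst|exact: Cinf_cdf].
have Dlam : 'D_1 lam = dx i \- a by exact: derive_cdfB.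
have Bb : exists C, forall t, `|(dt' \- dt) t| <= C by exists (4 / rho ^+ 2).
have B1 : exists C, forall t, `|dt' t| <= C by exists (4 / rho ^+ 2).
have B2 : exists C, forall t, `|dt t| <= C.
  by exists (rho ^+ 2)^-1 => t; rewrite ger0_norm ?dens_ge0// dens_le.
have Ia : mu.-integrable Q (EFin \o (fun z => f z * tens (upd (hyb n) i a) (dt' \- dt) z)).
  apply: L1_bounded_mul => //; first exact: admissible_measurable ada adB.
  exact: (tens_upd_bound i A0 (hyb_bound n) ca_bound dt_diff_bound).
have -> : J (hyb n) dt' - J (hyb n) dt =
   \int[mu]_(z in Q) (f z * tens (upd (hyb n) i ('D_1 lam)) (dt' \- dt) z) +
   J (upd (hyb n) i a) (dt' \- dt).
  transitivity (J (hyb n) (dt' \- dt)).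
    rewrite /J -RintegralB//; [|exact: integ|exact: integ].
    by apply: eq_Rintegral => z _; rewrite -mulrBr tensBr.
  rewrite /J Dlam -RintegralD//; last first.
    apply: L1_bounded_mul => //.
      apply: admissible_measurable adB; apply: admissible_upd => //.
        by apply: CinfB => //; exact: Cinf_dens.
      by move=> x H /=; rewrite adm_dx// a_far// subrr.
    have ab x : `|(dx i \- a) x| <= (1 + 2 / Bump 0 1) * A.
      by rewrite (le_trans (ler_normB _ _))// mulrDl mul1r lerD.
    exact: (tens_upd_bound i A0 (hyb_bound n) ab dt_diff_bound).
  by apply: eq_Rintegral => z _; rewrite tens_updB -hybn mulrBr subrK.
rewrite (le_trans (ler_normD _ _))// lerD//.
  apply: (space_step mQ rho0 PQ (wfd i) (Ifd i) Ig0 (fdg i) (adm_hyb n) adB) => //.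
  - by apply: CinfB => //; exact: Cinf_cdf.
  - by move=> x; exact: cdf_fixed_far.
  - move=> x; have -> : rho / 2 * A = 2 by rewrite /A; field; rewrite gt_eqF.
    have /andP[k1 k2] := kap_le.
    by apply: (cdfB_le2 _ _ _ _ _ _ k1); rewrite divfK ?Bump1_le2// gt_eqF// Bump1_gt0.
pose S := cdf m c0' h0' \- cdf m c.2 (rho ^+ 2).
have CS : Cinf S by apply: CinfB; exact: Cinf_cdf.
have DS : 'D_1 S = dt' \- dt by exact: derive_cdf_diff.
have Cda : Cinf ('D_1 a) by exact: Cinf_derive.
have adS : admissible_t c rho m S.
  by split=> // t H; rewrite /S/= (cdf_far rho2 sub_t H) subrr.
have adda : admissible_x c rho m (upd (hyb n) i ('D_1 a)).
  apply: admissible_upd => // x H.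
  rewrite daE derive_bump0 psi_le0 ?mul0r ?mulr0//; apply: bump_arg_le0.
  exact: le_trans (bump_radius0_le m) (sub_itv_far rho0 (sub_itv_refl _ rho0) H).
(* the spatial derivative moves from u onto a, the time derivative from S onto u *)
have -> : J (upd (hyb n) i a) (dt' \- dt) =
    - \int[mu]_(z in Q) (u z * 'D_dir_t (tens (upd (hyb n) i ('D_1 a)) S) z).
  have [T1 _] := admissible_test rho0 PQ ada adB.
  transitivity (- \int[mu]_(z in Q) (u z * 'D_(dir_x i) (tens (upd (hyb n) i a) (dt' \- dt)) z)).
    by rewrite (wf T1) opprK.
  apply: (congr1 -%R); apply: eq_Rintegral => z _.
  by rewrite (derive_tens_x _ _ _ _ Cinf_a) (derive_tens_t _ _ CS) DS.
rewrite normrN.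
have [T1 T2] := admissible_test rho0 PQ adda adS.
apply: (weak_derive_le mP mQ PQ wut Iut Ig0 utg T1) => //.
  exact: admissible_measurable adda adS.
have Sb t : `|S t| <= 2 by exact: cdf_diff_le2.
exact: (tens_upd_bound i A0 (hyb_bound n) da_bound Sb).
Qed.

Definition compare_cst : R := 2 * n%:R + 2 + 24 / Bump 0 1.

Lemma compare_level :
  `|\int[mu]_(z in Q) (f z * tens dx' dt' z) -
    \int[mu]_(z in Q) (f z * tens dx dt z)| <=
  compare_cst * A ^+ n / rho * \int[mu]_(z in P) g0 z.
Proof.
have E0 : hyb 0 = dx' by apply/funext.
have En : hyb n = dx by apply/funext => l; rewrite /hyb ltn_ord.
have := space_steps (leqnn n); have := time_step.
rewrite E0 En -!/(J _ _) -/I0 => H1 H2.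
have -> : J dx' dt' - J dx dt = (J dx' dt' - J dx dt') + (J dx dt' - J dx dt) by ring.
rewrite (le_trans (ler_normD _ _))// (le_trans (lerD H2 H1))// le_eqVlt; apply/orP; left.
by apply/eqP; rewrite /compare_cst; field; rewrite !gt_eqF// Bump1_gt0.
Qed.

End smoothed_averages.

(** * Means over a parabolic cube and over a half-size cube inside it *)

Section mean_compare.
Context {R : realType} {n : nat}.
Local Notation V := ('rV[R]_n * measurableTypeR R)%type.
Local Notation mu := (@lebesgue_xt R n).

Lemma dens_cvg (c h x : R) : 0 < h -> `|x - c| < h ->
  dens m c h x @[m --> \oo] --> h^-1.
Proof.
move=> h0 H; rewrite /dens -[X in _ --> X]mul1r.
apply: cvgM; last exact: cvg_cst.
apply: bump_cvg; rewrite normf_div (gtr0_norm h0) ltr_pdivrMr// mul1r//.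
Qed.

Lemma dens_out m (c h x : R) : 0 < h -> h <= `|x - c| -> dens m c h x = 0.
Proof.
move=> h0 H; rewrite /dens bump_eq0 ?mul0r//.
have /andP[_ r1] := @bump_radius_bound R m.
by rewrite (le_trans (ltW r1))// normf_div (gtr0_norm h0) ler_pdivlMr// mul1r.
Qed.

Definition cube_dens m (rho : R) (c : 'rV[R]_n * R) (z : 'rV[R]_n * R) : R :=
  tens (fun l => dens m (c.1 ord0 l) rho) (dens m c.2 (rho ^+ 2)) z.

Lemma pcubeP (rho : R) (c z : 'rV[R]_n * R) : pcube rho c z <->
  (forall l, `|z.1 ord0 l - c.1 ord0 l| < rho) /\ `|z.2 - c.2| < rho ^+ 2.
Proof.
split=> [[H1 H2]|[H1 H2]]; split=> //.
- by move=> l; rewrite distrC; exact: H1.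
- by move: H2; rewrite /= in_itv/= ltr_distl.
- by move=> l; rewrite distrC; exact: H1.
- by rewrite /= in_itv/= -ltr_distl.
Qed.

Lemma cube_dens_cvg (rho : R) c z : 0 < rho ->
  cube_dens m rho c z @[m --> \oo] --> \1_(pcube rho c) z * rho ^- (n + 2).
Proof.
move=> rho0; have rho2 : 0 < rho ^+ 2 by exact: exprn_gt0.
have [zP|zP] := pselect (pcube rho c z).
  rewrite indicE mem_set// mul1r.
  have [H1 H2] := (pcubeP _ _ _).1 zP.
  rewrite exprD invfM -exprVn -[X in _ ^+ X * _](card_ord n) -prodr_const.
  apply: cvgM; last exact: dens_cvg.
  apply: cvg_big => //; first exact: mul_continuous.
  by move=> l _; exact: dens_cvg.
rewrite indicE memNset// mul0r (_ : (fun m => _) = cst 0); first exact: cvg_cst.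
apply/funext => m; rewrite /cube_dens /tens.
have [[l Hl]|H] := pselect (exists l, rho <= `|z.1 ord0 l - c.1 ord0 l|).
  by rewrite (bigD1 l)//= dens_out// !mul0r.
rewrite (@dens_out _ c.2) ?mulr0// leNgt; apply/negP => H2; apply: zP.
apply/pcubeP; split=> // l; rewrite ltNge; apply/negP => H3; apply: H.
by exists l.
Qed.

Lemma cube_dens_bound m (rho : R) c z : 0 < rho ->
  `|cube_dens m rho c z| <= rho^-1 ^+ n * rho ^- 2.
Proof.
move=> rho0; apply: tens_bound => [l x|t];
  by rewrite ger0_norm ?dens_ge0 ?dens_le ?exprn_gt0.
Qed.

Lemma measurable_cube_dens m (rho : R) c (D : set V) : measurable_fun D (cube_dens m rho c).
Proof. by apply: measurable_tens => [l|]; apply: Cinf_continuous; exact: Cinf_dens. Qed.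

(** The smoothed densities have mass 2^(n+1) in the limit, not 1: each of the n + 1
    factors tends to the indicator of an interval divided by half its length. *)
Lemma integral_cube_dens_cvg (Q : set V) (f : V -> R) (rho : R) c :
  measurable Q -> 0 < rho -> pcube rho c `<=` Q -> L1 Q f ->
  \int[mu]_(z in Q) (f z * cube_dens m rho c z) @[m --> \oo] -->
  2 ^+ n.+1 * mean (pcube rho c) f.
Proof.
move=> mQ rho0 PQ If.
have mP : @measurable _ V (pcube rho c) by exact: measurable_pcube.
have mf : measurable_fun Q f by apply/measurable_EFinP; exact: (measurable_int mu If).
pose M : R := rho^-1 ^+ n * rho ^- 2.
pose F z := f z * (\1_(pcube rho c) z * rho ^- (n + 2)).
have := @dominated_convergence _ V R mu Q mQ
  (fun m z => (f z * cube_dens m rho c z)%:E) (EFin \o F) (fun z => (`|f z| * M)%:E).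
case.
- move=> m; apply/measurable_EFinP; apply: measurable_funM => //.
  exact: measurable_cube_dens.
- apply/measurable_EFinP; apply: measurable_funM => //.
  apply: measurable_funM => //.
- apply: aeW => z _; apply/fine_cvgP; split; first exact: nearW.
  apply: cvgM; [exact: cvg_cst|exact: cube_dens_cvg].
- apply: (@integrableZr _ _ _ mu Q mQ M (EFin \o (fun z => `|f z|))).
  exact: integrable_norm.
- apply: aeW => z m _ /=; rewrite lee_fin normrM ler_wpM2l//.
  exact: cube_dens_bound.
move=> IF _ H.
have -> : 2 ^+ n.+1 * mean (pcube rho c) f = \int[mu]_(z in Q) F z.
  rewrite /mean lebesgue_pcube//=.
  transitivity (rho ^- (n + 2) * \int[mu]_(z in pcube rho c) f z).
    rewrite [LHS]mulrA; congr (_ * _).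
    rewrite exprMn exprD exprS; field.
    by rewrite !expf_neq0 ?gt_eqF.
  rewrite -RintegralZl//; last exact: integrableS mQ mP PQ If.
  have -> : pcube rho c = Q `&` pcube rho c by rewrite setIidr.
  rewrite Rintegral_mkcondr; apply: eq_Rintegral => z _.
  rewrite /F patchE indicE; case: ifPn => _; last by rewrite mul0r mulr0.
  by rewrite mul1r mulrC.
have FN : (\int[mu]_(x in Q) (EFin \o F) x)%E \is a fin_num by exact: integrable_fin_num.
by move: H; rewrite -(fineK FN) => /fine_cvg; exact.
Qed.

Section child.
Variables (Q : set V) (c c' : 'rV[R]_n * R) (rho : R).
Local Notation P := (pcube rho c).
Local Notation C := (pcube (rho / 2) c').
Hypotheses (mQ : measurable Q) (rho0 : 0 < rho) (PQ : P `<=` Q).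
Hypotheses (cx : forall l, `|c'.1 ord0 l - c.1 ord0 l| + rho / 2 <= rho)
  (ct : `|c'.2 - c.2| + (rho / 2) ^+ 2 <= rho ^+ 2).

Lemma child_sub : C `<=` P.
Proof.
move=> z /pcubeP[z1 z2]; apply/pcubeP; split.
  move=> l; rewrite (le_lt_trans (ler_distD (c'.1 ord0 l) _ _))//.
  by have := cx l; have := z1 l; lra.
rewrite (le_lt_trans (ler_distD c'.2 _ _))//.
by apply: lt_le_trans ct; rewrite addrC ltrD2l.
Qed.

Variables (u ut f g0 : V -> R) (fd : 'I_n -> V -> R) (i : 'I_n).
Hypotheses (Iut : L1 Q ut) (If : L1 Q f)
  (Ifd : forall l, L1 Q (fd l)) (Ig0 : L1 Q g0).
Hypotheses (wut : weak_derive Q dir_t u ut) (wf : weak_derive Q (dir_x i) u f)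
  (wfd : forall l, weak_derive Q (dir_x l) f (fd l)).
Hypotheses (utg : forall z, `|ut z| <= g0 z)
  (fdg : forall l z, `|fd l z| <= g0 z).

(** A Poincare inequality in telescoped form: the bound for the smoothed averages
    does not depend on the smoothing, so it passes to the limit. *)
Lemma mean_child :
  `|mean C f - mean P f| <=
   @compare_cst R n * (4 / rho) ^+ n / rho * \int[mu]_(z in P) g0 z.
Proof.
have I0 : 0 <= \int[mu]_(z in P) g0 z.
  by apply: Rintegral_ge0 => z _; apply: le_trans (utg z).
have rho20 : 0 < rho / 2 by rewrite divr_gt0.
have H m : `|\int[mu]_(z in Q) (f z * cube_dens m (rho / 2) c' z) -
    \int[mu]_(z in Q) (f z * cube_dens m rho c z)| <=
   @compare_cst R n * (4 / rho) ^+ n / rho * \int[mu]_(z in P) g0 z.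
  have sx l : sub_itv (c'.1 ord0 l) (rho / 2) (c.1 ord0 l) rho.
    by split; [exact: cx|lra].
  have st : sub_itv c'.2 ((rho / 2) ^+ 2) c.2 (rho ^+ 2).
    by split=> //; rewrite expr_div_n; have := exprn_gt0 2 rho0; lra.
  have X := (compare_level mQ rho0 PQ Iut If Ifd Ig0 wut wf wfd utg fdg sx st m).
  exact: X.
have CP := child_sub.
have L : `|\int[mu]_(z in Q) (f z * cube_dens m (rho / 2) c' z) -
    \int[mu]_(z in Q) (f z * cube_dens m rho c z)| @[m --> \oo] -->
    `|2 ^+ n.+1 * mean C f - 2 ^+ n.+1 * mean P f|.
  apply: cvg_norm; apply: cvgB; apply: integral_cube_dens_cvg => //.
  exact: subset_trans CP PQ.
set B := (X in _ <= X); rewrite -/B in H.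
have Lc : (fun _ : nat => B) @ \oo --> B by exact: cvg_cst.
have H2 : `|2 ^+ n.+1 * mean C f - 2 ^+ n.+1 * mean P f| <= B.
  exact: ler_cvg_to L Lc (nearW _ H).
move: (mean C f) (mean P f) B H2 {L Lc H} => a b B H2.
apply: (le_trans _ H2); rewrite -mulrBr normrM.
by rewrite ler_peMl// ger0_norm ?exprn_ge0// exprn_ege1// ler1n.
Qed.

End child.

End mean_compare.

(** * Dyadic parabolic cells *)

Section dyadic_line.
Context {R : realType}.
Implicit Types (L x : R) (M k : nat).

(** Centre of the k-th of the M equal subintervals of (-L, L). *)
Definition ctr M L k : R := L * ((2 * k + 1)%:R / M%:R - 1).

Lemma ctr_sub M L k x : (k < M)%N -> 0 < L ->
  `|x - ctr M L k| < L / M%:R -> `|x| < L.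
Proof.
move=> kM L0; have M0 : 0 < M%:R :> R by rewrite ltr0n (leq_ltn_trans _ kM).
rewrite ltr_distl => /andP[H1 H2]; rewrite ltr_norml.
have k1 : (k.+1%:R : R) <= M%:R by rewrite ler_nat.
have E : L = L / M%:R * M%:R by rewrite divfK// gt_eqF.
have LM : 0 < L / M%:R by rewrite divr_gt0.
have Ec : ctr M L k = L / M%:R * (2 * k%:R + 1 - M%:R).
  rewrite /ctr natrD natrM; field; rewrite gt_eqF//.
move: H1 H2; rewrite Ec; move: LM k1 E; set a := L / M%:R; rewrite -natr1.
have : (0 : R) <= k%:R by [].
move: (k%:R) (M%:R) => K Mr k0 a0 k1 E H1 H2.
rewrite E; apply/andP; split; nra.
Qed.

Lemma ctr_disj M L k k' x : (0 < M)%N -> 0 < L ->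
  `|x - ctr M L k| < L / M%:R -> `|x - ctr M L k'| < L / M%:R -> k = k'.
Proof.
move=> M0 L0 H1 H2; apply/eqP/negPn/negP => kk'.
have M0' : 0 < M%:R :> R by rewrite ltr0n.
wlog kk : k k' H1 H2 kk' / (k < k')%N.
  by move=> W; move: (kk'); rewrite neq_ltn => /orP[] H;
    [exact: (W k k')|apply: (W k' k) => //; rewrite eq_sym].
have LM : 0 < L / M%:R by rewrite divr_gt0.
have Ec j : ctr M L j = L / M%:R * (2 * j%:R + 1 - M%:R).
  rewrite /ctr natrD natrM; field; rewrite gt_eqF//.
move: H1 H2; rewrite !Ec !ltr_distl => /andP[a1 a2] /andP[a3 a4].
have k1 : (k%:R + 1 : R) <= k'%:R by rewrite natr1 ler_nat.
nra.
Qed.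

Lemma ctr_parent M L B k : (0 < M)%N -> (0 < B)%N -> 0 < L ->
  `|ctr (M * B) L k - ctr M L (k %/ B)| + L / (M * B)%:R <= L / M%:R.
Proof.
move=> M0 B0 L0.
have M0' : 0 < M%:R :> R by rewrite ltr0n.
have B0' : 0 < B%:R :> R by rewrite ltr0n.
rewrite {1}(divn_eq k B) /ctr; set q := (k %/ B)%N; set s := (k %% B)%N.
have sB : (s.+1%:R : R) <= B%:R by rewrite ler_nat ltn_pmod.
have LM : 0 < L / M%:R / B%:R by rewrite !divr_gt0.
pose a := L / M%:R / B%:R.
have -> : L * ((2 * (q * B + s) + 1)%:R / (M * B)%:R - 1) -
  L * ((2 * q + 1)%:R / M%:R - 1) = a * (2 * s%:R + 1 - B%:R).
  by rewrite !(natrD, natrM) /a; field; rewrite !gt_eqF.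
have -> : L / (M * B)%:R = a by rewrite natrM /a; field; rewrite !gt_eqF.
have -> : L / M%:R = a * B%:R by rewrite divfK// gt_eqF.
rewrite normrM (gtr0_norm LM) -[X in _ + X]mulr1 -mulrDr ler_pM2l//.
rewrite -lerBrDr ler_norml; move: sB; rewrite -natr1.
have : (0 : R) <= s%:R by [].
by move=> ? ?; apply/andP; split; lra.
Qed.

End dyadic_line.

Section cells.
Context {R : realType} {n : nat}.
Local Notation V := ('rV[R]_n * measurableTypeR R)%type.
Local Notation mu := (@lebesgue_xt R n).
Variable r : R.
Hypothesis r0 : 0 < r.
Local Notation Q := (@pcube R n r 0).

(** Generation j splits every side in space into 2^j and the one in time into 4^j
    pieces, so that the cells are again parabolic cubes. *)
Definition cellI j : finType := ({ffun 'I_n -> 'I_(2 ^ j)} * 'I_(4 ^ j))%type.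

Definition crad j : R := r / (2 ^ j)%:R.

Definition cctr j (k : cellI j) : 'rV[R]_n * R :=
  (\row_l ctr (2 ^ j) r (k.1 l), ctr (4 ^ j) (r ^+ 2) k.2).

Definition cell j (k : cellI j) : set V := pcube (crad j) (cctr k).

Lemma crad_gt0 j : 0 < crad j.
Proof. by rewrite divr_gt0// ltr0n expn_gt0. Qed.

Lemma crad2 j : crad j ^+ 2 = r ^+ 2 / (4 ^ j)%:R.
Proof. by rewrite /crad expr_div_n -natrX -expnM mulnC expnM. Qed.

Lemma cradS j : crad j.+1 = crad j / 2.
Proof. by rewrite /crad expnS natrM invfM mulrA mulrAC. Qed.

Lemma cellP j (k : cellI j) z : cell k z <->
  (forall l, `|z.1 ord0 l - ctr (2 ^ j) r (k.1 l)| < r / (2 ^ j)%:R) /\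
  `|z.2 - ctr (4 ^ j) (r ^+ 2) k.2| < r ^+ 2 / (4 ^ j)%:R.
Proof.
split.
  move=> /pcubeP[H1 H2]; split; last by rewrite -crad2.
  by move=> l; have := H1 l; rewrite mxE.
move=> [H1 H2]; apply/pcubeP; split; last by rewrite crad2.
by move=> l; rewrite mxE.
Qed.

Lemma measurable_cell j (k : cellI j) : measurable (cell k).
Proof. exact: measurable_pcube. Qed.

Lemma cell_sub j (k : cellI j) : cell k `<=` Q.
Proof.
move=> z /cellP[H1 H2]; apply/pcubeP; split => /=.
  by move=> l; rewrite mxE subr0; exact: (ctr_sub (ltn_ord _) r0 (H1 l)).
by rewrite subr0; exact: (ctr_sub (ltn_ord _) (exprn_gt0 2 r0) H2).
Qed.

Lemma cell_inj j (k k' : cellI j) z : cell k z -> cell k' z -> k = k'.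
Proof.
move=> /cellP[H1 H2] /cellP[H3 H4].
have E1 : k.1 = k'.1.
  by apply/ffunP => l; apply/val_inj; apply: (ctr_disj _ r0 (H1 l) (H3 l)); rewrite expn_gt0.
have E2 : k.2 = k'.2.
  by apply/val_inj; apply: (ctr_disj _ (exprn_gt0 2 r0) H2 H4); rewrite expn_gt0.
by case: k k' E1 E2 {H1 H2 H3 H4} => ? ? [? ?] /= -> ->.
Qed.

Lemma parent_proof B j (k : 'I_(B.+1 ^ j.+1)) : (k %/ B.+1 < B.+1 ^ j)%N.
Proof. by rewrite ltn_divLR// -expnSr. Qed.

Definition parent j (k : cellI j.+1) : cellI j :=
  ([ffun l => Ordinal (parent_proof (k.1 l))], Ordinal (parent_proof k.2)).

Lemma parent_ctr_x j (k : cellI j.+1) l :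
  `|(cctr k).1 ord0 l - (cctr (parent k)).1 ord0 l| + crad j / 2 <= crad j.
Proof.
rewrite -cradS /crad !mxE ffunE /=.
have := @ctr_parent _ (2 ^ j) r 2 (k.1 l) (expn_gt0 2 j) isT r0.
by rewrite -[(2 ^ j * 2)%N]expnSr.
Qed.

Lemma parent_ctr_t j (k : cellI j.+1) :
  `|(cctr k).2 - (cctr (parent k)).2| + (crad j / 2) ^+ 2 <= crad j ^+ 2.
Proof.
rewrite -cradS !crad2 /=.
have := @ctr_parent _ (4 ^ j) (r ^+ 2) 4 k.2 (expn_gt0 4 j) isT (exprn_gt0 2 r0).
by rewrite -[(4 ^ j * 4)%N]expnSr.
Qed.

Lemma cell_parent j (k : cellI j.+1) : cell k `<=` cell (parent k).
Proof.
rewrite /cell cradS; apply: child_sub; [exact: parent_ctr_x|exact: parent_ctr_t].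
Qed.

Lemma mu_cell j (k : cellI j) :
  mu (cell k) = ((2 * crad j) ^+ n * (2 * crad j ^+ 2))%:E.
Proof. by rewrite lebesgue_pcube// crad_gt0. Qed.

Definition step j (b : cellI j -> R) (z : V) : R := \sum_k b k * \1_(cell k) z.

Lemma stepE j (b : cellI j -> R) k z : cell k z -> step b z = b k.
Proof.
move=> kz; rewrite /step (bigD1 k)//= indicE mem_set// mulr1 big1 ?addr0// => k' k'k.
rewrite indicE memNset ?mulr0// => k'z; move/negP: k'k; apply.
by apply/eqP; exact: cell_inj k'z kz.
Qed.

Lemma step_out j (b : cellI j -> R) z : (forall k : cellI j, ~ cell k z) -> step b z = 0.
Proof.
by move=> H; rewrite /step big1// => k _; rewrite indicE memNset ?mulr0//; exact: H.
Qed.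

Lemma measurable_step j (b : cellI j -> R) D : measurable_fun D (step b).
Proof.
apply: measurable_sum => k; apply: measurable_funM => //.
by apply: measurable_indic; exact: measurable_cell.
Qed.

Lemma step_ge0 j (b : cellI j -> R) z : (forall k, 0 <= b k) -> 0 <= step b z.
Proof. by move=> b0; apply: sumr_ge0 => k _; rewrite mulr_ge0// indicE ler0n. Qed.

Let mQ : @measurable _ V Q. Proof. exact: measurable_pcube. Qed.

Lemma muQ_fin : (mu Q < +oo)%E.
Proof. by rewrite lebesgue_pcube// ltry. Qed.

Lemma integral_step j (b : cellI j -> R) (w : V -> \bar R) :
  (forall k, 0 <= b k) -> (forall z, 0 <= w z)%E -> measurable_fun Q w ->
  (\int[mu]_(z in Q) ((step b z)%:E * w z) =
   \sum_k (b k)%:E * \int[mu]_(z in cell k) w z)%E.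
Proof.
move=> b0 w0 mw.
transitivity (\int[mu]_(z in Q) (\sum_k ((b k)%:E * (w \_ (cell k)) z)))%E.
  apply: eq_integral => z _; rewrite /step -sumEFin ge0_sume_distrl; last first.
    by move=> k _; rewrite lee_fin mulr_ge0// indicE.
  apply: eq_bigr => k _; rewrite EFinM patchE indicE; case: ifPn => _.
    by rewrite mule1.
  by rewrite -[point]/(0%E : \bar R) mulr0n !mule0 mul0e.
have mres k : measurable_fun Q (w \_ (cell k)).
  apply/(measurable_restrict _ _ _).1 => //; first exact: measurable_cell.
  by rewrite setIidr; [exact: (measurable_funS mQ (@cell_sub _ k) mw)|exact: cell_sub].
have res0 k z : (0 <= (w \_ (cell k)) z)%E by rewrite patchE; case: ifP.
rewrite ge0_integral_sum//; last 2 first.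
- by move=> k; apply: measurable_funeM; exact: mres.
- by move=> k z _; rewrite mule_ge0// lee_fin.
apply: eq_bigr => k _; rewrite ge0_integralZl//; [|exact: mres|by rewrite lee_fin].
congr (_ * _)%E; rewrite -integral_mkcondr setIidr//; exact: cell_sub.
Qed.

Lemma integral_cells_le j (w : V -> \bar R) : (forall z, 0 <= w z)%E ->
  measurable_fun Q w ->
  (\sum_(k : cellI j) \int[mu]_(z in cell k) w z <= \int[mu]_(z in Q) w z)%E.
Proof.
move=> w0 mw; have := @integral_step j (fun=> 1) w (fun=> ler01) w0 mw.
under eq_bigr do rewrite mul1e.
move=> <-; apply: ge0_le_integral => //.
- by move=> z _; rewrite mule_ge0// lee_fin step_ge0.
- by apply: emeasurable_funM => //; apply/measurable_EFinP; exact: measurable_step.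
move=> z _; have [[k kz]|H] := pselect (exists k : cellI j, cell k z).
  by rewrite (stepE _ kz) mul1e.
by rewrite step_out ?mul0e// => k kz; apply: H; exists k.
Qed.

Lemma card_cellI j : #|cellI j| = ((2 ^ j) ^ n * 4 ^ j)%N.
Proof. by rewrite card_prod card_ffun !card_ord. Qed.

(** The open cells are disjoint, and their volumes add up to that of the cube. *)
Lemma cell_cover j : mu (Q `\` \bigcup_(k in [set: cellI j]) cell k) = 0%E.
Proof.
set U := \bigcup_(_ in _) _.
have mU : @measurable _ V U.
  apply: fin_bigcup_measurable => [|k _]; last exact: measurable_cell.
  exact: finite_finset.
have UQ : U `<=` Q by move=> z [k _]; exact: cell_sub.
have muU : mu U = mu Q.
  rewrite -[in LHS](setIidl UQ) -integral_indic//.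
  transitivity (\int[mu]_(z in Q) ((step (fun _ : cellI j => 1) z)%:E * 1))%E.
    apply: eq_integral => z _; rewrite mule1; congr EFin.
    have [[k kz]|H] := pselect (exists k : cellI j, cell k z).
      by rewrite (stepE _ kz) indicE mem_set//; exists k.
    rewrite step_out ?indicE ?memNset//; first by move=> [k _ kz]; apply: H; exists k.
    by move=> k kz; apply: H; exists k.
  rewrite integral_step//.
  rewrite (eq_bigr (fun=> (r ^+ (n + 2) * 2 ^+ n.+1 / (2 ^ j)%:R ^+ n / (4 ^ j)%:R)%:E)); last first.
    move=> k _; rewrite mul1e integral_cst ?mul1e; last exact: measurable_cell.
    rewrite [LHS]mu_cell crad2 /crad exprMn expr_div_n exprD (exprS 2 n); congr EFin.
    by field; rewrite ?expf_neq0 ?pnatr_eq0 ?expn_eq0.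
  rewrite sumEFin sumr_const card_cellI lebesgue_pcube//; congr EFin.
  rewrite -[LHS]mulr_natr natrM (natrX _ _ n) exprMn exprD (exprS 2 n).
  by field; rewrite ?expf_neq0 ?pnatr_eq0 ?expn_eq0.
rewrite measureD//; last exact: muQ_fin.
rewrite setIidr// -[X in (_ - X)%E]/(mu U) muU subee// ge0_fin_numE ?muQ_fin//.
Qed.

Lemma ae_cells : {ae mu, forall z, Q z -> forall j, exists k : cellI j, cell k z}.
Proof.
have H j : {ae mu, forall z, Q z -> exists k : cellI j, cell k z}.
  exists (Q `\` \bigcup_(k in [set: cellI j]) cell k); split.
  - apply: measurableD => //; apply: fin_bigcup_measurable => [|k _].
      exact: finite_finset.
    exact: measurable_cell.
  - exact: cell_cover.
  move=> z /= /not_implyP[Qz nk]; split=> // -[k _ kz]; apply: nk.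
  by exists k.
by apply: filterS (ae_foralln H) => z Hz Qz j; exact: Hz.
Qed.

End cells.

(** * Integrable functions with vanishing integrals over open sets *)

Section open_sets.
Context {R : realType} {n : nat}.
Local Notation V := ('rV[R]_n * measurableTypeR R)%type.
Local Notation T := ('rV[R]_n * R)%type.
Local Notation mu := (@lebesgue_xt R n).

(** Measurability is a separate condition because the sigma-algebra is defined through
    the coordinates and not through the topology. *)
Definition Gopen : set (set T) := [set A : set T | open A /\ measurable A].

Lemma continuous_coord (l : 'I_n) : continuous (fun z : T => z.1 ord0 l).
Proof. exact/Cinf_continuous/Cinf_coord. Qed.

Lemma Gopen_preimage (f : T -> R) : continuous f -> measurable_fun setT f ->
  measurable_fun setT (f : g_sigma_algebraType Gopen -> R).
Proof.
move=> cf mf; apply: (measurability _ (RGenOInfty.measurableE R)).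
move=> _ [_ [a ->] <-]; apply: sub_sigma_algebra; split.
  rewrite setTI; apply: open_comp => // z _; exact: cf.
by apply: mf => //; exact: measurable_itv.
Qed.

Lemma measurable_open_generated (A : set T) :
  measurable A -> <<s Gopen >> A.
Proof.
move=> mA.
have mid : measurable_fun setT (idfun : g_sigma_algebraType Gopen -> T).
  apply/measurable_fun_pairP; split.
    apply/measurable_fun_rVP => l.
    apply: Gopen_preimage; first exact: continuous_coord.
    exact: (measurableT_comp (measurable_rV_coord l) measurable_fst).
  apply: Gopen_preimage; last exact: measurable_snd.
  by move=> z; exact: cvg_snd.
by have := mid measurableT A mA; rewrite setTI.
Qed.

(** The sets over which the integral vanishes form a Dynkin system, and the open
    sets are closed under intersection and generate. *)
Lemma ae_zero_of_open (Q : set V) (h : V -> R) : measurable Q -> L1 Q h ->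
  (forall A : set T, open A -> measurable A -> (\int[mu]_(z in Q `&` A) (h z)%:E = 0)%E) ->
  {ae mu, forall z, Q z -> h z = 0}.
Proof.
move=> mQ Ih H0.
have IA (A : set V) : measurable A -> mu.-integrable (Q `&` A) (EFin \o h).
  by move=> mA; apply: integrableS Ih => //; exact: measurableI.
pose C := [set A : set V | measurable A /\ (\int[mu]_(z in Q `&` A) (h z)%:E = 0)%E].
have dC : dynkin C.
  have QT : C setT.
    split=> //; apply: H0; [exact: openT|exact: measurableT].
  split=> //.
  - move=> A [mA A0]; split; first exact: measurableC.
    have D : (\int[mu]_(z in Q) (h z)%:E =
        \int[mu]_(z in Q `&` A) (h z)%:E + \int[mu]_(z in Q `&` ~` A) (h z)%:E)%E.
      rewrite -integral_setU_EFin//.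
      + by rewrite -setIUr setUv setIT.
      + exact: measurableI.
      + by apply: measurableI => //; exact: measurableC.
      + rewrite -setIUr setUv setIT.
        by apply/measurable_EFinP; exact: (measurable_int mu Ih).
      + by apply/disj_setPS => z [[_ ?] [_ ?]].
    by have := QT.2; rewrite setIT D A0 add0e.
  - move=> F tF CF; have mF k : measurable (F k) by have [] := CF k.
    split; first exact: bigcupT_measurable.
    rewrite setI_bigcupr integral_bigcup.
    + by rewrite eseries0// => k _ _; have [] := CF k.
    + exact: trivIset_setIl.
    + by move=> k; exact: measurableI.
    + by rewrite -setI_bigcupr; apply: IA; exact: bigcupT_measurable.
have GI : setI_closed Gopen.
  by move=> A B [oA mA] [oB mB]; split; [exact: openI|exact: measurableI].
have CA (A : set V) : measurable A -> C A.
  move=> mA; have := measurable_open_generated mA.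
  rewrite -(setI_closed_g_dynkin_g_sigma_algebra GI).
  apply: smallest_sub => //.
  by move=> B [oB mB]; split=> //; exact: H0.
have := @integral_ae_eq _ V R mu Q mQ (cst 0%E) (EFin \o h) Ih.
move=> /(_ (measurable_cst _)) H.
have : ae_eq mu Q (EFin \o h) (cst 0%E).
  apply: H => E EQ mE; rewrite integral0.
  by have [_] := CA E mE; rewrite setIidr.
by apply: filterS => z Hz /Hz [].
Qed.

End open_sets.

(** * Telescoping along nested cells *)

Section series_bounds.
Context {R : realType}.

Lemma nneseries_le (a : nat -> \bar R) (B : \bar R) :
  (forall j, 0 <= a j)%E -> (forall J, \sum_(0 <= j < J) a j <= B)%E ->
  (\sum_(j <oo) a j <= B)%E.
Proof.
move=> a0 aB; apply: lime_le; first exact: is_cvg_nneseries.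
exact: nearW.
Qed.

Lemma geometric_sum_le (nu : R) J : 0 <= nu -> nu < 1 ->
  \sum_(0 <= j < J) nu ^+ j <= (1 - nu)^-1.
Proof.
move=> n0 n1; have d0 : 0 < 1 - nu by rewrite subr_gt0.
rewrite -[leRHS]mul1r ler_pdivlMr// mulrC.
elim: J => [|J IH]; first by rewrite big_geq// mulr0.
suff -> : (1 - nu) * \sum_(0 <= j < J.+1) nu ^+ j = 1 - nu ^+ J.+1.
  by rewrite gerBl exprn_ge0.
elim: J.+1 => [|K IHK]; first by rewrite big_geq// expr0 mulr0 subrr.
by rewrite big_nat_recr//= mulrDr IHK exprS; ring.
Qed.

End series_bounds.

Section telescoping.
Context {R : realType} {n : nat}.
Local Notation V := ('rV[R]_n * measurableTypeR R)%type.
Local Notation T := ('rV[R]_n * R)%type.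
Local Notation mu := (@lebesgue_xt R n).
Variable r : R.
Hypothesis r0 : 0 < r.
Local Notation Q := (@pcube R n r 0).
Variables (f g0 : V -> R) (K : R).
Hypotheses (If : L1 Q f) (Ig0 : L1 Q g0) (g00 : forall z, 0 <= g0 z) (K0 : 0 <= K).

(** [E j] is the conditional expectation of f on the cells of generation j, and [Y]
    dominates its jumps. *)
Let E j : V -> R := @step R n r j (fun k : @cellI n j => mean (cell r k) f).
Let Y j : V -> R := @step R n r j (fun k : @cellI n j => crad r j * mean (cell r k) g0).

Hypothesis jump : forall j (k : @cellI n j.+1),
  `|mean (cell r k) f - mean (cell r (parent k)) f| <=
  K * (crad r j * mean (cell r (parent k)) g0).

Let mQ : @measurable _ V Q. Proof. exact: measurable_pcube. Qed.

Lemma mean_ge0 (U : set V) (h : V -> R) : (forall z, 0 <= h z) -> 0 <= mean U h.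
Proof.
move=> h0; apply: mulr_ge0; last exact: Rintegral_ge0.
by rewrite invr_ge0; apply: fine_ge0; exact: measure_ge0.
Qed.

Let b_ge0 j (k : @cellI n j) : 0 <= crad r j * mean (cell r k) g0.
Proof. by rewrite mulr_ge0 ?mean_ge0// ltW// crad_gt0. Qed.

Let Y_ge0 j z : 0 <= Y j z. Proof. by apply: step_ge0 => k; exact: b_ge0. Qed.

Lemma mean_cell j (k : @cellI n j) (h : V -> R) :
  mean (cell r k) h * fine (mu (cell r k)) = \int[mu]_(z in cell r k) h z.
Proof.
rewrite /mean mulrC mulVKf// (mu_cell r0 k)/=.
by rewrite !mulf_neq0 ?expf_neq0 ?mulf_neq0 ?gt_eqF ?crad_gt0 ?exprn_gt0 ?crad_gt0.
Qed.

Lemma integrable_cell (h : V -> R) j (k : @cellI n j) : L1 Q h -> L1 (cell r k) h.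
Proof.
move=> Ih; apply: integrableS Ih => //; [exact: measurable_cell|exact: cell_sub].
Qed.

Lemma cell0E (k : @cellI n 0) : cell r k = Q.
Proof.
rewrite /cell /crad expn0 divr1; congr pcube.
rewrite /cctr; congr (_, _).
  apply/rowP => l; rewrite !mxE /ctr.
  by case: (k.1 l) => -[|//] /= _; rewrite muln0 add0n divr1 subrr mulr0.
by rewrite /ctr; case: (k.2) => -[|//] /= _; rewrite muln0 add0n divr1 subrr mulr0.
Qed.

Let chain z := forall j, exists k : @cellI n j, cell r k z.

Let E0 z : chain z -> E 0 z = mean Q f.
Proof. by move=> /(_ 0%N)[k kz]; rewrite /E (stepE r0 _ kz) cell0E. Qed.

Let E_jump j z : chain z -> `|E j.+1 z - E j z| <= K * Y j z.
Proof.
move=> /(_ j.+1)[k kz]; have pz := cell_parent r0 kz.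
by rewrite /E /Y (stepE r0 _ kz) !(stepE r0 _ pz); exact: jump.
Qed.

Let E_bound J z : chain z -> `|E J z - mean Q f| <= K * \sum_(0 <= j < J) Y j z.
Proof.
move=> cz; elim: J => [|J IH]; first by rewrite E0// subrr normr0 big_geq// mulr0.
rewrite big_nat_recr//= mulrDr.
have -> : E J.+1 z - mean Q f = (E J z - mean Q f) + (E J.+1 z - E J z) by ring.
by rewrite (le_trans (ler_normD _ _))// lerD// E_jump.
Qed.

(** The radii decay geometrically while the integral of g0 stays fixed: this makes
    the sum of the jumps finite almost everywhere. *)
Let intY j : (\int[mu]_(z in Q) (Y j z)%:E <= (crad r j)%:E * \int[mu]_(z in Q) (g0 z)%:E)%E.
Proof.
have mg : measurable_fun Q (EFin \o g0) := measurable_int mu Ig0.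
have mg' : (forall z, 0 <= (g0 z)%:E)%E by move=> z; rewrite lee_fin.
have -> : (\int[mu]_(z in Q) (Y j z)%:E =
    \sum_(k : @cellI n j) (crad r j)%:E * \int[mu]_(z in cell r k) (g0 z)%:E)%E.
  transitivity (\int[mu]_(z in Q) ((Y j z)%:E * 1))%E.
    by apply: eq_integral => z _; rewrite mule1.
  rewrite (integral_step r0 (b_ge0 (j := j))) //.
  apply: eq_bigr => k _; rewrite integral_cst ?mul1e; last exact: measurable_cell.
  have mc := mu_cell r0 k.
  rewrite [X in (_ * X)%E](_ : _ = (fine (mu (cell r k)))%:E); last first.
    by rewrite -[LHS]/(mu (cell r k)) mc.
  rewrite -EFinM -mulrA mean_cell EFinM; congr (_ * _)%E.
  rewrite /Rintegral fineK//; apply: integrable_fin_num => //; first exact: measurable_cell.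
  exact: integrable_cell.
rewrite -ge0_sume_distrr; last by move=> k _; apply: integral_ge0.
apply: lee_wpmul2l; first by rewrite lee_fin ltW// crad_gt0.
exact: integral_cells_le.
Qed.

Let S z : \bar R := (\sum_(j <oo) (Y j z)%:E)%E.

Let S_ge0 z : (0 <= S z)%E.
Proof. by apply: nneseries_ge0 => j _ _; rewrite lee_fin. Qed.

Let mS : measurable_fun Q S.
Proof.
apply: ge0_emeasurable_sum => // [j z _ _|j _]; first by rewrite lee_fin.
by apply/measurable_EFinP; exact: measurable_step.
Qed.

Let S_integrable : mu.-integrable Q S.
Proof.
apply/integrableP; split; first exact: mS.
rewrite (eq_integral S); last by move=> z _; rewrite gee0_abs.
rewrite integral_nneseries//; last 2 first.
- by move=> j; apply/measurable_EFinP; exact: measurable_step.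
- by move=> j z _; rewrite lee_fin.
have I0 : (\int[mu]_(z in Q) (g0 z)%:E)%E \is a fin_num by exact: integrable_fin_num.
apply: (@le_lt_trans _ _ ((2 * r)%:E * \int[mu]_(z in Q) (g0 z)%:E)%E); last first.
  by rewrite -(fineK I0) -EFinM ltry.
apply: nneseries_le => [j|J]; first by apply: integral_ge0 => z _; rewrite lee_fin.
apply: (@le_trans _ _ (\sum_(0 <= j < J) ((crad r j)%:E * \int[mu]_(z in Q) (g0 z)%:E))%E).
  by apply: lee_sum => j _; exact: intY.
rewrite -(fineK I0); under eq_bigr do rewrite -EFinM.
rewrite sumEFin -EFinM lee_fin -mulr_suml ler_wpM2r//.
  by rewrite fine_ge0// integral_ge0// => z _; rewrite lee_fin.
rewrite /crad -mulr_sumr mulrC ler_wpM2r ?(ltW r0)//.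
under eq_bigr do rewrite natrX -exprVn.
have h1 : (2^-1 : R) < 1 by lra.
have h0 : 0 <= (2^-1 : R) by lra.
have h2 : 1 - 2^-1 = (2^-1 : R) by lra.
by have := geometric_sum_le J h0 h1; rewrite h2 invrK.
Qed.

Let good z := chain z /\ (S z < +oo)%E.

Let ae_good : {ae mu, forall z, Q z -> good z}.
Proof.
have H1 := @ae_cells R n r r0.
have H2 := integrable_ae mQ S_integrable.
apply: (@filterS2 _ _ (ae_filter_ringOfSetsType mu) _ _ _ _ H1 H2).
move=> z {}H1 {}H2 Qz; split; first exact: H1.
by have := H2 Qz; rewrite ge0_fin_numE.
Qed.

Let sumY_le z J : (S z < +oo)%E -> \sum_(0 <= j < J) Y j z <= fine (S z).
Proof.
move=> Sz; have Sf : S z \is a fin_num by rewrite ge0_fin_numE.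
rewrite -lee_fin fineK// -sumEFin.
by apply: nneseries_lim_ge => j _; rewrite lee_fin.
Qed.

Let E_cvg z : good z -> cvgn (fun j => E j z).
Proof.
move=> [cz Sz].
have cY : cvgn (series (fun j => K * Y j z)).
  apply: nondecreasing_is_cvgn.
    by apply: nondecreasing_series => j _ _; rewrite mulr_ge0.
  exists (K * fine (S z)) => _ [J _ <-].
  by rewrite /series/= -mulr_sumr ler_wpM2l// sumY_le.
have cD : cvgn (series (telescope (fun j => E j z))).
  apply: normed_cvg; apply: series_le_cvg cY => j; first exact: normr_ge0.
    by apply: mulr_ge0.
  exact: E_jump.
rewrite (_ : (fun j => E j z) = (fun j => E 0 z + series (telescope (fun j => E j z)) j)).
  by apply: is_cvgD => //; exact: is_cvg_cst.
by apply/funext => j; exact: (eq_sum_telescope (fun j => E j z)).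
Qed.

(** The upper limit is taken to have a function that is measurable everywhere. *)
Let F z : R := fine (limn_esup (fun j => (E j z)%:E)).

Let E_cvgF z : good z -> E j z @[j --> \oo] --> F z.
Proof.
move=> gz; have c := E_cvg gz.
have cE : (fun j => (E j z)%:E) @ \oo --> (limn (fun j => E j z))%:E.
  by apply/fine_cvgP; split; [exact: nearW|exact: c].
rewrite /F (is_cvg_limn_esupE); last by apply/cvg_ex; eexists; exact: cE.
by rewrite (cvg_lim _ cE)//=.
Qed.

Let mF : measurable_fun Q F.
Proof.
apply: (@measurableT_comp _ _ _ _ _ _ fine) => //.
apply: measurable_fun_limn_esup => j; apply/measurable_EFinP; exact: measurable_step.
Qed.

Let G z : \bar R := (`|mean Q f|%:E + K%:E * S z)%E.

Let G_integrable : mu.-integrable Q G.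
Proof.
apply: integrableD => //; last exact: integrableZl.
apply/integrableP; split; first exact: measurable_cst.
rewrite integral_cst// lte_mul_pinfty ?abse_ge0//.
exact: (muQ_fin r0).
Qed.

Let E_dom z j : good z -> ((`|E j z|)%:E <= G z)%E.
Proof.
move=> [cz Sz]; have Sf : S z \is a fin_num by rewrite ge0_fin_numE.
rewrite /G -(fineK Sf) -EFinM -EFinD lee_fin.
have -> : E j z = mean Q f + (E j z - mean Q f) by ring.
rewrite (le_trans (ler_normD _ _))// lerD2l (le_trans (E_bound _ _))//.
by rewrite ler_wpM2l// sumY_le.
Qed.

(** The indicator of the union of the cells of generation j lying inside A: [E j]
    and f have the same integral against it, and it tends to the indicator of A. *)
Let inner (A : set T) j : V -> R :=
  @step R n r j (fun k : @cellI n j => (`[< cell r k `<=` A >])%:R).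

Let inner_bound A j z : 0 <= inner A j z <= 1.
Proof.
have [[k kz]|H] := pselect (exists k : @cellI n j, cell r k z).
  by rewrite /inner (stepE r0 _ kz); case: asbool; rewrite ?ler01 ?lexx.
by rewrite /inner step_out ?lexx ?ler01// => k kz; apply: H; exists k.
Qed.

Let inner_cvg A z : open A -> chain z -> inner A j z @[j --> \oo] --> (\1_A z : R).
Proof.
move=> oA cz; have [Az|Az] := pselect (A z); last first.
  rewrite indicE memNset//.
  rewrite (_ : (fun j => _) = cst 0); first exact: cvg_cst.
  apply/funext => j; have [k kz] := cz j.
  rewrite /inner (stepE r0 _ kz); case: asboolP => // /(_ _ kz).
  by [].
rewrite indicE mem_set//.
have /nbhs_ballP[e /= e0 eA] : nbhs z A by exact: open_nbhs_nbhs.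
apply: cvg_near_cst.
have cr0 : crad r j @[j --> \oo] --> (0 : R).
  rewrite (_ : (fun j => _) = geometric r 2^-1); last first.
    by apply/funext => j /=; rewrite /crad natrX exprVn.
  by apply: cvg_geometric; rewrite ger0_norm//; lra.
near=> j; have [k kz] := cz j.
rewrite /inner (stepE r0 _ kz); case: asboolP => //; case=> y ky.
apply: eA.
have c0 := crad_gt0 r0 j.
have c1 : crad r j < 1 by near: j; exact: (cvgr_lt _ cr0).
have c2 : crad r j < e / 2 by near: j; apply: (cvgr_lt _ cr0); rewrite divr_gt0.
move: ky kz => /pcubeP[y1 y2] /pcubeP[z1 z2]; split.
  split=> // i l; rewrite (ord1 i).
  rewrite /ball /= (le_lt_trans (ler_distD ((cctr r k).1 ord0 l) _ _))//.
  by have := y1 l; have := z1 l; rewrite [in X in _ -> X -> _]distrC; lra.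
rewrite /ball /= (le_lt_trans (ler_distD ((cctr r k).2) _ _))//.
move: y2 z2; rewrite [in X in X -> _]distrC.
move: (`|_ - _|) (`|_ - _|) => a b b2 a2.
have : crad r j ^+ 2 <= crad r j by rewrite expr2 ler_piMl// ltW.
by move: a2 b2; move: (_ ^+ 2) => w; lra.
Unshelve. all: by end_near. Qed.

Let integral_step_signed j (b : @cellI n j -> R) (h : V -> R) : L1 Q h ->
  (\int[mu]_(z in Q) (step r b z * h z)%:E =
   \sum_k (b k)%:E * \int[mu]_(z in cell r k) (h z)%:E)%E.
Proof.
move=> Ih.
have Ires (k : @cellI n j) : mu.-integrable Q ((EFin \o h) \_ (cell r k)).
  have mk : measurable (cell r k) by exact: measurable_cell.
  apply/(integrable_restrict mu mk mQ).
  by rewrite setIidr; [exact: (integrable_cell k Ih)|exact: cell_sub].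
transitivity (\int[mu]_(z in Q) (\sum_k ((b k)%:E * ((EFin \o h) \_ (cell r k)) z)))%E.
  apply: eq_integral => z _; rewrite /step mulr_suml -sumEFin.
  apply: eq_bigr => k _; rewrite patchE indicE; case: ifPn => _ /=.
    by rewrite mulr1.
  by rewrite -[point]/(0%E : \bar R) mulr0n mulr0 mul0r mule0.
rewrite integral_sum//; last by move=> k; apply: integrableZl.
apply: eq_bigr => k _; rewrite integralZl//.
congr (_ * _)%E; rewrite -integral_mkcondr setIidr//; exact: cell_sub.
Qed.

Let E_integrable j : L1 Q (E j).
Proof.
apply: measurable_bounded_integrable => //.
- exact: (muQ_fin r0).
- exact: measurable_step.
exists (\sum_(k : @cellI n j) `|mean (cell r k) f|); split; first exact: num_real.
move=> M HM z _ /=; apply: le_trans (ltW HM).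
have [[k kz]|H] := pselect (exists k : @cellI n j, cell r k z).
  by rewrite /E (stepE r0 _ kz) (bigD1 k)//= lerDl sumr_ge0.
rewrite /E step_out ?normr0 ?sumr_ge0// => k kz; apply: H; by exists k.
Qed.

Let inner_eq A j :
  (\int[mu]_(z in Q) (inner A j z * E j z)%:E = \int[mu]_(z in Q) (inner A j z * f z)%:E)%E.
Proof.
rewrite !integral_step_signed//; apply: eq_bigr => k _; congr (_ * _)%E.
transitivity (\int[mu]_(z in cell r k) (cst (mean (cell r k) f)%:E z))%E.
  by apply: eq_integral => z; rewrite inE => kz; rewrite /E (stepE r0 _ kz).
rewrite integral_cst; last exact: measurable_cell.
have mc := mu_cell r0 k.
rewrite [X in (_ * X)%E](_ : _ = (fine (mu (cell r k)))%:E); last first.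
  by rewrite -[LHS]/(mu (cell r k)) mc.
rewrite -EFinM mean_cell /Rintegral fineK//; apply: integrable_fin_num.
  exact: measurable_cell.
exact: integrable_cell.
Qed.

Let mf : measurable_fun Q f.
Proof. by apply/measurable_EFinP; exact: (measurable_int mu If). Qed.

Let F_dcvg (A : set T) : open A -> measurable A ->
  mu.-integrable Q (fun z => (\1_A z * F z)%:E) /\
  (\int[mu]_(z in Q) (\1_A z * F z)%:E = \int[mu]_(z in Q) (\1_A z * f z)%:E)%E.
Proof.
move=> oA mA.
have mI : measurable_fun Q (\1_A : V -> R).
  by apply: (@measurable_indic _ V R Q A); exact: mA.
have L1 := @dominated_convergence _ V R mu Q mQ
  (fun j z => (inner A j z * E j z)%:E) (fun z => (\1_A z * F z)%:E) G.
have L2 := @dominated_convergence _ V R mu Q mQ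
  (fun j z => (inner A j z * f z)%:E) (fun z => (\1_A z * f z)%:E) (fun z => `|f z|%:E).
case: L1 => //.
- move=> j; apply/measurable_EFinP; apply: measurable_funM; exact: measurable_step.
- apply/measurable_EFinP; exact: measurable_funM.
- apply: (@filterS _ _ (ae_filter_ringOfSetsType mu) _ _ _ ae_good) => z gz Qz; have {}gz := gz Qz.
  apply/fine_cvgP; split; first exact: nearW.
  by apply: cvgM; [apply: inner_cvg => //; exact: gz.1|exact: E_cvgF].
- apply: (@filterS _ _ (ae_filter_ringOfSetsType mu) _ _ _ ae_good) => z gz j Qz; have {}gz := gz Qz => /=.
  apply: le_trans (E_dom j gz); rewrite lee_fin normrM ler_piMl//.
  by have /andP[i0 i1] := inner_bound A j z; rewrite ger0_norm.
move=> IF _ H1; split; first exact: IF.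
case: L2 => //.
- move=> j; apply/measurable_EFinP; apply: measurable_funM => //; exact: measurable_step.
- apply/measurable_EFinP; exact: measurable_funM.
- apply: (@filterS _ _ (ae_filter_ringOfSetsType mu) _ _ _ ae_good) => z gz Qz; have {}gz := gz Qz.
  apply/fine_cvgP; split; first exact: nearW.
  by apply: cvgM; [apply: inner_cvg => //; exact: gz.1|exact: cvg_cst].
- exact: (integrable_norm If).
- apply: aeW => z j _ /=; rewrite lee_fin normrM ler_piMl//.
  by have /andP[i0 i1] := inner_bound A j z; rewrite ger0_norm.
move=> _ _ H2.
have H3 : (\int[mu]_(z in Q) (inner A j z * f z)%:E)%E @[j --> \oo] -->
    (\int[mu]_(z in Q) (\1_A z * F z)%:E)%E.
  by rewrite -(eq_cvg _ _ (fun j => inner_eq A j)); exact: H1.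
by apply: (cvg_unique _ H3 H2); exact: ereal_hausdorff.
Qed.

Let F_integrable : L1 Q F.
Proof.
have [IF _] := F_dcvg openT measurableT.
by apply: eq_integrable IF => // z _ /=; rewrite indicE mem_set// mul1r.
Qed.

Let f_eq_F : {ae mu, forall z, Q z -> f z - F z = 0}.
Proof.
apply: (@ae_zero_of_open R n Q (fun z => f z - F z)) => //.
  by apply: (@integrableB _ V R mu Q mQ (EFin \o f) (EFin \o F)).
move=> A oA mA; have [IF H] := F_dcvg oA mA.
rewrite integral_mkcondr.
transitivity (\int[mu]_(z in Q) ((\1_A z * f z)%:E - (\1_A z * F z)%:E))%E.
  apply: eq_integral => z _; rewrite patchE indicE; case: ifPn => _.
    by rewrite !mul1r.
  by rewrite -[point]/(0%E : \bar R) mulr0n !mul0r subee.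
have mI : measurable_fun Q (\1_A : V -> R).
  by apply: (@measurable_indic _ V R Q A); exact: mA.
have IfA : mu.-integrable Q (fun z => (\1_A z * f z)%:E).
  apply: le_integrable If => //.
    by apply/measurable_EFinP; exact: measurable_funM.
  move=> z _ /=; rewrite lee_fin normrM ler_piMl//.
  by rewrite indicE; case: (_ \in _); rewrite ?normr1 ?normr0.
by rewrite integralB// H subee// integrable_fin_num.
Qed.

(** The limit F of the averages is f: both have the same integral over every open
    set. This replaces the Lebesgue differentiation theorem on parabolic cubes. *)
Theorem chain_bound : {ae mu, forall z, Q z ->
  (`|f z - mean Q f|%:E <= K%:E * \sum_(j <oo) (Y j z)%:E)%E}.
Proof.
apply: (@filterS2 _ _ (ae_filter_ringOfSetsType mu) _ _ _ _ ae_good f_eq_F).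
move=> z gz fF Qz; have {}gz := gz Qz.
have -> : f z = F z by apply/eqP; rewrite -subr_eq0; apply/eqP; exact: fF.
have [cz Sz] := gz.
have Sf : S z \is a fin_num by rewrite ge0_fin_numE.
rewrite -/(S z) -(fineK Sf) -EFinM lee_fin.
have L : `|E j z - mean Q f| @[j --> \oo] --> `|F z - mean Q f|.
  by apply: cvg_norm; apply: cvgB; [exact: E_cvgF|exact: cvg_cst].
have Lc : (fun _ : nat => K * fine (S z)) @ \oo --> K * fine (S z) by exact: cvg_cst.
apply: (ler_cvg_to L Lc); apply: nearW => j.
by rewrite (le_trans (E_bound _ _))// ler_wpM2l// sumY_le.
Qed.

End telescoping.

(** * The weight, its dual and the Hoelder inequality on a cube *)

Section young.
Context {R : realType}.
Implicit Types p x c I X S : R.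

Lemma young_powR p x c : 1 < p -> 0 <= x -> 0 <= c ->
  x * c `^ (p - 1) <= x `^ p / p + c `^ p * ((p - 1) / p).
Proof.
move=> p1 x0 c0; have p0 : 0 < p by lra.
have pm : 0 < p - 1 by lra.
have q0 : 0 < p / (p - 1) by rewrite divr_gt0.
have := @conjugate_powR _ x (c `^ (p - 1)) p (p / (p - 1)) x0 (powR_ge0 _ _) p0 q0.
rewrite -powRrM [(p - 1) * _]mulrC divfK ?gt_eqF// invf_div; apply.
by field; rewrite !gt_eqF.
Qed.

Lemma powR_invK p x : 0 < p -> 0 <= x -> (x `^ p^-1) `^ p = x.
Proof. by move=> p0 x0; rewrite -powRrM mulVf ?gt_eqF// powRr1. Qed.

(** Hoelder's inequality from Young's by optimising the parameter, at
    c^p = X / S; the degenerate cases X = 0 and S = 0 are limits of the parameter. *)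
Lemma young_opt p I X S : 1 < p -> 0 <= I -> 0 <= X -> 0 <= S ->
  (forall c, 0 < c -> c `^ (p - 1) * I <= X / p + c `^ p * S * ((p - 1) / p)) ->
  I `^ p <= X * S `^ (p - 1).
Proof.
move=> p1 I0 X0 S0 H; have p0 : 0 < p by lra.
have pm : 0 < p - 1 by lra.
have q1 : 0 < (p - 1) / p <= 1 by rewrite divr_gt0//= ler_pdivrMr// mul1r; lra.
have pi : 0 < p^-1 <= 1 by rewrite invr_gt0 p0/= invf_le1// ltW.
move: I0; rewrite le_eqVlt => /predU1P[<-|I0].
  by rewrite powR0 ?gt_eqF// mulr_ge0// powR_ge0.
move: S0; rewrite le_eqVlt => /predU1P[S0|S0].
  exfalso; have c0 : 0 < ((X + 1) / I) `^ (p - 1)^-1.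
    by rewrite powR_gt0// divr_gt0//; lra.
  have := H _ c0; rewrite -S0 mulr0 mul0r addr0 powR_invK//; last by rewrite divr_ge0; lra.
  by rewrite divfK ?gt_eqF//; nra.
move: X0; rewrite le_eqVlt => /predU1P[X0|X0].
  exfalso; have c0 : 0 < I / (2 * S) by rewrite divr_gt0//; lra.
  have := H _ c0; rewrite -X0 mul0r add0r -(mulr_powRB1 (ltW c0) p0).
  set cp := _ `^ (p - 1); have cp0 : 0 < cp by rewrite powR_gt0.
  have -> : I / (2 * S) * cp * S * ((p - 1) / p) = cp * (I * ((p - 1) / p) / 2).
    by field; rewrite !gt_eqF.
  by rewrite ler_pM2l//; nra.
pose c := (X / S) `^ p^-1.
have c0 : 0 < c by rewrite powR_gt0// divr_gt0.
have cp : c `^ p = X / S by rewrite powR_invK// divr_ge0// ltW.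
have := H _ c0; rewrite cp divfK ?gt_eqF//.
have -> : X / p + X * ((p - 1) / p) = X by field; rewrite gt_eqF.
move=> H1.
have H2 : (c `^ (p - 1) * I) `^ p <= X `^ p.
  apply: ge0_ler_powR => //; rewrite ?nnegrE; [lra| |lra].
  by rewrite mulr_ge0// ?powR_ge0// ltW.
move: H2; rewrite powRM ?powR_ge0 ?(ltW I0)// -powRrM [(p - 1) * p]mulrC powRrM cp.
rewrite -(mulr_powRB1 (ltW X0) p0).
have -> : X `^ (p - 1) = (X / S) `^ (p - 1) * S `^ (p - 1).
  by rewrite -powRM ?divfK ?gt_eqF// ?divr_ge0// ltW.
rewrite mulrCA ler_pM2l//.
by rewrite powR_gt0// divr_gt0.
Qed.

End young.

Section weight_cubes.
Context {R : realType} {n : nat}.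
Local Notation V := ('rV[R]_n * measurableTypeR R)%type.
Local Notation mu := (@lebesgue_xt R n).
Variables (p : R) (w : V -> R) (A : R).
Hypotheses (p1 : 1 < p) (Aw : Ap_weight p w) (ApA : Ap_const p w = A%:E).

Let p0 : 0 < p. Proof. by move: p1; lra. Qed.
Let pm : 0 < p - 1. Proof. by move: p1; lra. Qed.

Lemma weight_ge0 z : 0 <= w z. Proof. by have [[]] := Aw. Qed.

Lemma weight_measurable (D : set V) : measurable_fun D w.
Proof. by have [[_ mw _] _ _] := Aw; apply: measurable_funTS; exact: mw. Qed.

Lemma dual_ge0 z : (0 <= dual_weight p w z)%E.
Proof. by rewrite /dual_weight inve_ge0 lee_fin powR_ge0. Qed.

Lemma dual_measurable (D : set V) : measurable_fun D (dual_weight p w).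
Proof.
apply: measurable_funTS.
have mv : measurable_fun setT (fun z => w z `^ (p - 1)^-1).
  apply: (@measurableT_comp _ _ _ _ _ _ (@powR R ^~ (p - 1)^-1) _ w) => //.
  exact: weight_measurable.
rewrite (_ : dual_weight p w = fun z => if w z `^ (p - 1)^-1 == 0 then +oo%E
    else (w z `^ (p - 1)^-1)^-1%:E); last first.
  by apply/funext => z; rewrite /dual_weight inver.
apply: measurable_fun_ifT => //.
  exact: measurable_fun_eqr.
apply/measurable_EFinP.
rewrite (_ : (fun x => _) = (fun x => w x `^ (- (p - 1)^-1))); last first.
  by apply/funext => z; rewrite powRN.
apply: (@measurableT_comp _ _ _ _ _ _ (@powR R ^~ (- (p - 1)^-1)) _ w) => //.
exact: weight_measurable.
Qed.

Lemma wmeasure_pcube_lty s c : (wmeasure w (pcube s c) < +oo)%E.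
Proof.
have [[w0 mw wK] _ _] := Aw.
pose K : set V := [set x : 'rV[R]_n | forall l, `[c.1 ord0 l - s, c.1 ord0 l + s]%classic (x ord0 l)]
   `*` `[c.2 - s ^+ 2, c.2 + s ^+ 2]%classic.
have cK : compact (K : set ('rV[R]_n * R)).
  apply: compact_setX; last exact: segment_compact.
  apply: (@rV_compact _ _ (fun l => `[c.1 ord0 l - s, c.1 ord0 l + s]%classic)).
  by move=> l; exact: segment_compact.
have mK : measurable K.
  apply: measurableX; last exact: measurable_itv.
  apply: (@measurable_rV_box _ _ (fun l => `[c.1 ord0 l - s, c.1 ord0 l + s]%classic)).
  by move=> l; exact: measurable_itv.
apply: le_lt_trans (wK _ cK).
apply: ge0_subset_integral => //.
- exact: measurable_pcube.
- by apply/measurable_EFinP; exact: weight_measurable.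
- by move=> z _; rewrite lee_fin.
move=> z /pcubeP[H1 H2]; split => /=.
  by move=> l; rewrite in_itv/= -ler_distl ltW.
by rewrite in_itv/= -ler_distl ltW.
Qed.

Definition dmeasure (U : set V) : \bar R := (\int[mu]_(z in U) dual_weight p w z)%E.

Lemma mu_pcube s (c : 'rV[R]_n * R) : 0 < s ->
  exists2 m : R, 0 < m & mu (pcube s c) = m%:E.
Proof.
move=> s0; exists ((2 * s) ^+ n * (2 * s ^+ 2)); last exact: lebesgue_pcube.
by rewrite mulr_gt0 ?exprn_gt0 ?mulr_gt0 ?exprn_gt0.
Qed.

Lemma dmeasure_pcube_lty s c : 0 < s -> (dmeasure (pcube s c) < +oo)%E.
Proof.
move=> s0; have [_ /(_ c s s0) + _] := Aw.
rewrite /emean; have [m m0 ->] := mu_pcube c s0.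
move=> H; rewrite ltey; apply/eqP => Hd; move: H; rewrite -/(dmeasure _) Hd.
by rewrite inver (negbTE (lt0r_neq0 m0)) gt0_muley ?lte_fin ?invr_gt0// ltxx.
Qed.

(** Pointwise Young inequality between h w^(1/p) and w^(-1/p). It stays true where
    w = 0, since the dual weight is infinite there. *)
Lemma young_weight (h c : R) z : 0 <= h -> 0 < c ->
  ((c `^ (p - 1) * h)%:E <= (p^-1 * (h `^ p * w z))%:E +
     (c `^ p * ((p - 1) / p))%:E * dual_weight p w z)%E.
Proof.
move=> h0 c0; rewrite /dual_weight inver.
have k0 : 0 < c `^ p * ((p - 1) / p) by rewrite mulr_gt0 ?powR_gt0// divr_gt0.
have := weight_ge0 z; rewrite le_eqVlt => /predU1P[<-|w0].
  have e0 : (p - 1)^-1 != 0 by rewrite invr_eq0 gt_eqF.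
  rewrite (powR0 e0) eqxx gt0_muley ?lte_fin//.
  by rewrite addey// leey.
have d0 : 0 < w z `^ (p - 1)^-1 by rewrite powR_gt0.
rewrite gt_eqF// -EFinM -EFinD lee_fin.
set D := (w z `^ (p - 1)^-1)^-1; have D0 : 0 < D by rewrite invr_gt0.
have H := ler_wpM2l (ltW D0) (young_powR p1 (divr_ge0 h0 (ltW D0)) (ltW c0)).
have E1 : D * (h / D * c `^ (p - 1)) = c `^ (p - 1) * h by field; rewrite gt_eqF.
have E2 : D * (h / D) `^ p = h `^ p * w z.
  have -> : (h / D) `^ p = h `^ p * D^-1 `^ p by apply: powRM => //; rewrite invr_ge0 ltW.
  rewrite mulrCA; congr (_ * _).
  have -> : D = w z `^ (- (p - 1)^-1) by rewrite powRN.
  rewrite -powRN opprK -powRrM -powRD; last by apply/implyP => _; rewrite gt_eqF.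
  rewrite -[RHS]powRr1 ?(ltW w0)//; congr (_ `^ _).
  by field; rewrite gt_eqF.
have E3 : p^-1 * (h `^ p * w z) = D * ((h / D) `^ p / p) by rewrite -E2; ring.
have E4 : c `^ p * ((p - 1) / p) * D = D * (c `^ p * ((p - 1) / p)) by rewrite mulrC.
by rewrite -E1 E3 E4 -mulrDr.
Qed.

Section hoelder.
Variables (s : R) (c : 'rV[R]_n * R) (h : V -> R).
Local Notation P := (pcube s c : set V).
Hypotheses (s0 : 0 < s) (h0 : forall z, 0 <= h z) (mh : measurable_fun P h).
Let X : \bar R := (\int[mu]_(z in P) (h z `^ p * w z)%:E)%E.
Hypothesis X_lty : (X < +oo)%E.

Let mP : measurable P. Proof. exact: measurable_pcube. Qed.

Let X_ge0 : (0 <= X)%E.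
Proof. by apply: integral_ge0 => z _; rewrite lee_fin mulr_ge0 ?powR_ge0 ?weight_ge0. Qed.

Lemma dmeasure_ge0 (U : set V) : (0 <= dmeasure U)%E.
Proof. by apply: integral_ge0 => z _; exact: dual_ge0. Qed.

Let young_integral t : 0 < t ->
  ((t `^ (p - 1))%:E * \int[mu]_(z in P) (h z)%:E <=
   (p^-1)%:E * X + (t `^ p * ((p - 1) / p))%:E * dmeasure P)%E.
Proof.
move=> t0.
have k0 : 0 <= t `^ p * ((p - 1) / p) by rewrite mulr_ge0 ?powR_ge0 ?divr_ge0 ?ltW.
have mhw : measurable_fun P (fun z => h z `^ p * w z).
  apply: measurable_funM; last exact: weight_measurable.
  by apply: (@measurableT_comp _ _ _ _ _ _ (@powR R ^~ p) _ h).
have md : measurable_fun P (dual_weight p w) by exact: dual_measurable.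
have EZ (a : R) (F : V -> \bar R) : 0 <= a -> (forall z, 0 <= F z)%E ->
    measurable_fun P F ->
    (a%:E * \int[mu]_(z in P) F z = \int[mu]_(z in P) (a%:E * F z))%E.
  by move=> a0 F0 mF; rewrite ge0_integralZl.
have F1 z : (0 <= (h z)%:E)%E by rewrite lee_fin.
have F2 z : (0 <= (h z `^ p * w z)%:E)%E.
  by rewrite lee_fin mulr_ge0 ?powR_ge0 ?weight_ge0.
have pi0 : 0 <= p^-1 by rewrite invr_ge0 ltW.
have mh' : measurable_fun P (fun z => (h z)%:E) by exact/measurable_EFinP.
have mhw' : measurable_fun P (fun z => (h z `^ p * w z)%:E) by exact/measurable_EFinP.
rewrite (EZ _ _ (powR_ge0 _ _) F1 mh') (EZ _ _ pi0 F2 mhw') (EZ _ _ k0 dual_ge0 md).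
rewrite -ge0_integralD//; first last.
- by apply: measurable_funeM.
- by move=> z _; apply: mule_ge0; [rewrite lee_fin|exact: dual_ge0].
- by apply: measurable_funeM.
- by move=> z _; apply: mule_ge0; [rewrite lee_fin|exact: F2].
apply: ge0_le_integral => //.
- by move=> z _; rewrite -EFinM lee_fin mulr_ge0 ?powR_ge0.
- by apply: measurable_funeM; exact/measurable_EFinP.
- apply: emeasurable_funD; first by apply: measurable_funeM; exact/measurable_EFinP.
  exact: measurable_funeM.
- by move=> z _; rewrite -!EFinM; exact: young_weight.
Qed.

Lemma integral_lty_cube : (\int[mu]_(z in P) (h z)%:E < +oo)%E.
Proof.
have := young_integral ltr01; rewrite powR1 mul1e => /le_lt_trans; apply.
have dl := dmeasure_pcube_lty c s0; have d0 := dmeasure_ge0 P.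
rewrite lte_add_pinfty//.
  by rewrite lte_mul_pinfty// lee_fin invr_ge0 ltW.
by rewrite lte_mul_pinfty// lee_fin mulr_ge0 ?powR_ge0 ?divr_ge0 ?ltW.
Qed.

Lemma hoelder_cube : (fine (\int[mu]_(z in P) (h z)%:E)) `^ p <=
  fine X * fine (dmeasure P) `^ (p - 1).
Proof.
have dl := dmeasure_pcube_lty c s0; have d0 := dmeasure_ge0 P.
have df : dmeasure P \is a fin_num by rewrite ge0_fin_numE.
have Xf : X \is a fin_num by rewrite ge0_fin_numE.
have I0 : (0 <= \int[mu]_(z in P) (h z)%:E)%E.
  by apply: integral_ge0 => z _; rewrite lee_fin.
have If : (\int[mu]_(z in P) (h z)%:E)%E \is a fin_num.
  by rewrite ge0_fin_numE// integral_lty_cube.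
apply: young_opt => //; rewrite ?fine_ge0// => t t0.
have := young_integral t0.
rewrite -{1}(fineK If) -{1}(fineK Xf) -{1}(fineK df) -!EFinM -EFinD lee_fin.
by rewrite [p^-1 * _]mulrC [X in _ <= _ + X -> _]mulrAC.
Qed.

End hoelder.

End weight_cubes.

(** * Consequences of the A_p condition *)

Lemma powR_cancel_le {R : realType} (b e x y : R) : 0 < b -> 0 < e -> 0 <= x -> 0 <= y ->
  x `^ e <= b * y `^ e -> b `^ (- e^-1) * x <= y.
Proof.
move=> b0 e0 x0 y0 H.
have : (x `^ e) `^ e^-1 <= (b * y `^ e) `^ e^-1.
  by apply: ge0_ler_powR; rewrite ?nnegrE ?invr_ge0 ?(ltW e0) ?powR_ge0// mulr_ge0 ?powR_ge0// ltW.
rewrite powRM ?powR_ge0 ?(ltW b0)// -!powRrM mulfV ?gt_eqF// !powRr1// => H1.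
by rewrite powRN ler_pdivrMl ?powR_gt0.
Qed.

Section weight_reals.
Context {R : realType} {n : nat}.
Local Notation V := ('rV[R]_n * measurableTypeR R)%type.
Local Notation mu := (@lebesgue_xt R n).
Variables (p : R) (w : V -> R) (A : R).
Hypotheses (p1 : 1 < p) (Aw : Ap_weight p w) (ApA : Ap_const p w = A%:E).

Let p0 : 0 < p. Proof. by move: p1; lra. Qed.
Let pm : 0 < p - 1. Proof. by move: p1; lra. Qed.

Definition vol (s : R) : R := (2 * s) ^+ n * (2 * s ^+ 2).
Definition wR (U : set V) : R := fine (wmeasure w U).
Definition dR (U : set V) : R := fine (dmeasure p w U).

Lemma vol_gt0 s : 0 < s -> 0 < vol s.
Proof. by move=> s0; rewrite mulr_gt0 ?exprn_gt0 ?mulr_gt0 ?exprn_gt0. Qed.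

Lemma vol_half s : vol (s / 2) = vol s / 2 ^+ (n + 2).
Proof.
rewrite /vol; have -> : 2 * (s / 2) = 2 * s / 2 by rewrite mulrA.
by rewrite (expr_div_n (2 * s)) (expr_div_n s) exprD; field; rewrite expf_neq0.
Qed.

Lemma mu_vol s (c : 'rV[R]_n * R) : 0 < s -> mu (pcube s c) = (vol s)%:E.
Proof. exact: lebesgue_pcube. Qed.

Lemma wmeasure_ge0 (U : set V) : (0 <= wmeasure w U)%E.
Proof. by apply: integral_ge0 => z _; rewrite lee_fin (weight_ge0 Aw). Qed.

Lemma wRE s c : wmeasure w (pcube s c) = (wR (pcube s c))%:E.
Proof. by rewrite fineK// ge0_fin_numE ?wmeasure_ge0// (wmeasure_pcube_lty Aw). Qed.

Lemma dRE s c : 0 < s -> dmeasure p w (pcube s c) = (dR (pcube s c))%:E.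
Proof.
by move=> s0; rewrite fineK// ge0_fin_numE ?dmeasure_ge0// (dmeasure_pcube_lty Aw).
Qed.

Lemma wR_ge0 U : 0 <= wR U. Proof. by rewrite fine_ge0 ?wmeasure_ge0. Qed.
Lemma dR_ge0 U : 0 <= dR U. Proof. by rewrite fine_ge0 ?dmeasure_ge0. Qed.

Lemma Ap_upper s c : 0 < s ->
  wR (pcube s c) * dR (pcube s c) `^ (p - 1) <= A * vol s `^ p.
Proof.
move=> s0; have v0 := vol_gt0 s0.
have : (emean (pcube s c) (fun y => (w y)%:E) *
    emean (pcube s c) (dual_weight p w) `^ (p - 1) <= A%:E)%E.
  by rewrite -ApA; apply: ereal_sup_ubound; exists c, s.
rewrite /emean (mu_vol c s0) -/(wmeasure w _) -/(dmeasure p w _) wRE dRE//.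
rewrite inver (gt_eqF v0) -!EFinM lee_fin.
rewrite powRM ?invr_ge0 ?dR_ge0 ?(ltW v0)//.
have -> : (vol s)^-1 `^ (p - 1) = (vol s `^ (p - 1))^-1.
  by rewrite -[_^-1](powR_inv1 (ltW v0)) -powRrM mulN1r powRN.
have vp : 0 < vol s `^ (p - 1) by rewrite powR_gt0.
rewrite -(mulr_powRB1 (ltW v0) p0) => H.
have -> : wR (pcube s c) * dR (pcube s c) `^ (p - 1) =
   ((vol s)^-1 * wR (pcube s c) * ((vol s `^ (p - 1))^-1 * dR (pcube s c) `^ (p - 1))) *
   (vol s * vol s `^ (p - 1)) by field; rewrite !gt_eqF.
by rewrite ler_wpM2r// mulr_ge0// ltW.
Qed.

(** Hoelder's inequality for the constant function 1: the converse of the A_p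
    condition, with constant 1. *)
Lemma Ap_lower s c : 0 < s ->
  vol s `^ p <= wR (pcube s c) * dR (pcube s c) `^ (p - 1).
Proof.
move=> s0; have := @hoelder_cube R n p w p1 Aw s c (fun=> 1) s0 (fun=> ler01).
have E : (\int[mu]_(z in pcube s c) (1 `^ p * w z)%:E = wmeasure w (pcube s c))%E.
  by apply: eq_integral => z _; rewrite powR1 mul1r.
rewrite E integral_cst ?mul1e; last exact: measurable_pcube.
rewrite [X in fine X](_ : _ = (vol s)%:E); last exact: mu_vol.
by apply; [exact: measurable_cst|exact: wmeasure_pcube_lty Aw _ _].
Qed.

Lemma wR_gt0 s c : 0 < s -> 0 < wR (pcube s c).
Proof.
move=> s0; rewrite lt_neqAle wR_ge0 andbT; apply/eqP => H.
have := Ap_lower c s0; rewrite -H mul0r leNgt => /negP; apply.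
by rewrite powR_gt0 ?vol_gt0.
Qed.

Lemma Ap_ge1 : 1 <= A.
Proof.
have s0 := @ltr01 R.
have := le_trans (Ap_lower 0 s0) (Ap_upper 0 s0).
by rewrite -[leLHS]mul1r ler_pM2r// powR_gt0 ?vol_gt0.
Qed.

Lemma wR_sub (U U' : set V) s c : measurable U -> measurable U' ->
  U' = pcube s c -> U `<=` U' -> wR U <= wR U'.
Proof.
move=> mU mU' E UU'.
have L : (wmeasure w U <= wmeasure w U')%E.
  apply: ge0_subset_integral => //; last by move=> z _; rewrite lee_fin (weight_ge0 Aw).
  by apply/measurable_EFinP; exact: weight_measurable Aw _.
have f' : wmeasure w U' \is a fin_num.
  by rewrite E ge0_fin_numE ?wmeasure_ge0// (wmeasure_pcube_lty Aw).
apply: fine_le => //.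
by rewrite ge0_fin_numE ?wmeasure_ge0// (le_lt_trans L)// -ge0_fin_numE ?wmeasure_ge0.
Qed.

(** A fraction of the dual mass of a cube that every half-size subcube must carry. *)
Definition eta : R := (A * 2 `^ ((n + 2)%:R * p)) `^ (- (p - 1)^-1).

Lemma eta_bound : 1 <= A -> 0 < eta < 1.
Proof.
move=> A1.
have B1 : 1 < A * 2 `^ ((n + 2)%:R * p).
  apply: lt_le_trans (ler_peMl (powR_ge0 _ _) A1).
  have e0 : 0 < (n + 2)%:R * p by rewrite mulr_gt0// ltr0n addn2.
  have : (1 : R) `^ ((n + 2)%:R * p) < 2 `^ ((n + 2)%:R * p).
    by apply: gt0_ltr_powR; rewrite ?nnegrE ?ltr1n.
  by rewrite powR1.
rewrite /eta powR_gt0 ?(lt_trans ltr01 B1)//=.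
rewrite powRN invf_lt1 ?powR_gt0 ?(lt_trans ltr01 B1)//.
set B := A * _; have B0 : 0 < B by apply: lt_trans B1.
have : (1 : R) `^ (p - 1)^-1 < B `^ (p - 1)^-1.
  by apply: gt0_ltr_powR; rewrite ?nnegrE ?invr_gt0 ?ler01// ltW.
by rewrite powR1.
Qed.

(** The second subcube has at least the fraction [eta] of the dual mass: its own
    weight is at most that of the large cube, so [Ap_lower] bounds its dual mass
    from below, and [Ap_upper] bounds that of the large cube from above. The first
    subcube is disjoint from it and loses this fraction. *)
Lemma dR_half s c c' c'' : 0 < s ->
  (pcube (s / 2) c' : set V) `<=` pcube s c ->
  (pcube (s / 2) c'' : set V) `<=` pcube s c ->
  (pcube (s / 2) c' : set V) `&` pcube (s / 2) c'' = set0 ->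
  dR (pcube (s / 2) c') <= (1 - eta) * dR (pcube s c).
Proof.
move=> s0 P1 P2 P12; have h0 : 0 < s / 2 by rewrite divr_gt0.
have D1 : dR (pcube (s / 2) c') + dR (pcube (s / 2) c'') <= dR (pcube s c).
  rewrite -lee_fin EFinD -!dRE// /dmeasure.
  rewrite -ge0_integral_setU//.
  - apply: ge0_subset_integral => //.
    + by apply: measurableU; exact: measurable_pcube.
    + exact: measurable_pcube.
    + exact: dual_measurable Aw _.
    + by move=> z _; exact: dual_ge0.
    + by rewrite subUset.
  - exact: measurable_pcube.
  - exact: measurable_pcube.
  - exact: dual_measurable Aw _.
  - by move=> z _; exact: dual_ge0.
  - by apply/disj_setPS; rewrite P12.
suff D2 : eta * dR (pcube s c) <= dR (pcube (s / 2) c'') by lra.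
have A1 := Ap_ge1.
set S := dR (pcube s c); set S2 := dR (pcube (s / 2) c'').
set W := wR (pcube s c).
have W0 : 0 < W by exact: wR_gt0.
have E1 : vol (s / 2) `^ p <= W * S2 `^ (p - 1).
  apply: le_trans (Ap_lower c'' h0) _; rewrite ler_wpM2r ?powR_ge0//.
  by apply: (@wR_sub _ _ s c) => //; exact: measurable_pcube.
have E2 : W * S `^ (p - 1) <= A * 2 `^ ((n + 2)%:R * p) * vol (s / 2) `^ p.
  apply: le_trans (Ap_upper c s0) _.
  rewrite -mulrA ler_pM2l ?(lt_le_trans ltr01)//.
  rewrite powRrM powR_mulrn// -powRM ?exprn_ge0// ?(ltW (vol_gt0 h0))//.
  by rewrite vol_half mulrC divfK// expf_neq0.
have E3 : S `^ (p - 1) <= A * 2 `^ ((n + 2)%:R * p) * S2 `^ (p - 1).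
  rewrite -(ler_pM2l W0); apply: le_trans E2 _.
  rewrite mulrCA ler_pM2l// mulr_gt0 ?powR_gt0// (lt_le_trans ltr01)//.
have B0 : 0 < A * 2 `^ ((n + 2)%:R * p).
  by rewrite mulr_gt0 ?powR_gt0// (lt_le_trans ltr01).
exact: (powR_cancel_le B0 pm (dR_ge0 _) (dR_ge0 _) E3).
Qed.

End weight_reals.

(** * Weighted powers of the cell means *)

Section cell_weights.
Context {R : realType} {n : nat}.
Local Notation V := ('rV[R]_n * measurableTypeR R)%type.
Local Notation mu := (@lebesgue_xt R n).
Variables (p : R) (w : V -> R) (A : R).
Hypotheses (p1 : 1 < p) (Aw : Ap_weight p w) (ApA : Ap_const p w = A%:E).
Variable r : R.
Hypothesis r0 : 0 < r.
Local Notation Q := (@pcube R n r 0 : set V).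

Let p0 : 0 < p. Proof. by move: p1; lra. Qed.
Let pm : 0 < p - 1. Proof. by move: p1; lra. Qed.

Let mQ : measurable Q. Proof. exact: measurable_pcube. Qed.

Lemma sibling_proof B (k : 'I_(4 ^ B.+1)) :
  ((if odd k then k.-1 else k.+1) < 4 ^ B.+1)%N.
Proof.
case: k => m /= mM; case: ifP => om; first by rewrite (leq_ltn_trans (leq_pred _)).
move: mM; rewrite expnS; set M := (4 ^ B)%N => mM.
rewrite ltn_neqAle mM andbT; apply/eqP => E.
have : odd (4 * M) by rewrite -E /= om.
by rewrite oddM.
Qed.

(** The sibling is the adjacent cell in time. *)
Lemma sibling j (k : @cellI n j.+1) :
  exists2 k' : @cellI n j.+1, parent k' = parent k & k' <> k.
Proof.
exists (k.1, Ordinal (sibling_proof k.2)).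
  rewrite /parent /=; congr (_, _); apply/val_inj => /=.
  by case: ifP => om; lia.
move=> H; have : val (Ordinal (sibling_proof k.2)) = val k.2 by rewrite -[in RHS]H.
move=> /= /eqP; case: ifP => om; last by rewrite eqn_leq ltnn.
by case: (val k.2) om => // m _; rewrite eqn_leq /= ltnn andbF.
Qed.

Lemma dR_cell j (k : @cellI n j) :
  dR p w (cell r k) <= (1 - eta (n := n) p A) ^+ j * dR p w Q.
Proof.
have /andP[e0 e1] := @eta_bound R n p A p1 (@Ap_ge1 R n p w A p1 Aw ApA).
elim: j k => [|j IH] k; first by rewrite expr0 mul1r (cell0E r k).
have [k' pk' kk'] := sibling k.
rewrite exprS -mulrA; apply: le_trans (_ : _ <= (1 - eta (n := n) p A) * dR p w (cell r (parent k))) _.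
  have c1 := @cell_parent R n r r0 j k; have c2 := @cell_parent R n r r0 j k'; rewrite pk' in c2.
  have c12 : cell r k `&` cell r k' = set0.
    by rewrite -subset0 => z [z1 z2]; apply: kk'; apply: (cell_inj r0 z2 z1).
  move: c1 c2 c12; rewrite /cell cradS => c1 c2 c12.
  exact: (dR_half p1 Aw ApA (crad_gt0 r0 j) c1 c2 c12).
by rewrite ler_wpM2l// subr_ge0 ltW.
Qed.

Lemma vol_crad j : vol (n := n) (crad r j) = vol (n := n) r / (2 ^+ (n + 2)) ^+ j.
Proof.
elim: j => [|j IH]; first by rewrite /crad expn0 !expr0 !divr1.
by rewrite cradS vol_half IH exprS invfM mulrA mulrAC.
Qed.

Variables (g : V -> R) (kap : R).
Hypotheses (g0 : forall z, 0 <= g z) (mg : measurable_fun Q g) (kap1 : 1 <= kap).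
Let X (U : set V) : \bar R := (\int[mu]_(z in U) (g z `^ p * w z)%:E)%E.
Hypothesis XQ : (X Q < +oo)%E.

(** The factor by which the bound for the p-th power of a cell mean grows from one
    generation to the next: the volume to the power p drops by 2^((n+2)p), the dual
    mass to the power p - 1 by at least (1 - eta)^(p-1). *)
Definition growth : R := 2 `^ ((n + 2)%:R * p) * (1 - eta (n := n) p A) `^ (p - 1).

Let mgw (D : set V) : measurable D -> D `<=` Q -> measurable_fun D (fun z => (g z `^ p * w z)%:E).
Proof.
move=> mD DQ; apply/measurable_EFinP; apply: measurable_funM; last exact: weight_measurable Aw _.
apply: (@measurableT_comp _ _ _ _ _ _ (@powR R ^~ p) _ g) => //.
exact: (measurable_funS mQ DQ).
Qed.

Let gw0 z : (0 <= (g z `^ p * w z)%:E)%E.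
Proof. by rewrite lee_fin mulr_ge0 ?powR_ge0 ?(weight_ge0 Aw). Qed.

Let X_ge0 U : (0 <= X U)%E. Proof. by apply: integral_ge0 => z _; exact: gw0. Qed.

Let Xcell_le j (k : @cellI n j) : (X (cell r k) <= X Q)%E.
Proof.
apply: ge0_subset_integral => //; [exact: measurable_cell|exact: mgw|exact: cell_sub].
Qed.

Let Xcell_fin j (k : @cellI n j) : X (cell r k) \is a fin_num.
Proof. by rewrite ge0_fin_numE ?X_ge0// (le_lt_trans (Xcell_le k)). Qed.

Let XQ_fin : X Q \is a fin_num. Proof. by rewrite ge0_fin_numE ?X_ge0. Qed.

Let b j (k : @cellI n j) := mean (cell r k) g.

Let b_ge0 j (k : @cellI n j) : 0 <= b k. Proof. exact: mean_ge0. Qed.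

Let bp_le j (k : @cellI n j) :
  b k `^ p <= fine (X (cell r k)) * dR p w (cell r k) `^ (p - 1) / vol (n := n) (crad r j) `^ p.
Proof.
have c0 := crad_gt0 r0 j; have v0 := @vol_gt0 R n _ c0.
have mgc : measurable_fun (cell r k) g by apply: (measurable_funS mQ (cell_sub r0 (k := k))).
have XC : (X (cell r k) < +oo)%E by rewrite (le_lt_trans (Xcell_le k)).
have := @hoelder_cube R n p w p1 Aw (crad r j) (cctr r k) g c0 g0 mgc XC.
rewrite -/(cell r k) => H.
rewrite /b /mean (mu_cell r0 k)/= -/(vol (n := n) (crad r j)).
rewrite powRM ?invr_ge0 ?(ltW v0)//; last by apply: Rintegral_ge0 => z _.
rewrite -[_^-1](powR_inv1 (ltW v0)) -powRrM mulN1r powRN mulrC.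
by rewrite ler_wpM2r// invr_ge0 powR_ge0.
Qed.

Let w_bp j (k : @cellI n j) : wR w (cell r k) * b k `^ p <= A * fine (X (cell r k)).
Proof.
have c0 := crad_gt0 r0 j; have v0 := @vol_gt0 R n _ c0.
have vp : 0 < vol (n := n) (crad r j) `^ p by rewrite powR_gt0.
apply: le_trans (ler_wpM2l (wR_ge0 Aw _) (bp_le k)) _.
have := @Ap_upper R n p w A p1 Aw ApA _ (cctr r k) c0; rewrite -/(cell r k) => H.
have X0 : 0 <= fine (X (cell r k)) / vol (n := n) (crad r j) `^ p.
  by rewrite divr_ge0 ?fine_ge0 ?X_ge0// ltW.
have := ler_wpM2r X0 H.
have -> : A * vol (n := n) (crad r j) `^ p * (fine (X (cell r k)) / vol (n := n) (crad r j) `^ p) =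
    A * fine (X (cell r k)) by field; rewrite gt_eqF.
by congr (_ <= _); ring.
Qed.

Let bp_top j (k : @cellI n j) :
  b k `^ p <= A * growth ^+ j * fine (X Q) / wR w Q.
Proof.
have c0 := crad_gt0 r0 j; have v0 := @vol_gt0 R n _ c0; have v := @vol_gt0 R n _ r0.
have W0 : 0 < wR w Q := wR_gt0 p1 Aw 0 r0.
have /andP[e0 e1] := @eta_bound R n p A p1 (@Ap_ge1 R n p w A p1 Aw ApA).
have e2 : 0 <= 1 - eta (n := n) p A by rewrite subr_ge0 ltW.
apply: le_trans (bp_le k) _.
have S1 : dR p w (cell r k) `^ (p - 1) <=
    ((1 - eta (n := n) p A) `^ (p - 1)) ^+ j * dR p w Q `^ (p - 1).
  rewrite -powR_mulrn ?powR_ge0// powRAC powR_mulrn// -powRM ?exprn_ge0 ?dR_ge0//.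
  apply: ge0_ler_powR; rewrite ?nnegrE; first exact: ltW.
  - exact: dR_ge0.
  - by rewrite mulr_ge0 ?exprn_ge0 ?dR_ge0.
  - exact: dR_cell.
have S2 : dR p w Q `^ (p - 1) <= A * vol (n := n) r `^ p / wR w Q.
  by rewrite ler_pdivlMr// mulrC; exact: (Ap_upper p1 Aw ApA 0 r0).
have V1 : vol (n := n) r `^ p = vol (n := n) (crad r j) `^ p * (2 `^ ((n + 2)%:R * p)) ^+ j.
  rewrite -[_ ^+ j]powR_mulrn ?powR_ge0// -powRrM mulrAC powRrM -powRM ?powR_ge0 ?(ltW v0)//.
  rewrite -natrM powR_mulrn// vol_crad exprM divfK// expf_neq0// expf_neq0//.
have X1 : fine (X (cell r k)) <= fine (X Q) by apply: fine_le.
have vp : 0 < vol (n := n) (crad r j) `^ p by rewrite powR_gt0.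
rewrite ler_pdivrMr//.
apply: (@le_trans _ _ (fine (X Q) * (((1 - eta (n := n) p A) `^ (p - 1)) ^+ j * (A * vol (n := n) r `^ p / wR w Q)))).
  apply: ler_pM; rewrite ?fine_ge0 ?X_ge0 ?powR_ge0//.
  by apply: le_trans S1 _; rewrite ler_wpM2l// exprn_ge0// powR_ge0.
rewrite V1 /growth exprMn le_eqVlt; apply/orP; left; apply/eqP.
by field; rewrite gt_eqF.
Qed.

Let weighted_power j (k : @cellI n j) :
  wR w (cell r k) * b k `^ (p * kap) <=
  A * fine (X (cell r k)) * (A * growth ^+ j * fine (X Q) / wR w Q) `^ (kap - 1).
Proof.
rewrite powRrM -mulr_powRB1 ?powR_ge0//; last by move: kap1; lra.
rewrite mulrA; apply: ler_pM.
- by rewrite mulr_ge0 ?powR_ge0 ?(wR_ge0 Aw).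
- exact: powR_ge0.
- exact: w_bp.
- apply: ge0_ler_powR; rewrite ?nnegrE ?powR_ge0 ?bp_top//; first by move: kap1; lra.
  by apply: le_trans (bp_top k); exact: powR_ge0.
Qed.

Lemma step_powR j (bb : @cellI n j -> R) (c s : R) z : 0 < s ->
  (c * step r bb z) `^ s = step r (fun k => (c * bb k) `^ s) z.
Proof.
move=> s0; have [[k kz]|H] := pselect (exists k : @cellI n j, cell r k z).
  by rewrite !(stepE r0 _ kz).
have H' (k : @cellI n j) : ~ cell r k z by move=> kz; apply: H; exists k.
by rewrite !step_out// mulr0 powR0 ?gt_eqF.
Qed.

(** The exponent p k is split as p + p (k - 1): the first power keeps the local
    integral, summable over the cells, and the second is bounded through the
    integral over the whole cube. *)
Lemma integral_step_powR j (c : R) : 0 <= c ->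
  (\int[mu]_(z in Q) ((c * step r (fun k : @cellI n j => mean (cell r k) g) z) `^ (p * kap) * w z)%:E <=
   (c `^ (p * kap) * (A * fine (X Q) * (A * growth ^+ j * fine (X Q) / wR w Q) `^ (kap - 1)))%:E)%E.
Proof.
move=> c0; have s0 : 0 < p * kap by rewrite mulr_gt0//; move: kap1; lra.
set T := (_ `^ (kap - 1)).
have E : (\int[mu]_(z in Q) ((c * step r (@b j) z) `^ (p * kap) * w z)%:E =
    \sum_(k : @cellI n j) (c `^ (p * kap) * (wR w (cell r k) * b k `^ (p * kap)))%:E)%E.
  transitivity (\int[mu]_(z in Q) ((step r (fun k => (c * @b j k) `^ (p * kap)) z)%:E * (w z)%:E))%E.
    by apply: eq_integral => z _; rewrite step_powR.
  rewrite integral_step//; last 3 first.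
  - by move=> k; exact: powR_ge0.
  - by move=> z; rewrite lee_fin (weight_ge0 Aw).
  - by apply/measurable_EFinP; exact: weight_measurable Aw _.
  apply: eq_bigr => k _; rewrite -/(wmeasure w _) (wRE Aw) -EFinM powRM//.
  by congr EFin; ring.
rewrite E.
apply: (@le_trans _ _ (\sum_(k : @cellI n j) (c `^ (p * kap) * A * T)%:E * X (cell r k))%E).
  apply: lee_sum => k _; rewrite -(fineK (Xcell_fin k)) -EFinM lee_fin.
  rewrite -!mulrA ler_wpM2l ?powR_ge0//.
  by apply: le_trans (weighted_power k) _; rewrite -/T mulrA mulrAC.
have A0 : 0 <= A := le_trans ler01 (@Ap_ge1 R n p w A p1 Aw ApA).
rewrite -ge0_sume_distrr; last by move=> k _; exact: X_ge0.
apply: (@le_trans _ _ ((c `^ (p * kap) * A * T)%:E * X Q)%E).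
  apply: lee_wpmul2l; first by rewrite lee_fin !mulr_ge0 ?powR_ge0.
  by apply: integral_cells_le => //; exact: mgw.
by rewrite -(fineK XQ_fin) -EFinM lee_fin le_eqVlt; apply/orP; left; apply/eqP; ring.
Qed.

End cell_weights.

(** * Summation in j and the choice of the exponent *)

Section final_reals.
Context {R : realType}.

(** With T the sum on the right, every y_j is at most nu^j T^(1/s), and these bounds
    form a geometric series. *)
Lemma powR_series_le (K nu s e : R) (y : nat -> R) :
  0 < K -> 0 < nu < 1 -> 0 < s -> 0 <= e -> (forall j, 0 <= y j) ->
  (e%:E <= K%:E * \sum_(j <oo) (y j)%:E)%E ->
  ((e `^ s)%:E <= ((K / (1 - nu)) `^ s)%:E * \sum_(j <oo) ((y j / nu ^+ j) `^ s)%:E)%E.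
Proof.
move=> K0 /andP[n0 n1] s0 e0 y0 He.
have d0 : 0 < 1 - nu by rewrite subr_gt0.
have Kd : 0 < K / (1 - nu) by rewrite divr_gt0.
have t0 j : 0 <= (y j / nu ^+ j) `^ s by exact: powR_ge0.
set S := (\sum_(j <oo) ((y j / nu ^+ j) `^ s)%:E)%E.
have S0 : (0 <= S)%E by apply: nneseries_ge0 => j _ _; rewrite lee_fin.
have [Soo|Sfin] := eqVneq S +oo%E.
  by rewrite Soo gt0_muley ?leey// lte_fin powR_gt0.
have Sf : S \is a fin_num by rewrite ge0_fin_numE// ltey.
pose T := fine S; have T0 : 0 <= T by exact: fine_ge0.
have yT j : y j <= nu ^+ j * T `^ s^-1.
  have : ((y j / nu ^+ j) `^ s) `^ s^-1 <= T `^ s^-1.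
    apply: ge0_ler_powR; rewrite ?nnegrE ?invr_ge0 ?(ltW s0)//.
    rewrite -lee_fin /T fineK//.
    have := @nneseries_lim_ge R (fun j => ((y j / nu ^+ j) `^ s)%:E) xpredT 0 j.+1.
    move=> /(_ (fun k _ _ => t0 k)); apply: le_trans.
    rewrite big_nat_recr//= leeDr//.
    by apply: sume_ge0 => k _; rewrite lee_fin.
  rewrite -powRrM mulfV ?gt_eqF// powRr1 ?divr_ge0 ?exprn_ge0 ?(ltW n0)//.
  by rewrite ler_pdivrMr ?exprn_gt0// mulrC.
have H : (\sum_(j <oo) (y j)%:E <= (T `^ s^-1 / (1 - nu))%:E)%E.
  apply: nneseries_le => [j|J]; first by rewrite lee_fin.
  rewrite sumEFin lee_fin.
  apply: (@le_trans _ _ (\sum_(0 <= j < J) nu ^+ j * T `^ s^-1)).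
    by apply: ler_sum => j _; exact: yT.
  rewrite -mulr_suml mulrC ler_wpM2l ?powR_ge0//.
  exact: geometric_sum_le (ltW n0) n1.
have {}He : e <= K / (1 - nu) * T `^ s^-1.
  rewrite -lee_fin (le_trans He)//.
  apply: (@le_trans _ _ (K%:E * (T `^ s^-1 / (1 - nu))%:E)%E).
    by apply: lee_wpmul2l => //; rewrite lee_fin ltW.
  by rewrite -EFinM lee_fin le_eqVlt; apply/orP; left; apply/eqP; ring.
rewrite -(fineK Sf) -EFinM lee_fin -/T.
have -> : T = (T `^ s^-1) `^ s by rewrite -powRrM mulVf ?gt_eqF// powRr1.
rewrite -powRM ?powR_ge0 ?(ltW Kd)//.
by apply: ge0_ler_powR; rewrite ?nnegrE ?(ltW s0)// mulr_ge0 ?powR_ge0// ltW.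
Qed.

(** With N = n + 2, at k = N / (N - 1) the powers of 2 cancel exactly and theta < 1
    makes the product less than 1; delta uses up half of this gain. *)
Lemma exponent_choice (n : nat) (p theta : R) : 1 < p -> 0 < theta < 1 ->
  exists2 delta : R, 0 < delta &
    let k := n.+2%:R / n.+1%:R + delta in
    2 `^ (- (p * k)) * (2 `^ ((n + 2)%:R * p) * theta `^ (p - 1)) `^ (k - 1) < 1.
Proof.
move=> p1 /andP[t0 t1].
pose m : R := n.+1%:R; have m0 : 0 < m by rewrite ltr0n.
have l2 : 0 < ln 2 :> R by rewrite ln_gt0// ltr1n.
have lt0 : ln theta < 0 by rewrite ln_lt0// t0 t1.
have pm : 0 < p - 1 by lra.
have p0 : 0 < p by lra.
pose delta := (p - 1) * - ln theta / (2 * p * m ^+ 2 * ln 2).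
have d0 : 0 < delta by rewrite divr_gt0 ?mulr_gt0 ?exprn_gt0 ?oppr_gt0.
exists delta => //.
set k := n.+2%:R / n.+1%:R + delta => /=.
have Ek : k - 1 = m^-1 + delta.
  rewrite /k -/m; have -> : n.+2%:R = m + 1 :> R by rewrite /m natr1.
  by field; rewrite gt_eqF.
have k1 : 0 < k - 1 by rewrite Ek addr_gt0 ?invr_gt0.
set x := (X in X < 1).
have x0 : 0 < x by rewrite mulr_gt0 ?powR_gt0// mulr_gt0 ?powR_gt0.
rewrite -(@ltr_ln R) ?posrE// ln1.
rewrite /x lnM ?posrE ?powR_gt0 ?mulr_gt0 ?powR_gt0// !ln_powR.
rewrite lnM ?posrE ?powR_gt0// !ln_powR.
have -> : (n + 2)%:R = m + 1 :> R by rewrite /m natr1 addn2.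
have -> : k = 1 + m^-1 + delta by rewrite -[k](subrK 1) Ek; ring.
have Hd : delta * (2 * p * m ^+ 2 * ln 2) = (p - 1) * - ln theta.
  by rewrite /delta divfK// gt_eqF// !mulr_gt0// exprn_gt0.
have -> : - (p * (1 + m^-1 + delta)) * ln 2 +
   (1 + m^-1 + delta - 1) * ((m + 1) * p * ln 2 + (p - 1) * ln theta) =
   p * m * delta * ln 2 + (m^-1 + delta) * ((p - 1) * ln theta).
  by field; rewrite gt_eqF.
have -> : p * m * delta * ln 2 = ((p - 1) * - ln theta) / (2 * m).
  by rewrite -Hd; field; rewrite gt_eqF.
have L0 : (p - 1) * ln theta < 0 by rewrite pmulr_rlt0.
rewrite mulrN; set L := (p - 1) * ln theta in L0 *.
have -> : - L / (2 * m) + (m^-1 + delta) * L = L * (m^-1 / 2 + delta) by field; rewrite gt_eqF.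
by rewrite nmulr_rlt0// addr_gt0// divr_gt0// invr_gt0.
Qed.

End final_reals.

Section euclid_facts.
Context {R : realType}.

Lemma euclid_ge0 m k (M : 'M[R]_(m, k)) : 0 <= euclid M.
Proof. exact: sqrtr_ge0. Qed.

Lemma entry_le_euclid m k (M : 'M[R]_(m, k)) i j : `|M i j| <= euclid M.
Proof.
rewrite /euclid -sqrtr_sqr ler_wsqrtr//.
rewrite (bigD1 i)//= (bigD1 j)//= -addrA lerDl addr_ge0 ?sumr_ge0// => [l _|l _].
  exact: sqr_ge0.
by apply: sumr_ge0 => ? _; exact: sqr_ge0.
Qed.

Lemma euclid_le_row k (v : 'rV[R]_k) (T : R) : 0 <= T ->
  (forall i, `|v ord0 i| <= T) -> euclid v <= k%:R * T.
Proof.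
move=> T0 H; have kT : 0 <= k%:R * T by rewrite mulr_ge0.
rewrite -(ger0_norm kT) -sqrtr_sqr ler_wsqrtr// big_ord1.
apply: (@le_trans _ _ (\sum_(i < k) T ^+ 2)).
  apply: ler_sum => i _; rewrite -(real_normK (num_real (v ord0 i))).
  by rewrite lerXn2r ?nnegrE.
rewrite sumr_const card_ord -[T ^+ 2 *+ _]mulr_natl exprMn ler_wpM2r ?sqr_ge0//.
by rewrite -natrX ler_nat; case: k {v H kT} => // k; rewrite leq_pmull.
Qed.

Lemma measurable_euclid d (T : measurableType d) (D : set T) m k (F : T -> 'M[R]_(m, k)) :
  (forall i j, measurable_fun D (fun z => F z i j)) ->
  measurable_fun D (fun z => euclid (F z)).
Proof.
move=> mF; rewrite /euclid.
apply: (@measurableT_comp _ _ _ _ _ _ (@Num.sqrt R) _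
  (fun z => \sum_i \sum_j F z i j ^+ 2)).
  by apply: continuous_measurable_fun; exact: sqrt_continuous.
apply: measurable_sum => i; apply: measurable_sum => j.
exact: measurable_funX.
Qed.

End euclid_facts.

(** * The oscillation of the gradient *)

Section powR_facts.
Context {R : realType}.
Implicit Types x e : R.

Lemma powR_inv x e : 0 <= x -> x^-1 `^ e = x `^ (- e).
Proof. by move=> x0; rewrite -(powR_inv1 x0) -powRrM mulN1r. Qed.

Lemma powR_exprn x e j : 0 <= x -> (x ^+ j) `^ e = (x `^ e) ^+ j.
Proof. by move=> x0; rewrite -powR_mulrn// powRAC powR_mulrn ?powR_ge0. Qed.

Lemma powR_level (A W X k : R) : 0 < A -> 0 < W -> 0 <= X -> 0 < k ->
  A * X * (A * (X / W)) `^ (k - 1) = A `^ k * (W * (X / W) `^ k).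
Proof.
move=> A0 W0 X0 k0.
have XW : 0 <= X / W by rewrite divr_ge0// ltW.
have AX0 : 0 <= A * (X / W) by rewrite mulr_ge0// ltW.
have -> : A * X = W * (A * (X / W)) by field; rewrite gt_eqF.
by rewrite -mulrA mulr_powRB1// powRM ?(ltW A0)// mulrCA.
Qed.

Lemma level_algebra (a b x y z l : R) : l != 0 -> x * z = l * l ->
  a * (x * l^-1) * (b * (y * z)) = a * (b * y) * l.
Proof.
move=> l0 E; transitivity (a * (b * y) * (x * z) / l); first by field.
by rewrite E mulrA mulfK.
Qed.

End powR_facts.

Section main_estimate.
Context {R : realType} {n : nat}.
Local Notation V := ('rV[R]_n * measurableTypeR R)%type.
Local Notation mu := (@lebesgue_xt R n).

Definition jump_cst : R := @compare_cst R n * 4 ^+ n * 2 ^+ n.+1.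

Lemma jump_cst_gt0 : 0 < jump_cst.
Proof.
rewrite !mulr_gt0 ?exprn_gt0// /compare_cst.
have B0 := @Bump1_gt0 R 0.
have : 0 < 24 / Bump 0 1 :> R by rewrite divr_gt0.
have : 0 <= n%:R :> R by [].
lra.
Qed.

Section data.
Variables (r : R) (r0 : 0 < r).
Local Notation Q := (@pcube R n r 0 : set V).
Variables (u ut : V -> R) (Du : V -> 'rV[R]_n) (D2u : V -> 'M[R]_n).
Hypothesis Hu : W21_1 Q u ut Du D2u.

Definition source (z : V) : R := euclid (D2u z) + `|ut z|.

Lemma source_ge0 z : 0 <= source z.
Proof. by rewrite addr_ge0// euclid_ge0. Qed.

Hypothesis Ig : L1 Q source.

Lemma mean_jump i j (k : @cellI n j.+1) :
  `|mean (cell r k) (fun z => Du z ord0 i) -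
    mean (cell r (parent k)) (fun z => Du z ord0 i)| <=
  jump_cst * (crad r j * mean (cell r (parent k)) source).
Proof.
have [Iu [Iut wut] HD HD2] := Hu.
have mQ : measurable Q by exact: measurable_pcube.
have c0 := crad_gt0 r0 j.
have Iff : L1 Q (fun z => Du z ord0 i) := (HD i).1.
have Ifd l : L1 Q (fun z => D2u z i l) := (HD2 i l).1.
have wfd l : weak_derive Q (dir_x l) (fun z => Du z ord0 i) (fun z => D2u z i l).
  exact: (HD2 i l).2.
have gut z : `|ut z| <= source z by rewrite /source lerDr euclid_ge0.
have gfd l z : `|D2u z i l| <= source z.
  by rewrite (le_trans (entry_le_euclid _ i l))// /source lerDl.
have := mean_child mQ c0 (cell_sub r0 (k := parent k)) (parent_ctr_x r0 k)
  (parent_ctr_t r0 k) Iut Iff Ifd Ig wut (HD i).2 wfd gut gfd.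
rewrite -cradS => /le_trans; apply.
rewrite /mean (mu_cell r0 (parent k))/= -/(cell r (parent k)).
rewrite le_eqVlt; apply/orP; left; apply/eqP.
rewrite /jump_cst [(4 / crad r j) ^+ n]expr_div_n [(2 * crad r j) ^+ n]exprMn (exprS 2 n).
by field; rewrite !expf_neq0 ?gt_eqF.
Qed.

Lemma mean_rVE (z : V) i :
  (Du z - mean_rV Q Du) ord0 i = Du z ord0 i - mean Q (fun z => Du z ord0 i).
Proof. by rewrite !mxE. Qed.

Lemma oscillation_bound : {ae mu, forall z, Q z ->
  ((euclid (Du z - mean_rV Q Du))%:E <= (n%:R * jump_cst)%:E *
    \sum_(j <oo) (step r (fun k : @cellI n j => crad r j * mean (cell r k) source) z)%:E)%E}.
Proof.
have mQ : measurable Q by exact: measurable_pcube.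
pose Pr (m : nat) (z : V) := forall i : 'I_n, val i = m -> Q z ->
  (`|Du z ord0 i - mean Q (fun z => Du z ord0 i)|%:E <= jump_cst%:E *
    \sum_(j <oo) (step r (fun k : @cellI n j => crad r j * mean (cell r k) source) z)%:E)%E.
have HP m : {ae mu, forall z, Pr m z}.
  have [mn|mn] := ltnP m n; last first.
    by apply: aeW => z i im; move: mn; rewrite -im leqNgt ltn_ord.
  have Iff : L1 Q (fun z => Du z ord0 (Ordinal mn)).
    by have [_ _ HD _] := Hu; exact: (HD _).1.
  have := chain_bound r0 Iff Ig source_ge0 (ltW jump_cst_gt0)
    (@mean_jump (Ordinal mn)).
  apply: (@filterS _ _ (ae_filter_ringOfSetsType mu)) => z H i im Qz.
  by have -> : i = Ordinal mn by [apply/val_inj]; exact: H.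
have := ae_foralln HP; apply: (@filterS _ _ (ae_filter_ringOfSetsType mu)) => z H Qz.
set S := (\sum_(j <oo) _)%E in H *.
have S0 : (0 <= S)%E.
  apply: nneseries_ge0 => j _ _; rewrite lee_fin; apply: step_ge0 => k.
  by rewrite mulr_ge0 ?mean_ge0 ?(ltW (crad_gt0 r0 _))//; exact: source_ge0.
have [n0|n0] := posnP n.
  have -> : euclid (Du z - mean_rV Q Du) = 0.
    rewrite /euclid big_ord1 big1 ?sqrtr0// => i _.
    by have := ltn_ord i; rewrite [X in (_ < X)%N]n0.
  by rewrite mule_ge0// lee_fin mulr_ge0// ltW// jump_cst_gt0.
have nK : 0 < n%:R * jump_cst :> R by rewrite mulr_gt0 ?ltr0n ?jump_cst_gt0.
have [Soo|Sfin] := eqVneq S +oo%E.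
  by rewrite Soo gt0_muley ?leey// lte_fin.
have Sf : S \is a fin_num by rewrite ge0_fin_numE// ltey.
rewrite -(fineK Sf) -EFinM lee_fin -mulrA; apply: euclid_le_row.
  by rewrite mulr_ge0 ?fine_ge0// ltW// jump_cst_gt0.
move=> i; rewrite mean_rVE; have := H (val i) i erefl Qz.
by rewrite -/S -(fineK Sf) -EFinM lee_fin.
Qed.

(** ** Integration against the weight *)

Section weighted.
Variables (p : R) (w : V -> R) (A kap : R).
Hypotheses (p1 : 1 < p) (Aw : Ap_weight p w) (ApA : Ap_const p w = A%:E) (kap1 : 1 < kap).
Hypothesis msource : measurable_fun Q source.
Let X : \bar R := (\int[mu]_(z in Q) (source z `^ p * w z)%:E)%E.
Hypothesis X_lty : (X < +oo)%E.
Hypothesis n0 : (0 < n)%N.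

(** Ratio between consecutive generations of the integrals of the s-th power of the
    jumps; the radius contributes the factor 2^(-s). *)
Definition ratio_cst : R := 2 `^ (- (p * kap)) * growth (n := n) p A `^ (kap - 1).
(** The weights nu^j of [powR_series_le] cost the factor nu^(-s) per generation:
    with nu^s the square root of the ratio, half of the decay is left. *)
Definition nu_cst : R := ratio_cst `^ (2 * (p * kap))^-1.
Definition main_cst : R :=
  (n%:R * jump_cst / (1 - nu_cst)) `^ (p * kap) * A `^ kap / (1 - ratio_cst `^ 2^-1).

Hypothesis ratio1 : ratio_cst < 1.

Let s := p * kap.
Let s0 : 0 < s. Proof. by rewrite mulr_gt0//; move: p1 kap1; lra. Qed.

Let mQ : measurable Q. Proof. exact: measurable_pcube. Qed.

Lemma powR_lt1 (x e : R) : 0 < x < 1 -> 0 < e -> 0 < x `^ e < 1.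
Proof.
move=> /andP[x0 x1] e0; rewrite powR_gt0//=.
have : x `^ e < 1 `^ e by apply: gt0_ltr_powR; rewrite ?nnegrE ?(ltW x0).
by rewrite powR1.
Qed.

Let growth0 : 0 < growth (n := n) p A.
Proof.
have /andP[e0 e1] := @eta_bound R n p A p1 (@Ap_ge1 R n p w A p1 Aw ApA).
by rewrite mulr_gt0 ?powR_gt0// subr_gt0.
Qed.

Let ratio0 : 0 < ratio_cst.
Proof. by rewrite mulr_gt0 ?powR_gt0. Qed.

Let nu_bound : 0 < nu_cst < 1.
Proof. by apply: powR_lt1; rewrite ?ratio0 ?ratio1// invr_gt0 mulr_gt0. Qed.

Let lam_bound : 0 < ratio_cst `^ 2^-1 < 1.
Proof. by apply: powR_lt1; rewrite ?ratio0 ?ratio1// invr_gt0. Qed.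

Let nK : 0 < n%:R * jump_cst :> R.
Proof. by rewrite mulr_gt0 ?ltr0n ?jump_cst_gt0. Qed.

Let Y j z := step r (fun k : @cellI n j => crad r j * mean (cell r k) source) z.

Let YE j z : Y j z = crad r j * step r (fun k : @cellI n j => mean (cell r k) source) z.
Proof. by rewrite /Y /step mulr_sumr; apply: eq_bigr => k _; rewrite mulrA. Qed.

Let Y_ge0 j z : 0 <= Y j z.
Proof.
apply: step_ge0 => k.
by rewrite mulr_ge0 ?mean_ge0 ?(ltW (crad_gt0 r0 _))//; exact: source_ge0.
Qed.

Let mY j : measurable_fun Q (fun z => (Y j z / nu_cst ^+ j) `^ s * w z).
Proof.
apply: measurable_funM; last exact: weight_measurable Aw _.
apply: (@measurableT_comp _ _ _ _ _ _ (@powR R ^~ s) _ (fun z => Y j z / nu_cst ^+ j)) => //.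
by apply: measurable_funM => //; exact: measurable_step.
Qed.

Let W := wR w Q.
Let W0 : 0 < W. Proof. exact: (wR_gt0 p1 Aw 0 r0). Qed.
Let A0 : 0 < A. Proof. exact: (lt_le_trans ltr01 (@Ap_ge1 R n p w A p1 Aw ApA)). Qed.

Let base := r `^ s * (A `^ kap * (W * (fine X / W) `^ kap)).

Let integral_level j :
  (\int[mu]_(z in Q) ((Y j z / nu_cst ^+ j) `^ s * w z)%:E <=
   (base * (ratio_cst `^ 2^-1) ^+ j)%:E)%E.
Proof.
have /andP[a1 a2] := nu_bound.
have c0 : 0 <= crad r j / nu_cst ^+ j.
  by rewrite divr_ge0 ?exprn_ge0 ?(ltW a1)// ltW// crad_gt0.
have H := @integral_step_powR R n p w A p1 Aw ApA r r0 source kap source_ge0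
  msource (ltW kap1) X_lty j _ c0.
rewrite (eq_integral (fun z => ((crad r j / nu_cst ^+ j *
    step r (fun k : @cellI n j => mean (cell r k) source) z) `^ (p * kap) * w z)%:E)); last first.
  by move=> z _; congr EFin; rewrite YE mulrAC.
apply: le_trans H _; rewrite lee_fin -/X -/W -/s le_eqVlt; apply/orP; left; apply/eqP.
have X0 : 0 <= fine X.
  by rewrite fine_ge0// integral_ge0// => z _; rewrite lee_fin mulr_ge0 ?powR_ge0// (weight_ge0 Aw).
have k0 : 0 < kap by move: kap1; lra.
have E1 : (A * growth (n := n) p A ^+ j * fine X / W) `^ (kap - 1) =
    (A * (fine X / W)) `^ (kap - 1) * (growth (n := n) p A `^ (kap - 1)) ^+ j.
  have -> : A * growth (n := n) p A ^+ j * fine X / W = A * (fine X / W) * growth (n := n) p A ^+ j.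
    by field; rewrite gt_eqF.
  have b1 : 0 <= A * (fine X / W) by rewrite mulr_ge0 ?divr_ge0// ltW.
  rewrite powRM//; last by rewrite exprn_ge0// ltW.
  by rewrite powR_exprn// ltW.
have E2 : (crad r j / nu_cst ^+ j) `^ s = r `^ s * ((2 `^ (- s)) ^+ j * ((nu_cst `^ s) ^+ j)^-1).
  rewrite /crad natrX -mulrA powRM ?mulr_ge0 ?invr_ge0 ?exprn_ge0 ?(ltW r0) ?(ltW a1)//.
  congr (_ * _); rewrite powRM ?invr_ge0 ?exprn_ge0 ?(ltW a1)//; congr (_ * _).
    by rewrite -exprVn powR_exprn ?invr_ge0// powR_inv.
  by rewrite -exprVn powR_exprn ?invr_ge0 ?(ltW a1)// powR_inv ?(ltW a1)// powRN exprVn.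
have E3 : nu_cst `^ s = ratio_cst `^ 2^-1.
  by rewrite /nu_cst -powRrM -/s invfM divfK// gt_eqF.
have E4 : ratio_cst = ratio_cst `^ 2^-1 * ratio_cst `^ 2^-1.
  by rewrite -powRD ?gt_eqF ?implybT// -[LHS]powRr1 ?(ltW ratio0)//; congr (_ `^ _); field.
have E5 : (2 `^ (- s)) ^+ j * (growth (n := n) p A `^ (kap - 1)) ^+ j = ratio_cst ^+ j.
  by rewrite -exprMn.
have E6 : ratio_cst ^+ j = (ratio_cst `^ 2^-1) ^+ j * (ratio_cst `^ 2^-1) ^+ j.
  by rewrite -exprMn -E4.
have E7 := powR_level A0 W0 X0 k0.
rewrite E1 E2 E3 /base -E7.
have /andP[la _] := lam_bound.
have la0 : (ratio_cst `^ 2^-1) ^+ j != 0 := expf_neq0 _ (lt0r_neq0 la).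
move: E5; rewrite E6 => E5.
exact: level_algebra.
Qed.

Theorem main_integral :
  (\int[mu]_(z in Q) (euclid (Du z - mean_rV Q Du) `^ s * w z)%:E <=
   (main_cst * (r `^ s * (W * (fine X / W) `^ kap)))%:E)%E.
Proof.
have /andP[a1 a2] := nu_bound; have /andP[a3 a4] := lam_bound.
pose C1 := (n%:R * jump_cst / (1 - nu_cst)) `^ s.
have C10 : 0 <= C1 by exact: powR_ge0.
have mD : measurable_fun Q (fun z => euclid (Du z - mean_rV Q Du) `^ s * w z).
  apply: measurable_funM; last exact: weight_measurable Aw _.
  apply: (@measurableT_comp _ _ _ _ _ _ (@powR R ^~ s) _ (fun z => euclid (Du z - mean_rV Q Du))) => //.
  apply: measurable_euclid => i l; rewrite (ord1 i).
  rewrite (_ : (fun z => _) = (fun z => Du z ord0 l - mean Q (fun z => Du z ord0 l))); last first.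
    by apply/funext => z; rewrite mean_rVE.
  apply: measurable_funB => //.
  have [_ _ HD _] := Hu; apply/measurable_EFinP; exact: (measurable_int mu (HD l).1).
have Sm : measurable_fun Q (fun z => \sum_(j <oo) (((Y j z / nu_cst ^+ j) `^ s) * w z)%:E)%E.
  apply: ge0_emeasurable_sum => // [j z _ _|j _].
    by rewrite lee_fin mulr_ge0 ?powR_ge0// (weight_ge0 Aw).
  by apply/measurable_EFinP; exact: mY.
have S0 z : (0 <= \sum_(j <oo) (((Y j z / nu_cst ^+ j) `^ s) * w z)%:E)%E.
  by apply: nneseries_ge0 => j _ _; rewrite lee_fin mulr_ge0 ?powR_ge0// (weight_ge0 Aw).
apply: (@le_trans _ _ (\int[mu]_(z in Q) (C1%:E *
    \sum_(j <oo) (((Y j z / nu_cst ^+ j) `^ s) * w z)%:E))%E).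
  apply: ae_ge0_le_integral => //.
  - by move=> z _; rewrite lee_fin mulr_ge0 ?powR_ge0// (weight_ge0 Aw).
  - exact/measurable_EFinP.
  - by move=> z _; rewrite mule_ge0.
  - exact: measurable_funeM.
  have := oscillation_bound; apply: (@filterS _ _ (ae_filter_ringOfSetsType mu)) => z H Qz.
  have := powR_series_le nK nu_bound s0 (euclid_ge0 _) (fun j => Y_ge0 j z) (H Qz).
  move=> {}H; have w0 := weight_ge0 Aw z.
  rewrite EFinM.
  apply: (@le_trans _ _ ((C1%:E * \sum_(j <oo) ((Y j z / nu_cst ^+ j) `^ s)%:E) * (w z)%:E)%E).
    by apply: lee_wpmul2r => //; rewrite lee_fin.
  rewrite -muleA; apply: lee_wpmul2l => //; rewrite muleC -nneseriesZl; last first.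
    by move=> j _; rewrite lee_fin powR_ge0.
  by under eq_eseriesr do rewrite -EFinM mulrC.
rewrite ge0_integralZl//.
rewrite integral_nneseries//; last 2 first.
- by move=> j; apply/measurable_EFinP; exact: mY.
- by move=> j z _; rewrite lee_fin mulr_ge0 ?powR_ge0// (weight_ge0 Aw).
have b0 : 0 <= base.
  by rewrite /base !mulr_ge0 ?powR_ge0// ltW.
apply: (@le_trans _ _ (C1%:E * (base / (1 - ratio_cst `^ 2^-1))%:E)%E).
  apply: lee_wpmul2l => //; apply: nneseries_le => [j|J].
    by apply: integral_ge0 => z _; rewrite lee_fin mulr_ge0 ?powR_ge0// (weight_ge0 Aw).
  apply: (@le_trans _ _ (\sum_(0 <= j < J) (base * (ratio_cst `^ 2^-1) ^+ j)%:E)%E).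
    by apply: lee_sum => j _; exact: integral_level.
  rewrite sumEFin lee_fin -mulr_sumr ler_wpM2l//.
  exact: geometric_sum_le (ltW a3) a4.
rewrite -EFinM lee_fin le_eqVlt; apply/orP; left; apply/eqP.
by rewrite /main_cst -/s -/C1 /base; ring.
Qed.

End weighted.
End data.
End main_estimate.

(** * Passage to the weighted averages *)

Lemma measurable_row {R : realType} {n : nat} (U : set ('rV[R]_n * R))
    (F : 'rV[R]_n * R -> 'rV[R]_n) : measurable U ->
  (forall i, measurable_fun U (fun z => F z ord0 i)) -> measurable_fun U F.
Proof.
move=> mU mF.
apply: (@eq_measurable_fun _ _ _ _ U (fun z => \row_i ((fun z => F z ord0 i) \_ U) z)).
  by move=> z Uz; apply/rowP => i; rewrite mxE patchE Uz.
apply: measurable_funTS; apply/measurable_fun_rVP => i.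
apply: (@eq_measurable_fun _ _ _ _ setT ((fun z => F z ord0 i) \_ U)).
  by move=> z _; rewrite mxE.
exact: (measurable_restrictT (fun z => F z ord0 i) mU).1 (mF i).
Qed.

Lemma powRD_le {R : realType} (a b p : R) : 0 < p -> 0 <= a -> 0 <= b ->
  (a + b) `^ p <= 2 `^ p * (a `^ p + b `^ p).
Proof.
move=> p0 a0 b0.
wlog ab : a b a0 b0 / a <= b.
  move=> W; have [ab|/ltW ba] := leP a b; first exact: W.
  by rewrite addrC [X in _ * X]addrC; exact: W.
apply: (@le_trans _ _ ((2 * b) `^ p)).
  by apply: ge0_ler_powR; rewrite ?nnegrE ?(ltW p0) ?addr_ge0 ?mulr_ge0//; lra.
by rewrite powRM// ler_wpM2l ?powR_ge0// lerDr powR_ge0.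
Qed.

Lemma power_mean_le {R : realType} (p k C r W X Z I : R) :
  0 < p -> 0 < k -> 0 < C -> 0 < r -> 0 < W -> 0 <= X -> 0 <= Z -> 0 <= I ->
  X <= 2 `^ p * Z ->
  I <= C * (r `^ (p * k) * (W * (X / W) `^ k)) ->
  (W^-1 * I) `^ (p * k)^-1 <=
    2 * C `^ (p * k)^-1 * r * (W^-1 * Z) `^ p^-1.
Proof.
move=> p0 k0 C0 r0 W0 X0 Z0 I0 XZ HI.
have s0 : 0 < p * k by rewrite mulr_gt0.
have XWq : X / W <= 2 `^ p * (W^-1 * Z).
  by rewrite mulrCA mulrC ler_pM2l ?invr_gt0.
have : 0 <= W^-1 * Z by rewrite mulr_ge0 ?invr_ge0 ?(ltW W0).
move: XWq; move: (W^-1 * Z) => q XWq q0.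
pose T := C `^ (p * k)^-1 * r * (2 * q `^ p^-1).
have T0 : 0 <= T by rewrite !mulr_ge0 ?powR_ge0 ?(ltW r0).
have -> : 2 * C `^ (p * k)^-1 * r * q `^ p^-1 = (T `^ (p * k)) `^ (p * k)^-1.
  by rewrite -powRrM mulfV ?gt_eqF// powRr1// /T; ring.
apply: ge0_ler_powR; rewrite ?nnegrE ?invr_ge0 ?powR_ge0 ?(ltW s0)//.
  by rewrite mulr_ge0 ?invr_ge0 ?(ltW W0).
have -> : T `^ (p * k) = C * (r `^ (p * k) * (2 `^ p * q) `^ k).
  rewrite /T !powRM ?mulr_ge0 ?powR_ge0 ?(ltW r0)// -[in LHS]mulrA.
  rewrite -!powRrM mulVf ?gt_eqF// powRr1 ?(ltW C0)//.
  by rewrite [p^-1 * _]mulrA mulVf ?gt_eqF// mul1r.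
apply: (@le_trans _ _ (C * (r `^ (p * k) * (X / W) `^ k))).
  rewrite ler_pdivrMl//; apply: le_trans HI _.
  by rewrite le_eqVlt; apply/orP; left; apply/eqP; ring.
rewrite ler_pM2l// ler_wpM2l ?powR_ge0//.
apply: ge0_ler_powR; rewrite ?nnegrE ?(ltW k0)//.
  by rewrite divr_ge0// ltW.
by rewrite mulr_ge0 ?powR_ge0.
Qed.

Section conclusion.
Context {R : realType} {n : nat}.
Local Notation V := ('rV[R]_n * measurableTypeR R)%type.
Local Notation mu := (@lebesgue_xt R n).
Variables (p A k C : R) (w : V -> R) (r : R).
Variables (u ut : V -> R) (Du : V -> 'rV[R]_n) (D2u : V -> 'M[R]_n).
Local Notation Q := (@pcube R n r 0 : set V).
Hypotheses (n0 : (0 < n)%N) (p1 : 1 < p) (k1 : 1 < k) (r0 : 0 < r).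
Hypotheses (Aw : Ap_weight p w) (ApA : Ap_const p w = A%:E).
Hypotheses (ratio1 : ratio_cst (n := n) p A k < 1).
Hypothesis Hu : W21_1 Q u ut Du D2u.
Hypotheses (mut : measurable_fun Q ut) (mD2 : measurable_fun Q (fun z => euclid (D2u z))).
Let Zut : \bar R := (\int[mu]_(z in Q) (`|ut z| `^ p * w z)%:E)%E.
Let ZD2 : \bar R := (\int[mu]_(z in Q) (`|euclid (D2u z)| `^ p * w z)%:E)%E.
Let Z : \bar R :=
  (\int[mu]_(z in Q) ((euclid (D2u z) `^ p + `|ut z| `^ p) * w z)%:E)%E.
Hypotheses (Zut_lty : (Zut < +oo)%E) (ZD2_lty : (ZD2 < +oo)%E).

Let p0 : 0 < p. Proof. by move: p1; lra. Qed.
Let k0 : 0 < k. Proof. by move: k1; lra. Qed.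
Let s0 : 0 < p * k. Proof. by rewrite mulr_gt0. Qed.
Let mQ : measurable Q. Proof. exact: measurable_pcube. Qed.
Let mw : measurable_fun Q w. Proof. exact: weight_measurable Aw _. Qed.
Let w0 z : 0 <= w z. Proof. exact: weight_ge0 Aw z. Qed.

Let mpow (f : V -> R) e : measurable_fun Q f -> measurable_fun Q (fun z => f z `^ e * w z).
Proof.
move=> mf; apply: measurable_funM => //.
exact: (@measurableT_comp _ _ _ _ _ _ (@powR R ^~ e) _ f).
Qed.

Let mnut : measurable_fun Q (fun z => `|ut z|).
Proof. exact: (@measurableT_comp _ _ _ _ _ _ (fun x : R => `|x|) _ ut). Qed.

Let msource : measurable_fun Q (source ut D2u).
Proof. exact: measurable_funD. Qed.

Let Z_ge0 : (0 <= Z)%E.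
Proof. by apply: integral_ge0 => z _; rewrite lee_fin mulr_ge0 ?addr_ge0 ?powR_ge0. Qed.

Let ZE : Z = (ZD2 + Zut)%E.
Proof.
rewrite /Z /ZD2 /Zut -ge0_integralD//.
- by apply: eq_integral => z _; rewrite -EFinD -mulrDl (ger0_norm (euclid_ge0 (D2u z))).
- by move=> z _; rewrite lee_fin mulr_ge0 ?powR_ge0.
- apply/measurable_EFinP; apply: mpow.
  exact: (@measurableT_comp _ _ _ _ _ _ (fun x : R => `|x|) _ (fun z => euclid (D2u z))).
- by move=> z _; rewrite lee_fin mulr_ge0 ?powR_ge0.
- by apply/measurable_EFinP; exact: mpow.
Qed.

Let Z_fin : Z \is a fin_num.
Proof. by rewrite (ge0_fin_numE Z_ge0) ZE; exact: lte_add_pinfty ZD2_lty Zut_lty. Qed.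

Let X : \bar R := (\int[mu]_(z in Q) (source ut D2u z `^ p * w z)%:E)%E.

Let X_ge0 : (0 <= X)%E.
Proof. by apply: integral_ge0 => z _; rewrite lee_fin mulr_ge0 ?powR_ge0. Qed.

Let X_le : (X <= (2 `^ p)%:E * Z)%E.
Proof.
have mZ : measurable_fun Q (fun z => (euclid (D2u z) `^ p + `|ut z| `^ p) * w z).
  rewrite (_ : (fun z => _) = (fun z => euclid (D2u z) `^ p * w z) \+
    (fun z => `|ut z| `^ p * w z)); last by apply/funext => z; rewrite mulrDl.
  by apply: measurable_funD; exact: mpow.
rewrite /X /Z -ge0_integralZl//; last 2 first.
- exact/measurable_EFinP.
- by move=> z _; rewrite lee_fin mulr_ge0 ?addr_ge0 ?powR_ge0.
apply: ge0_le_integral => //.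
- by move=> z _; rewrite lee_fin mulr_ge0 ?powR_ge0.
- by apply/measurable_EFinP; exact: mpow.
- by apply: measurable_funeM; exact/measurable_EFinP.
- move=> z _; rewrite -EFinM lee_fin mulrA ler_wpM2r//.
  exact: powRD_le (euclid_ge0 _) _.
Qed.

Let X_lty : (X < +oo)%E.
Proof. by apply: le_lt_trans X_le _; rewrite lte_mul_pinfty ?lee_fin ?powR_ge0// -ge0_fin_numE. Qed.

Let Isource : L1 Q (source ut D2u).
Proof.
apply/integrableP; split; first exact/measurable_EFinP.
under eq_integral => z _ do rewrite /= ger0_norm ?source_ge0//.
exact: (@integral_lty_cube R n p w p1 Aw r 0 _ r0 (source_ge0 ut D2u)).
Qed.

Let osc z := euclid (Du z - mean_rV Q Du).
Let I : \bar R := (\int[mu]_(z in Q) (osc z `^ (p * k) * w z)%:E)%E.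

Let W : R := wR w Q.
Let W0 : 0 < W. Proof. exact: (wR_gt0 p1 Aw 0 r0). Qed.

Let I_le : (I <= (main_cst (n := n) p A k * (r `^ (p * k) * (W * (fine X / W) `^ k)))%:E)%E.
Proof. exact: (main_integral r0 Hu Isource p1 Aw ApA k1 msource X_lty n0 ratio1). Qed.

Let I_ge0 : (0 <= I)%E.
Proof. by apply: integral_ge0 => z _; rewrite lee_fin mulr_ge0 ?powR_ge0. Qed.

Let I_fin : I \is a fin_num.
Proof. by rewrite (ge0_fin_numE I_ge0); exact: le_lt_trans I_le (ltry _). Qed.

Lemma wmean_fine (f : V -> R) : (0 <= \int[mu]_(z in Q) (f z * w z)%:E)%E ->
  (\int[mu]_(z in Q) (f z * w z)%:E)%E \is a fin_num ->
  wmean w Q f = (W^-1 * fine (\int[mu]_(z in Q) (f z * w z)%:E)%E)%:E.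
Proof.
move=> f0 ff; rewrite /wmean (wRE Aw) inver gt_eqF// EFinM fineK//.
Qed.

(** Only [X], the integral of (|D^2u| + |u_t|)^p, enters the dyadic estimate; it is at
    most 2^p times the integral of |D^2u|^p + |u_t|^p, whence the factor 2. *)
Lemma wmean_estimate : main_cst (n := n) p A k <= C -> 0 < C ->
  (wmean w Q (fun z => osc z `^ (p * k))%R `^ (p * k)^-1%R <=
   (2 * C `^ (p * k)^-1 * r)%:E *
     wmean w Q (fun z => euclid (D2u z) `^ p + `|ut z| `^ p)%R `^ p^-1%R)%E.
Proof.
move=> HC C0; rewrite (wmean_fine I_ge0 I_fin) (wmean_fine Z_ge0 Z_fin).
rewrite !poweR_EFin -EFinM lee_fin.
have X_fin : X \is a fin_num by rewrite (ge0_fin_numE X_ge0).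
have fineM_le (a : R) (x y : \bar R) : x \is a fin_num -> y \is a fin_num ->
    (x <= a%:E * y)%E -> fine x <= a * fine y.
  by move=> xf yf; rewrite -lee_fin EFinM !fineK.
have fine_le_real (b : R) (x : \bar R) : x \is a fin_num -> (x <= b%:E)%E -> fine x <= b.
  by move=> xf; rewrite -lee_fin fineK.
have base0 (x : R) : 0 <= r `^ (p * k) * (W * (x / W) `^ k).
  by rewrite !mulr_ge0 ?powR_ge0 ?(ltW W0).
exact: (power_mean_le p0 k0 C0 r0 W0 (fine_ge0 X_ge0) (fine_ge0 Z_ge0) (fine_ge0 I_ge0)
  (fineM_le _ _ _ X_fin Z_fin X_le)
  (le_trans (fine_le_real _ _ I_fin I_le) (ler_wpM2r (base0 _) HC))).
Qed.

(** The oscillation has finite weighted norm by the dyadic estimate, and the mean is a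
    constant, integrable because the weight is locally integrable. *)
Lemma Lpw_gradient : Lpw_rV (p * k) w Q Du.
Proof.
have mDu i : measurable_fun Q (fun z => Du z ord0 i).
  have [_ _ HD _] := Hu; apply/measurable_EFinP; exact: (measurable_int mu (HD i).1).
split; first exact: measurable_row.
have mosc : measurable_fun Q osc.
  apply: measurable_euclid => i l; rewrite (ord1 i).
  rewrite (_ : (fun z => _) = (fun z => Du z ord0 l - mean Q (fun z => Du z ord0 l))); last first.
    by apply/funext => z; rewrite mean_rVE.
  exact: measurable_funB.
pose M := euclid (mean_rV Q Du).
pose c := (n%:R * 2) `^ (p * k).
have c0 : 0 <= c by exact: powR_ge0.
have M0 : 0 <= M `^ (p * k) by exact: powR_ge0.
have H z : euclid (Du z) `^ (p * k) * w z <=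
    c * (osc z `^ (p * k) * w z) + c * M `^ (p * k) * w z.
  have E : euclid (Du z) <= n%:R * (osc z + M).
    apply: euclid_le_row => [|i]; first by rewrite addr_ge0 ?euclid_ge0.
    have -> : Du z ord0 i = (Du z - mean_rV Q Du) ord0 i + mean_rV Q Du ord0 i.
      by rewrite !mxE subrK.
    by rewrite (le_trans (ler_normD _ _))// lerD// entry_le_euclid.
  have -> : c * (osc z `^ (p * k) * w z) + c * M `^ (p * k) * w z =
    c * (osc z `^ (p * k) + M `^ (p * k)) * w z by ring.
  rewrite ler_wpM2r//.
  apply: (@le_trans _ _ ((n%:R * (osc z + M)) `^ (p * k))).
    apply: ge0_ler_powR; rewrite ?nnegrE ?(ltW s0) ?euclid_ge0//.
    by rewrite mulr_ge0// addr_ge0 ?euclid_ge0.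
  rewrite /c !powRM ?addr_ge0 ?euclid_ge0// -mulrA ler_wpM2l ?powR_ge0//.
  by apply: powRD_le; rewrite ?euclid_ge0.
apply: (@le_lt_trans _ _ (c%:E * I + (c * M `^ (p * k))%:E * wmeasure w Q)%E).
  have -> : (c%:E * I = \int[mu]_(z in Q) (c%:E * (osc z `^ (p * k) * w z)%:E))%E.
    rewrite -ge0_integralZl//; first by apply/measurable_EFinP; exact: mpow.
    by move=> z _; rewrite lee_fin mulr_ge0 ?powR_ge0.
  have -> : ((c * M `^ (p * k))%:E * wmeasure w Q =
      \int[mu]_(z in Q) ((c * M `^ (p * k))%:E * (w z)%:E))%E.
    rewrite -ge0_integralZl//; first exact/measurable_EFinP.
    - by move=> z _; rewrite lee_fin.
    - by rewrite lee_fin mulr_ge0.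
  rewrite -ge0_integralD//; first last.
  - by apply: measurable_funeM; exact/measurable_EFinP.
  - by move=> z _; rewrite -EFinM lee_fin !mulr_ge0.
  - by apply: measurable_funeM; apply/measurable_EFinP; exact: mpow.
  - by move=> z _; rewrite -EFinM lee_fin !mulr_ge0 ?powR_ge0.
  apply: ge0_le_integral => //.
  - by move=> z _; rewrite lee_fin mulr_ge0 ?powR_ge0.
  - apply/measurable_EFinP; apply: mpow; apply: measurable_euclid => i l.
    by rewrite (ord1 i).
  - apply: emeasurable_funD; apply: measurable_funeM; apply/measurable_EFinP => //.
    exact: mpow.
  - by move=> z _; rewrite -!EFinM -EFinD lee_fin.
apply: lte_add_pinfty; last by rewrite (wRE Aw) -EFinM; exact: ltry.
by rewrite -(fineK I_fin) -EFinM; exact: ltry.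
Qed.

End conclusion.

Theorem theorem4p1 (R : realType) (n : nat) (p A : R) (n_ge1 : (1 <= n)%N)
    (p_gt1 : 1 < p) :
  exists delta c : R, let k := n.+2%:R / n.+1%:R + delta in
    [/\ 0 < delta, 0 < c, 1 < k &
    forall w : 'rV[R]_n * R -> R, Ap_weight p w -> Ap_const p w = A%:E ->
    forall r : R, 0 < r -> let Q := pcube r 0 in
    forall (u ut : 'rV[R]_n * R -> R) (Du : 'rV[R]_n * R -> 'rV[R]_n)
           (D2u : 'rV[R]_n * R -> 'M[R]_n),
    W21_1 Q u ut Du D2u ->
    Lpw p w Q ut -> Lpw p w Q (fun z => euclid (D2u z)) ->
    Lpw_rV (p * k) w Q Du /\
    (wmean w Q (fun z => euclid (Du z - mean_rV Q Du) `^ (p * k))%R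
       `^ (p * k)^-1%R
     <= (c * r)%:E *
        wmean w Q (fun z => euclid (D2u z) `^ p + `|ut z| `^ p)%R `^ p^-1%R)%E].
Proof.
have frac1 : 1 < n.+2%:R / n.+1%:R :> R by rewrite ltr_pdivlMr// mul1r ltr_nat.
have [A1|A1] := ltP A 1.
  (* no A_p weight has constant below 1 *)
  exists 1, 1; split; [exact: ltr01|exact: ltr01| |].
    by rewrite (lt_le_trans frac1)// lerDl.
  move=> w Aw ApA; exfalso; move: A1; rewrite ltNge => /negP; apply.
  exact: (Ap_ge1 p_gt1 Aw ApA).
have p0 : 0 < p by lra.
have /andP[e0 e1] := @eta_bound R n p A p_gt1 A1.
have th : 0 < 1 - eta (n := n) p A < 1 by apply/andP; split; lra.
have [delta d0] := exponent_choice n p_gt1 th.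
move=> /=; set k := _ + delta => ratio1.
have k1 : 1 < k by rewrite ltr_wpDr// ltW.
have s0 : 0 < p * k by rewrite mulr_gt0//; lra.
(* the constants are chosen before any weight, hence before [main_cst] is known
   to be positive *)
pose C := Num.max (main_cst (n := n) p A k) 1.
have C0 : 0 < C by rewrite lt_max ltr01 orbT.
exists delta, (2 * C `^ (p * k)^-1); rewrite -/k; split; [exact: d0| |exact: k1|].
  by rewrite mulr_gt0// powR_gt0.
move=> w Aw ApA r r0 u ut Du D2u Hu [mut Zut] [mD2 ZD2].
split; first exact: (Lpw_gradient n_ge1 p_gt1 k1 r0 Aw ApA ratio1 Hu mut mD2 Zut ZD2).
apply: (wmean_estimate n_ge1 p_gt1 k1 r0 Aw ApA ratio1 Hu mut mD2 Zut ZD2) => //.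
by rewrite le_max lexx.
Qed.
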